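(* Let $X$ be a Banach space, let $A:D(A)\subset X\to X$ be a positive operator, and let $$\Lambda_4=\begin{pmatrix}0&0&-I\\ 0&A&0\\ A&0&0\end{pmatrix},$$ regarded as an operator in $X^{\frac12}\times X\times X$ with domain $D(\Lambda_4)=X^{1}\times X^{1}\times X^{\frac12}$. Then for all $\alpha\in(0,1)$, $$\Lambda_4^{-\alpha}=\begin{pmatrix}\cos(\frac{\pi\alpha}{2})A^{-\frac{\alpha}{2}}&0&\sin(\frac{\pi\alpha}{2})A^{-\frac{\alpha+1}{2}}\\ 0&A^{-\alpha}&0\\ -\sin(\frac{\pi\alpha}{2})A^{\frac{1-\alpha}{2}}&0&\cos(\frac{\pi\alpha}{2})A^{-\frac{\alpha}{2}}\end{pmatrix},\qquad \Lambda_4^{-\alpha}\in\mathcal L(X^{\frac12}\times X\times X),$$ and $$\Lambda_4^{\alpha}=\begin{pmatrix}\cos(\frac{\pi\alpha}{2})A^{\frac{\alpha}{2}}&0&-\sin(\frac{\pi\alpha}{2})A^{\frac{\alpha-1}{2}}\\ 0&A^{\alpha}&0\\ \sin(\frac{\pi\alpha}{2})A^{\frac{1+\alpha}{2}}&0&\cos(\frac{\pi\alpha}{2})A^{\frac{\alpha}{2}}\end{pmatrix},\qquad D(\Lambda_4^{\alpha})=X^{\frac{1+\alpha}{2}}\times X^{\alpha}\times X^{\frac{\alpha}{2}}.$$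
   Context: A closed densely defined operator $A:D(A)\subset X\to X$ on a Banach space $X$ is called positive if there is $M\ge 1$ such that $[0,\infty)\subset\rho(-A)$ and $(1+s)\|(s+A)^{-1}\|_{\mathcal L(X)}\le M$ for all real $s>0$. Fractional powers of a positive operator $A$: for $\alpha>0$, $A^{-\alpha}:=\frac{1}{2\pi i}\int_\Gamma(-\lambda)^{-\alpha}(\lambda+A)^{-1}\,d\lambda\in\mathcal L(X)$ (principal branch), where $\Gamma$ is a contour from $\infty e^{-i\psi}$ to $\infty e^{i\psi}$ lying in $(\{|\arg z|\le\psi\}\cup B(0,r_0))\setminus[0,\infty)$, with $0<\psi<\arcsin(\frac1{2M})$ and $0<r_0<\frac1{2M}$. For $\alpha\in(0,1)$ this equals $\frac{\sin(\pi\alpha)}{\pi}\int_0^\infty s^{-\alpha}(s+A)^{-1}ds$. The operator $A^{-\alpha}$ is injective, and $A^{\alpha}:=(A^{-\alpha})^{-1}$ with domain $D(A^\alpha)=R(A^{-\alpha})$ (the range). $X^{\alpha}$ denotes $D(A^\alpha)$ equipped with the graph norm. The operator $\Lambda_4$ is a positive operator on the Banach space $X^{\frac12}\times X\times X$, and its fractional powers are those of a positive operator on that space. Entries of the matrices are understood as operators between the corresponding components (restricted to the relevant subspaces). *)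

(* Defs.v *)
From Stdlib Require Import Reals Lra ProofIrrelevance.
From Coquelicot Require Import Coquelicot.

Set Implicit Arguments.
Unset Strict Implicit.
Unset Printing Implicit Defensive.

Open Scope R_scope.

(** * Linear relations

    An (unbounded) operator from [U] to [V] is represented by its graph, a
    linear subspace of [U * V].  Single-valuedness is the separate predicate
    [functional].  Equality of operators, domains included, is [lrel_eq]. *)

Notation CNormedModule := (NormedModule C_AbsRing).

(** [scal_distr_l] with both sides in terms of the normed module structure. *)
Lemma Cscal_plus (V : CNormedModule) (c : C) (u v : V) :
  scal c (plus u v) = plus (scal c u) (scal c v).
Proof. exact (scal_distr_l c u v). Qed.

Record lrel (U V : CNormedModule) := Lrel {
  lrel_rel :> U -> V -> Prop;
  lrel_zero : lrel_rel zero zero;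
  lrel_plus : forall u u' v v',
    lrel_rel u v -> lrel_rel u' v' -> lrel_rel (plus u u') (plus v v');
  lrel_scal : forall (c : C) u v,
    lrel_rel u v -> lrel_rel (scal c u) (scal c v) }.

Definition lrel_eq (U V : CNormedModule) (S T : lrel U V) : Prop :=
  forall u v, S u v <-> T u v.

Definition dom (U V : CNormedModule) (T : lrel U V) (u : U) : Prop :=
  exists v, T u v.

Definition functional (U V : CNormedModule) (T : lrel U V) : Prop :=
  forall u v v', T u v -> T u v' -> v = v'.

Definition closed_graph (U V : CNormedModule) (T : lrel U V) : Prop :=
  closed (fun p : U * V => T (fst p) (snd p)).

Definition densely_defined (U V : CNormedModule) (T : lrel U V) : Prop :=
  forall (u : U) (eps : R), 0 < eps ->
    exists w, dom T w /\ norm (minus w u) < eps.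

(** [T] is (the graph of) an everywhere defined bounded operator; boundedness
    is part of Coquelicot's [is_linear]. *)
Definition bounded_op (U V : CNormedModule) (T : lrel U V) : Prop :=
  exists f : U -> V, is_linear f /\ forall u v, T u v <-> f u = v.

Section Constructions.
Variables U V : CNormedModule.

Program Definition lzero : lrel U V :=
  Lrel (lrel_rel := fun _ v => v = zero) _ _ _.
Next Obligation. apply plus_zero_l. Qed.
Next Obligation. exact (scal_zero_r c). Qed.

Program Definition lid : lrel U U :=
  Lrel (lrel_rel := fun u v => v = u) _ _ _.

Program Definition linv (T : lrel U V) : lrel V U :=
  Lrel (lrel_rel := fun v u => T u v) _ _ _.
Next Obligation. apply lrel_zero. Qed.
Next Obligation. apply lrel_plus; assumption. Qed.
Next Obligation. apply lrel_scal; assumption. Qed.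

Program Definition lscal (c : C) (T : lrel U V) : lrel U V :=
  Lrel (lrel_rel := fun u v => exists w, T u w /\ v = scal c w) _ _ _.
Next Obligation.
exists zero; split; [apply lrel_zero | symmetry; exact (scal_zero_r c)].
Qed.
Next Obligation.
rename H0 into w, H into w'; exists (plus w' w); split.
- apply lrel_plus; assumption.
- symmetry; exact (scal_distr_l c _ _).
Qed.
Next Obligation.
rename H into w; exists (scal c0 w); split.
- apply lrel_scal; assumption.
- rewrite 2!scal_assoc; f_equal; apply Cmult_comm.
Qed.

(** [lambda + T] *)
Program Definition lshift (c : C) (T : lrel U U) : lrel U U :=
  Lrel (lrel_rel := fun u v => exists w, T u w /\ v = plus (scal c u) w) _ _ _.
Next Obligation.
exists zero; split; [apply lrel_zero |].
rewrite plus_zero_r; symmetry; exact (scal_zero_r c).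
Qed.
Next Obligation.
rename H0 into w, H into w'; exists (plus w' w); split.
- apply lrel_plus; assumption.
- rewrite Cscal_plus, <- 2!plus_assoc; f_equal.
  rewrite 2!plus_assoc; f_equal; apply plus_comm.
Qed.
Next Obligation.
rename H into w; exists (scal c0 w); split.
- apply lrel_scal; assumption.
- rewrite Cscal_plus, 2!scal_assoc; do 2 f_equal; apply Cmult_comm.
Qed.

End Constructions.

Arguments lzero {U V}.
Arguments lid {U}.

(** [(lambda + T)^-1] *)
Definition resolvent (U : CNormedModule) (T : lrel U U) (c : C) : lrel U U :=
  linv (lshift c T).

(** [positive_with T M]: [T] is a positive operator, with constant [M].
    A point [c] is in the resolvent set of [- T] iff [resolvent T c] is an
    everywhere defined bounded operator. *)
Definition positive_with (U : CNormedModule) (T : lrel U U) (M : R) : Prop :=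
  1 <= M /\ functional T /\ closed_graph T /\ densely_defined T /\
  (forall s : R, 0 <= s -> bounded_op (resolvent T (RtoC s))) /\
  (forall s : R, 0 < s -> forall x y, resolvent T (RtoC s) x y ->
     (1 + s) * norm y <= M * norm x).

Definition positive_op (U : CNormedModule) (T : lrel U U) : Prop :=
  exists M, positive_with T M.

(** Coquelicot integrates functions valued in real normed modules: restriction
    of scalars of a complex normed module. *)
Section RestrictScalars.
Variable V : CNormedModule.

Lemma restr_scal_assoc (x y : R) (u : V) :
  scal (RtoC x) (scal (RtoC y) u) = scal (RtoC (x * y)) u.
Proof. rewrite scal_assoc, RtoC_mult; reflexivity. Qed.

Lemma restr_scal_plus (x y : R) (u : V) :
  scal (RtoC (x + y)) u = plus (scal (RtoC x) u) (scal (RtoC y) u).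
Proof. rewrite RtoC_plus; exact (scal_distr_r (RtoC x) (RtoC y) u). Qed.

Lemma restr_norm_scal (x : R) (u : V) :
  norm (scal (RtoC x) u) <= Rabs x * norm u.
Proof. rewrite <- Cmod_R; exact (norm_scal (RtoC x) u). Qed.

Definition restr_ModuleSpace_mixin : ModuleSpace.mixin_of R_Ring V :=
  ModuleSpace.Mixin R_Ring V (fun (x : R) (u : V) => scal (RtoC x) u)
    restr_scal_assoc (@scal_one _ V)
    (fun x u v => scal_distr_l (RtoC x) u v) restr_scal_plus.

Definition restr_NormedModuleAux : NormedModuleAux R_AbsRing :=
  NormedModuleAux.Pack R_AbsRing V
    (NormedModuleAux.Class R_AbsRing V
      (ModuleSpace.Class R_Ring V _ restr_ModuleSpace_mixin)
      (UniformSpace.class V)) V.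

Definition restr_NormedModule_mixin :
    NormedModule.mixin_of R_AbsRing restr_NormedModuleAux :=
  NormedModule.Mixin R_AbsRing restr_NormedModuleAux
    (fun u : V => norm u) (@norm_factor _ V) (@norm_triangle _ V)
    restr_norm_scal (@norm_compat1 _ V) (@norm_compat2 _ V)
    (@norm_eq_zero _ V).

Definition restr : NormedModule R_AbsRing :=
  NormedModule.Pack R_AbsRing V
    (NormedModule.Class R_AbsRing V _ restr_NormedModule_mixin) V.

End RestrictScalars.

(** Integral of [f] along the path [g], whose derivative is [g'], the parameter
    running between the ends given by the filters [Fa] and [Fb]. *)
Definition is_path_int (V : CNormedModule) (f : C -> V) (g g' : R -> C)
    (Fa Fb : (R -> Prop) -> Prop) (l : V) : Prop :=
  @is_RInt_gen (restr V) (fun t => scal (g' t) (f (g t))) Fa Fb l.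

Definition cis (t : R) : C := (cos t, sin t).

(** The contour from [oo e^(-i psi)] to [oo e^(i psi)]: the ray of argument
    [- psi] down to modulus [r], the circle of radius [r] run clockwise from
    argument [- psi] through [- PI] to [psi - 2 PI], and the ray of argument
    [psi]. *)
Definition ray (t r : R) : C := (RtoC r * cis t)%C.

Definition on_contour (psi r : R) (z : C) : Prop :=
  (exists t, r <= t /\ (z = ray (- psi) t \/ z = ray psi t)) \/
  (exists t, psi - 2 * PI <= t <= - psi /\ z = ray t r).

Definition is_contour_int (V : CNormedModule) (psi r : R) (f : C -> V)
    (l : V) : Prop :=
  exists l1 l2 l3 : V,
    is_path_int f (ray (- psi)) (fun _ => cis (- psi))
      (Rbar_locally p_infty) (at_point r) l1 /\
    is_path_int f (fun t => ray t r) (fun t => (Ci * ray t r)%C)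
      (at_point (- psi)) (at_point (psi - 2 * PI)) l2 /\
    is_path_int f (ray psi) (fun _ => cis psi)
      (at_point r) (Rbar_locally p_infty) l3 /\
    l = plus (plus l1 l2) l3.

(** Principal argument, in ]-PI, PI], and principal branch of the power. *)
Definition Carg (z : C) : R :=
  if Rlt_dec (Im z) 0 then - acos (Re z / Cmod z) else acos (Re z / Cmod z).

Definition Cpower (z : C) (b : R) : C :=
  (RtoC (Rpower (Cmod z) b) * cis (b * Carg z))%C.

Section ContourLinear.
Variable V : CNormedModule.

Lemma Riemann_sum_Cscal (f : R -> V) (c : C) ptd :
  @Riemann_sum (restr V) (fun t => scal c (f t)) ptd =
  scal c (@Riemann_sum (restr V) f ptd : V).
Proof.
apply (SF_cons_ind (T := R) (fun p =>
  @Riemann_sum (restr V) (fun t => scal c (f t)) p =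
  scal c (@Riemann_sum (restr V) f p : V))).
- intros x0; symmetry; exact (scal_zero_r c).
- intros h p IH.
  rewrite 2!Riemann_sum_cons, IH.
  symmetry; etransitivity; [exact (scal_distr_l c _ _) |].
  change (plus (scal c (scal (RtoC (SF_h p - fst h)) (f (snd h))))
            (scal c (@Riemann_sum (restr V) f p : V)) =
          plus (scal (RtoC (SF_h p - fst h)) (scal c (f (snd h))))
            (scal c (@Riemann_sum (restr V) f p : V))).
  f_equal; rewrite 2!scal_assoc; f_equal; apply Cmult_comm.
Qed.

Lemma is_RInt_Cscal (f : R -> V) (c : C) a b (l : V) :
  @is_RInt (restr V) f a b l ->
  @is_RInt (restr V) (fun t => scal c (f t)) a b (scal c l).
Proof.
intros Hf.
assert (Hl : filterlim (fun v : V => scal c v) (locally l)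
               (locally (scal c l))) by exact (filterlim_scal_r c l).
assert (H := filterlim_comp _ _ _ _ _ _ _ _ Hf Hl).
refine (filterlim_ext _ _ _ H).
intros ptd; rewrite Riemann_sum_Cscal.
change (scal c (scal (RtoC (sign (b - a))) (@Riemann_sum (restr V) f ptd : V))
      = scal (RtoC (sign (b - a))) (scal c (@Riemann_sum (restr V) f ptd : V))).
rewrite 2!scal_assoc; f_equal; apply Cmult_comm.
Qed.

Variables (g g' : R -> C) (Fa Fb : (R -> Prop) -> Prop).
Context {FFa : Filter Fa} {FFb : Filter Fb}.

Lemma is_path_int_zero (f : C -> V) :
  (forall t, f (g t) = zero) -> is_path_int f g g' Fa Fb zero.
Proof.
intros Hf P HP; unfold filtermapi.
apply filter_forall; intros ab; exists zero; split;
  [| exact (locally_singleton _ _ HP)].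
apply (is_RInt_ext (V := restr V) (fun _ => zero)).
- intros t _; rewrite Hf; symmetry; exact (scal_zero_r (g' t)).
- exact (eq_ind _ (@is_RInt (restr V) (fun _ => zero) (fst ab) (snd ab))
    (is_RInt_const (V := restr V) (fst ab) (snd ab) zero) _ (scal_zero_r _)).
Qed.

Lemma is_path_int_plus (f h k : C -> V) (l m : V) :
  (forall z, k z = plus (f z) (h z)) ->
  is_path_int f g g' Fa Fb l -> is_path_int h g g' Fa Fb m ->
  is_path_int k g g' Fa Fb (plus l m).
Proof.
intros E Hf Hh.
refine (is_RInt_gen_ext _ _ _ _ (is_RInt_gen_plus _ _ _ _ Hf Hh)).
apply filter_forall; intros ab x _; rewrite E; symmetry.
exact (Cscal_plus _ _ _).
Qed.

Lemma is_path_int_scal (f k : C -> V) (c : C) (l : V) :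
  (forall z, k z = scal c (f z)) ->
  is_path_int f g g' Fa Fb l -> is_path_int k g g' Fa Fb (scal c l).
Proof.
intros E Hf P HP.
assert (Hl : filterlim (fun v : V => scal c v) (locally l)
               (locally (scal c l))) by exact (filterlim_scal_r c l).
specialize (Hf _ (Hl _ HP)); revert Hf; unfold filtermapi.
apply filter_imp; intros ab [v [Hv Pv]].
exists (scal c v); split; [| exact Pv].
apply (is_RInt_ext (V := restr V)
         (fun t => scal c (scal (g' t) (f (g t))))).
- intros t _; rewrite E, 2!scal_assoc; f_equal; apply Cmult_comm.
- exact (is_RInt_Cscal Hv).
Qed.

End ContourLinear.

Lemma plus_plus_swap (G : AbelianGroup) (x y z t : G) :
  plus (plus x y) (plus z t) = plus (plus x z) (plus y t).
Proof.
rewrite <- 2!plus_assoc; f_equal.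
rewrite 2!plus_assoc; f_equal; apply plus_comm.
Qed.

Section NegPower.
Variables (U : CNormedModule) (T : lrel U U) (a : R).

(** [T^(-a) x = 1/(2 i PI) int (-z)^(-a) (z + T)^(-1) x dz] over the contour;
    [u z] is [(z + T)^(-1) x].  The value is required to be the same for all
    admissible choices of the constant [M] of [T] and of [psi] and [r].  If [T]
    is not positive the condition is void, so that every [x] is related to
    every [y]: [neg_power T] can be single-valued only for positive [T] (or on
    the zero space). *)
Definition neg_power_rel (x y : U) : Prop :=
  forall M psi r : R,
    positive_with T M ->
    0 < psi < asin (1 / (2 * M)) ->
    0 < r < 1 / (2 * M) ->
    exists (u : C -> U) (l : U),
      (forall z, on_contour psi r z -> resolvent T z x (u z)) /\
      is_contour_int psi r (fun z => scal (Cpower (- z) (- a)) (u z)) l /\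
      y = scal (/ (2 * RtoC PI * Ci))%C l.

Program Definition neg_power : lrel U U :=
  Lrel (lrel_rel := neg_power_rel) _ _ _.
Next Obligation.
intros M psi r _ _ _; exists (fun _ => zero), zero; split; [| split].
- intros z _; apply lrel_zero.
- exists zero, zero, zero; split; [| split; [| split]];
    [(apply is_path_int_zero; [exact _ | exact _ |];
      intros t; exact (scal_zero_r (Cpower _ _))) .. |].
  symmetry; exact (eq_trans (plus_zero_r _) (plus_zero_r _)).
- symmetry; exact (scal_zero_r _).
Qed.
Next Obligation.
rename u into x, u' into x', v into y, v' into y', H into H1, H0 into H2.
intros M psi r HM Hpsi Hr.
destruct (H1 M psi r HM Hpsi Hr)
  as (u & l & Hu & (l1 & l2 & l3 & I1 & I2 & I3 & ->) & ->).
destruct (H2 M psi r HM Hpsi Hr)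
  as (w & m & Hw & (m1 & m2 & m3 & J1 & J2 & J3 & ->) & ->).
exists (fun z => plus (u z) (w z)).
exists (plus (plus (plus l1 m1) (plus l2 m2)) (plus l3 m3)); split; [| split].
- intros z Hz; apply lrel_plus; auto.
- exists (plus l1 m1), (plus l2 m2), (plus l3 m3).
  split; [| split; [| split]]; [| | | reflexivity];
    (eapply is_path_int_plus;
      [exact _ | exact _ | intros z; apply Cscal_plus | eassumption ..]).
- refine (eq_trans (eq_sym (Cscal_plus _ _ _)) _); f_equal.
  rewrite (plus_plus_swap (plus l1 l2)), (plus_plus_swap l1); reflexivity.
Qed.
Next Obligation.
rename u into x, v into y, H into H1.
intros M psi r HM Hpsi Hr.
destruct (H1 M psi r HM Hpsi Hr)
  as (u & l & Hu & (l1 & l2 & l3 & I1 & I2 & I3 & ->) & ->).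
exists (fun z => scal c (u z)), (scal c (plus (plus l1 l2) l3)).
split; [| split].
- intros z Hz; apply lrel_scal; auto.
- exists (scal c l1), (scal c l2), (scal c l3).
  split; [| split; [| split]]; [| | | rewrite 2!Cscal_plus; reflexivity];
    (eapply is_path_int_scal; [exact _ | exact _ | | eassumption]);
    (intros z; rewrite 2!scal_assoc; f_equal; apply Cmult_comm).
- rewrite 2!scal_assoc; f_equal; apply Cmult_comm.
Qed.

End NegPower.

(** [T^b] for all real [b]; for [b > 0] it is the inverse of [T^(-b)], with
    domain the range of [T^(-b)]. *)
Definition frac_power (U : CNormedModule) (T : lrel U U) (b : R) : lrel U U :=
  if Rlt_dec b 0 then neg_power T (- b)
  else if Rlt_dec 0 b then linv (neg_power T b)
  else lid.

(** * Domains with the graph norm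

    [D(T)] with the graph norm is realised as the graph of [T], with the norm
    of [U * V], that is [sqrt (norm x ^ 2 + norm (T x) ^ 2)]. *)
Section GraphSpace.
Variables (U V : CNormedModule) (T : lrel U V).

Definition in_graph (p : U * V) : Prop := T (fst p) (snd p).

Definition graph : Type := {p : U * V | in_graph p}.

Lemma graph_inj (p q : graph) : proj1_sig p = proj1_sig q -> p = q.
Proof.
destruct p as [p hp], q as [q hq]; simpl; intros E; subst q.
f_equal; apply proof_irrelevance.
Qed.

Definition graph_plus (p q : graph) : graph :=
  exist in_graph (plus (proj1_sig p) (proj1_sig q))
    (lrel_plus (proj2_sig p) (proj2_sig q)).

Definition graph_scal (c : C) (p : graph) : graph :=
  exist in_graph (scal c (proj1_sig p)) (lrel_scal c (proj2_sig p)).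

Definition graph_zero : graph := exist in_graph zero (lrel_zero T).

Lemma graph_opp_proof (p : graph) :
  in_graph (opp (proj1_sig p)).
Proof.
refine (eq_ind _ in_graph _ _ (scal_opp_one (proj1_sig p))).
exact (lrel_scal (opp one) (proj2_sig p)).
Qed.

Definition graph_opp (p : graph) : graph := exist in_graph _ (graph_opp_proof p).

Definition graph_AbelianMonoid_mixin : AbelianMonoid.mixin_of graph.
Proof.
apply (AbelianMonoid.Mixin _ graph_plus graph_zero).
- intros p q; apply graph_inj, plus_comm.
- intros p q s; apply graph_inj, plus_assoc.
- intros p; apply graph_inj, plus_zero_r.
Defined.

Definition graph_AbelianMonoid : AbelianMonoid :=
  AbelianMonoid.Pack graph graph_AbelianMonoid_mixin graph.

Definition graph_AbelianGroup_mixin : AbelianGroup.mixin_of graph_AbelianMonoid.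
Proof.
apply (AbelianGroup.Mixin graph_AbelianMonoid graph_opp).
intros p; apply graph_inj; exact (plus_opp_r (proj1_sig p)).
Defined.

Definition graph_AbelianGroup : AbelianGroup :=
  AbelianGroup.Pack graph
    (AbelianGroup.Class graph graph_AbelianMonoid_mixin
      graph_AbelianGroup_mixin) graph.

Definition graph_ModuleSpace_mixin :
  ModuleSpace.mixin_of C_Ring graph_AbelianGroup.
Proof.
apply (ModuleSpace.Mixin C_Ring graph_AbelianGroup graph_scal).
- intros x y p; apply graph_inj; exact (scal_assoc x y (proj1_sig p)).
- intros p; apply graph_inj; exact (scal_one (proj1_sig p)).
- intros x p q; apply graph_inj.
  exact (scal_distr_l x (proj1_sig p) (proj1_sig q)).
- intros x y p; apply graph_inj; exact (scal_distr_r x y (proj1_sig p)).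
Defined.

Definition graph_UniformSpace_mixin : UniformSpace.mixin_of graph.
Proof.
apply (UniformSpace.Mixin _ graph_zero
         (fun p e q => ball (proj1_sig p) e (proj1_sig q))).
- intros p e; apply ball_center.
- intros p q e; apply ball_sym.
- intros p q s e1 e2; apply ball_triangle.
Defined.

Definition graph_NormedModuleAux : NormedModuleAux C_AbsRing :=
  NormedModuleAux.Pack C_AbsRing graph
    (NormedModuleAux.Class C_AbsRing graph
      (ModuleSpace.Class C_Ring graph _ graph_ModuleSpace_mixin)
      graph_UniformSpace_mixin) graph.

Definition graph_NormedModule_mixin :
  NormedModule.mixin_of C_AbsRing graph_NormedModuleAux.
Proof.
apply (NormedModule.Mixin C_AbsRing graph_NormedModuleAux
         (fun p : graph => norm (proj1_sig p))
         (norm_factor (V := prod_NormedModule C_AbsRing U V))).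
- intros p q; exact (norm_triangle (proj1_sig p) (proj1_sig q)).
- intros c p; exact (norm_scal c (proj1_sig p)).
- intros p q eps; exact (norm_compat1 (proj1_sig p) (proj1_sig q) eps).
- intros p q eps; exact (norm_compat2 (proj1_sig p) (proj1_sig q) eps).
- intros p Hp; apply graph_inj; exact (norm_eq_zero (proj1_sig p) Hp).
Defined.

Definition graph_space : CNormedModule :=
  NormedModule.Pack C_AbsRing graph
    (NormedModule.Class C_AbsRing graph _ graph_NormedModule_mixin) graph.

(** The inclusion of [D(T)] in [U]. *)
Definition graph_incl (p : graph_space) : U := fst (proj1_sig p).

(** Restriction of an operator on [U] to [D(T)], and an operator valued in [U]
    regarded as valued in [D(T)], for the arguments with values there. *)
Program Definition from_graph (W : CNormedModule) (S : lrel U W) :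
    lrel graph_space W :=
  Lrel (lrel_rel := fun p w => S (graph_incl p) w) _ _ _.
Next Obligation. apply lrel_zero. Qed.
Next Obligation. exact (lrel_plus H H0). Qed.
Next Obligation. exact (lrel_scal c H). Qed.

Program Definition to_graph (W : CNormedModule) (S : lrel W U) :
    lrel W graph_space :=
  Lrel (lrel_rel := fun w p => S w (graph_incl p)) _ _ _.
Next Obligation. apply lrel_zero. Qed.
Next Obligation. exact (lrel_plus H H0). Qed.
Next Obligation. exact (lrel_scal c H). Qed.

End GraphSpace.

Definition prod3 (U1 U2 U3 : CNormedModule) : CNormedModule :=
  prod_NormedModule _ (prod_NormedModule _ U1 U2) U3.

Section Matrix.
Variables U1 U2 U3 V V1 V2 V3 : CNormedModule.

Section Row.
Variables (T1 : lrel U1 V) (T2 : lrel U2 V) (T3 : lrel U3 V).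

Definition lrow_rel (u : prod3 U1 U2 U3) (v : V) : Prop :=
  exists w1 w2 w3 : V,
    T1 (fst (fst u)) w1 /\ T2 (snd (fst u)) w2 /\ T3 (snd u) w3 /\
    v = plus (plus w1 w2) w3.

Program Definition lrow : lrel (prod3 U1 U2 U3) V :=
  Lrel (lrel_rel := lrow_rel) _ _ _.
Next Obligation.
exists zero, zero, zero.
split; [| split; [| split]]; [apply lrel_zero .. |].
symmetry; exact (eq_trans (plus_zero_r _) (plus_zero_r _)).
Qed.
Next Obligation.
destruct H as (x1 & x2 & x3 & H1 & H2 & H3 & ->).
destruct H0 as (y1 & y2 & y3 & K1 & K2 & K3 & ->).
exists (plus x1 y1), (plus x2 y2), (plus x3 y3).
split; [| split; [| split]]; [apply lrel_plus; assumption .. |].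
rewrite (plus_plus_swap (plus x1 x2)), (plus_plus_swap x1); reflexivity.
Qed.
Next Obligation.
destruct H as (x1 & x2 & x3 & H1 & H2 & H3 & ->).
exists (scal c x1), (scal c x2), (scal c x3).
split; [| split; [| split]]; [apply lrel_scal; assumption .. |].
rewrite 2!Cscal_plus; reflexivity.
Qed.

End Row.

Program Definition lcol (U : CNormedModule)
    (T1 : lrel U V1) (T2 : lrel U V2) (T3 : lrel U V3) :
    lrel U (prod3 V1 V2 V3) :=
  Lrel (lrel_rel := fun u v =>
    T1 u (fst (fst v)) /\ T2 u (snd (fst v)) /\ T3 u (snd v)) _ _ _.
Next Obligation. repeat split; apply lrel_zero. Qed.
Next Obligation. repeat split; apply lrel_plus; assumption. Qed.
Next Obligation. repeat split; apply lrel_scal; assumption. Qed.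

End Matrix.

(** The operator with the given 3 x 3 matrix, on its natural domain. *)
Definition lmat3 (U1 U2 U3 V1 V2 V3 : CNormedModule)
    (T11 : lrel U1 V1) (T12 : lrel U2 V1) (T13 : lrel U3 V1)
    (T21 : lrel U1 V2) (T22 : lrel U2 V2) (T23 : lrel U3 V2)
    (T31 : lrel U1 V3) (T32 : lrel U2 V3) (T33 : lrel U3 V3) :
    lrel (prod3 U1 U2 U3) (prod3 V1 V2 V3) :=
  lcol (lrow T11 T12 T13) (lrow T21 T22 T23) (lrow T31 T32 T33).

(** [Xpow A b] is the space [X^b], for [b > 0]. *)
Definition Xpow (X : CNormedModule) (A : lrel X X) (b : R) : CNormedModule :=
  graph_space (frac_power A b).

Definition Xhalf3 (X : CNormedModule) (A : lrel X X) : CNormedModule :=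
  prod3 (Xpow A (1 / 2)) X X.

(** The entries act between the components; the natural domain of the matrix is
    the domain of [Lambda_4], see [dom_Lambda4]. *)
Definition Lambda4 (X : CNormedModule) (A : lrel X X) :
    lrel (Xhalf3 A) (Xhalf3 A) :=
  let B := frac_power A (1 / 2) in
  lmat3 lzero              lzero (to_graph B (lscal (RtoC (-1)) lid))
        lzero              A     lzero
        (from_graph B A)   lzero lzero.

Lemma dom_Lambda4 (X : CNormedModule) (A : lrel X X)
    (u : Xpow A (1 / 2)) (x2 x3 : X) :
  dom (Lambda4 A) (u, x2, x3) <->
  dom A (graph_incl u) /\ dom A x2 /\ dom (frac_power A (1 / 2)) x3.
Proof.
split.
- intros [v [R1 [R2 R3]]].
  destruct R1 as (_ & _ & p & _ & _ & [w [Hw Hp]] & _).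
  destruct R2 as (_ & y & _ & _ & Hy & _).
  destruct R3 as (z & _ & _ & Hz & _).
  split; [exists z; exact Hz | split; [exists y; exact Hy |]].
  destruct p as [[p q] Hpq]; unfold graph_incl in Hp; simpl in *; subst w p.
  exists (scal (RtoC (-1)) q).
  refine (eq_ind _ (fun x => frac_power A (1 / 2) x (scal (RtoC (-1)) q)) _ _ _).
  + exact (lrel_scal (RtoC (-1)) Hpq).
  + simpl; rewrite scal_assoc.
    replace (mult (RtoC (-1)) (RtoC (-1))) with (one : C_AbsRing).
    * exact (scal_one x3).
    * change (RtoC 1 = (RtoC (-1) * RtoC (-1))%C).
      rewrite <- RtoC_mult; f_equal; ring.
- intros [[z Hz] [[y Hy] [q Hq]]].
  pose (p := exist (in_graph (frac_power A (1 / 2)))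
    (scal (RtoC (-1)) x3, scal (RtoC (-1)) q) (lrel_scal (RtoC (-1)) Hq)
    : Xpow A (1 / 2)).
  exists (plus (plus zero zero) p, plus (plus zero y) zero,
          plus (plus z zero) zero).
  split; [| split].
  + exists zero, zero, p; repeat split; exists x3; split; reflexivity.
  + exists zero, y, zero; repeat split; exact Hy.
  + exists z, zero, zero; repeat split; exact Hz.
Qed.

(* Main.v *)
Require Import Defs.
From Stdlib Require Import Reals Lra Lia ClassicalEpsilon.
From Stdlib Require Import FunctionalExtensionality PropExtensionality.
From Coquelicot Require Import Coquelicot.
Open Scope R_scope.

(** On the contour the integrand is [f(w) dw], [z = e^w], with [f] holomorphic
    on the strip [- 2 pi <= Im w <= 0] near the contour.  Cauchy's theorem on
    rectangles collapses the contour onto the two sides of the cut and yields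
    Balakrishnan's formula
    [A^(-a) x = (sin (pi a) / pi) Int_R e^((1-a)t) (e^t + A)^(-1) x dt].
    The same theorem for [1 / (1 + e^w)], rotated by [pi / 2], gives
    [kappa(a/2) = 2 cos(pi a/2) kappa(a)] for
    [kappa(a) = Int_0^oo s^(-a) / (1 + s) ds], hence the reflection formula
    [kappa(a) sin(pi a) = pi], as [a kappa(a) -> 1] at [0].

    For the semigroup law, the functions [y(m) = (m + A)^(-a) x] solve
    [y' = - a (m + A)^(-1) y], so products of powers of total exponent [1] solve
    the equation of [(m + A)^(-1) x] and have the same asymptotics at infinity;
    [(m + A) y(m)] being constant, they coincide.

    Writing the first component as [A^(-1/2) h], the resolvent of [Lambda4] at
    [- s] acts on [(h, g)] by the entries [s (s^2 + A)^(-1)] and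
    [+- A^(1/2) (s^2 + A)^(-1)].  With [s^2 = e^t], Balakrishnan's integral for
    [Lambda4] reduces to those of [A] with exponents [a/2] and [(1+a)/2]; thus
    [Lambda4^(-a)] is [A^(-a/2)] times the rotation of angle [pi a/2]. *)

(* [neg_power] quantifies over every admissible constant, angle and radius; the half-line integral
   contains none of them, which is why one value serves them all. For [z = e^w] with
   [- 2 pi < Im w < 0] the principal logarithm of [- z] is [w + i pi], so [(- z)^(-a)] extends to an
   entire function of [w] that reaches both sides of the cut; its two phases there produce the sine.

   The shift [m] is introduced because at [m = 0] nothing singles out the right value of a product
   of powers, whereas [(m + A)^(-a)] behaves like [m^(-a)] at infinity whatever [A] is. The
   comparison is made with bounded resolvents only, so that no vector has to be shown to lie in a
   domain.

   The off-diagonal entries [A^(1/2) (s^2 + A)^(-1)] are not themselves Balakrishnan integrands of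
   [A]. The bounded injective operator [A^(-1/2)] turns them into one, of exponent [(1 + a) / 2],
   and the semigroup law then splits [A^(-1/2)] off again. The constants are [kappa (a / 2)] and
   [kappa ((1 + a) / 2)], whose quotients by [kappa a] are twice the cosine and twice the sine of
   [pi a / 2]. *)
Declare Scope vec_scope.
Delimit Scope vec_scope with vec.
(* Explicit paths to the module structure: Coquelicot's overloaded operations
   would otherwise be elaborated in several convertible, syntactically different
   ways. *)
Notation "x +v y" := (@plus (NormedModule.AbelianMonoid C_AbsRing _) x y)
  (at level 50, left associativity) : vec_scope.
Notation "x -v y" := (@minus (NormedModule.AbelianGroup C_AbsRing _) x y)
  (at level 50, left associativity) : vec_scope.
Notation "c *v x" := (@scal C_Ring (NormedModule.ModuleSpace C_AbsRing _) c x)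
  (at level 40, left associativity) : vec_scope.
Notation vopp x := (@opp (NormedModule.AbelianGroup C_AbsRing _) x).
Notation vzero := (@zero (NormedModule.AbelianMonoid C_AbsRing _)).
Open Scope vec_scope.

(** * Linear identities in complex modules *)

Section LinearExpressions.
Variable V : CNormedModule.

Inductive vexp :=
| VAtom (n : nat) | VZero | VPlus (a b : vexp) | VMinus (a b : vexp)
| VOpp (a : vexp) | VScal (c : C) (a : vexp).

Fixpoint vden (env : list V) (e : vexp) : V :=
  match e with
  | VAtom n => List.nth n env zero
  | VZero => zero
  | VPlus a b => plus (vden env a) (vden env b)
  | VMinus a b => minus (vden env a) (vden env b)
  | VOpp a => opp (vden env a)
  | VScal c a => scal c (vden env a)
  end.

Fixpoint vcoef (e : vexp) (i : nat) : C :=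
  match e with
  | VAtom n => if Nat.eqb n i then RtoC 1 else RtoC 0
  | VZero => RtoC 0
  | VPlus a b => (vcoef a i + vcoef b i)%C
  | VMinus a b => (vcoef a i - vcoef b i)%C
  | VOpp a => (- vcoef a i)%C
  | VScal c a => (c * vcoef a i)%C
  end.

Fixpoint lincomb (f : nat -> C) (env : list V) : V :=
  match env with
  | nil => zero
  | cons x l => plus (scal (f O) x) (lincomb (fun i => f (S i)) l)
  end.

Lemma lincomb_ext f g env :
  (forall i, (i < length env)%nat -> f i = g i) -> lincomb f env = lincomb g env.
Proof.
revert f g; induction env as [|x l IH]; simpl; intros f g H; [reflexivity|].
f_equal; [rewrite (H O); [reflexivity | lia] | apply IH; intros i Hi; apply H; lia].
Qed.

Lemma lincomb_zero env : lincomb (fun _ => RtoC 0) env = zero.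
Proof.
induction env as [|x l IH]; simpl; [reflexivity|].
rewrite IH, plus_zero_r; exact (scal_zero_l x).
Qed.

Lemma lincomb_plus f g env :
  lincomb (fun i => (f i + g i)%C) env = plus (lincomb f env) (lincomb g env).
Proof.
revert f g; induction env as [|x l IH]; simpl; intros f g.
- symmetry; apply plus_zero_l.
- rewrite IH, (plus_plus_swap (scal (f O) x)); f_equal.
  exact (scal_distr_r (f O) (g O) x).
Qed.

Lemma lincomb_scal c f env :
  lincomb (fun i => (c * f i)%C) env = scal c (lincomb f env).
Proof.
revert f; induction env as [|x l IH]; simpl; intros f.
- symmetry; exact (scal_zero_r c).
- rewrite IH, Cscal_plus; f_equal; symmetry; exact (scal_assoc c (f O) x).
Qed.

Lemma opp_scal (x : V) : opp x = scal (RtoC (-1)) x.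
Proof.
refine (eq_trans (eq_sym (scal_opp_one x)) _).
change (scal (- RtoC 1)%C x = scal (RtoC (-1)) x); f_equal.
apply injective_projections; simpl; ring.
Qed.

Lemma lincomb_opp f env : lincomb (fun i => (- f i)%C) env = opp (lincomb f env).
Proof.
rewrite opp_scal, <- lincomb_scal; apply lincomb_ext; intros i _.
apply injective_projections; simpl; ring.
Qed.

Lemma vden_lincomb env e : vden env e = lincomb (vcoef e) env.
Proof.
induction e; simpl.
- revert n; induction env as [|x l IH]; simpl; intros [|n]; try reflexivity.
  + rewrite (lincomb_ext _ (fun _ => RtoC 0)) by reflexivity.
    rewrite lincomb_zero, plus_zero_r; symmetry; exact (scal_one x).
  + rewrite IH; simpl.
    etransitivity; [symmetry; apply plus_zero_l|]; f_equal.
    symmetry; exact (scal_zero_l x).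
- symmetry; apply lincomb_zero.
- rewrite lincomb_plus, IHe1, IHe2; reflexivity.
- unfold Cminus; rewrite lincomb_plus, lincomb_opp, IHe1, IHe2; reflexivity.
- rewrite lincomb_opp, IHe; reflexivity.
- rewrite lincomb_scal, IHe; reflexivity.
Qed.

(** A nested conjunction instead of a bounded quantifier: it computes to one scalar goal per
    atom. *)
Fixpoint coef_eq (n : nat) (f g : nat -> C) : Prop :=
  match n with O => True | S m => f m = g m /\ coef_eq m f g end.

(** Both sides are linear combinations of the atoms in [env], so equal coefficients suffice, and
    those are identities in [C], within reach of [ring] and [field]. *)
Lemma vden_eq env e1 e2 :
  coef_eq (length env) (vcoef e1) (vcoef e2) -> vden env e1 = vden env e2.
Proof.
intros H; rewrite !vden_lincomb; apply lincomb_ext.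
revert H; generalize (length env); induction n as [|n IH]; simpl; intros H i Hi; [lia|].
destruct H as [H1 H2].
destruct (Nat.eq_dec i n) as [->|Hn]; [exact H1 | apply IH; [exact H2 | lia]].
Qed.

End LinearExpressions.

Ltac vmem x l :=
  match l with
  | nil => constr:(false)
  | cons ?y ?l' => let _ := match goal with _ => constr_eq x y end in constr:(true)
  | cons _ ?l' => vmem x l'
  end.

Ltac vatoms V l e :=
  lazymatch e with
  | plus ?a ?b => let l1 := vatoms V l a in vatoms V l1 b
  | minus ?a ?b => let l1 := vatoms V l a in vatoms V l1 b
  | opp ?a => vatoms V l a
  | scal _ ?a => vatoms V l a
  | zero => l
  | ?x => let m := vmem x l in
          lazymatch m with true => l | false => constr:(cons (x : V) l) end
  end.

Ltac vindex x l :=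
  match l with
  | cons ?y _ => let _ := match goal with _ => constr_eq x y end in constr:(O)
  | cons _ ?l' => let n := vindex x l' in constr:(S n)
  end.

Ltac vreify l e :=
  lazymatch e with
  | plus ?a ?b => let x := vreify l a in let y := vreify l b in constr:(VPlus x y)
  | minus ?a ?b => let x := vreify l a in let y := vreify l b in constr:(VMinus x y)
  | opp ?a => let x := vreify l a in constr:(VOpp x)
  | scal ?c ?a => let x := vreify l a in constr:(VScal c x)
  | zero => constr:(VZero)
  | ?x => let n := vindex x l in constr:(VAtom n)
  end.

Ltac vlin V :=
  match goal with
  | |- ?x = ?y =>
    let l0 := vatoms V (@nil V) x in
    let l := vatoms V l0 y in
    let e1 := vreify l x in let e2 := vreify l y in
    change (vden V l e1 = vden V l e2); apply vden_eq;
    cbn [coef_eq length vcoef Nat.eqb]; repeat split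
  end.

Ltac cring :=
  repeat (rewrite RtoC_plus || rewrite RtoC_minus || rewrite RtoC_opp
          || rewrite RtoC_mult); ring.

Ltac vring V := vlin V; try cring.

(** * Integrals of functions valued in complex Banach spaces *)

Notation CBanach := (CompleteNormedModule C_AbsRing).

(** Restriction of scalars leaves the uniform structure unchanged, so the completeness of [V] is
    reused as it stands and [restrC V] has the same carrier and operations as [restr V]. *)
Definition restrC (V : CBanach) : CompleteNormedModule R_AbsRing :=
  CompleteNormedModule.Pack R_AbsRing V
    (CompleteNormedModule.Class R_AbsRing V
      (NormedModule.class R_AbsRing (restr V))
      (CompleteNormedModule.mixin C_AbsRing V
        (CompleteNormedModule.class C_AbsRing V))) V.

Notation contin V f t := (@continuous R_UniformSpace (NormedModule.UniformSpace C_AbsRing V) f t).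

Definition rint (V : CBanach) (f : R -> V) (a b : R) : V := @RInt (restrC V) f a b.

Definition is_int (V : CBanach) (f : R -> V) (Fa Fb : (R -> Prop) -> Prop) (l : V) : Prop :=
  @is_RInt_gen (restr V) f Fa Fb l.

Notation minf := (Rbar_locally m_infty).
Notation pinf := (Rbar_locally p_infty).

Lemma filterlim_RtoC (m : R) :
  filterlim RtoC (locally m) (@locally (AbsRing_UniformSpace C_AbsRing) (RtoC m)).
Proof.
apply (filterlim_locally (U := AbsRing_UniformSpace C_AbsRing)); intros eps.
exists eps; intros y Hy.
change (Cmod (RtoC y - RtoC m) < eps).
rewrite <- RtoC_minus, Cmod_R; exact Hy.
Qed.

Lemma plus_minus_inner (G : AbelianGroup) (x y z : G) :
  plus x z = minus (plus x (plus y z)) y.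
Proof.
unfold minus; rewrite <- (plus_assoc x), (plus_comm y z), <- (plus_assoc z), plus_opp_r.
rewrite plus_zero_r; reflexivity.
Qed.

(** * Improper integrals dominated by a real integral *)

Section RealDomination.
Variable W : CompleteNormedModule R_AbsRing.
Implicit Types (f : R -> W) (l : W).

(** Continuity makes every proper integral exist, so the improper integral becomes the limit of an
    honest function of the end points. *)
Lemma is_RInt_gen_iff (Fa Fb : (R -> Prop) -> Prop) {FFa : Filter Fa} {FFb : Filter Fb} f l :
  (forall t, continuous f t) ->
  is_RInt_gen f Fa Fb l <->
  forall eps, 0 < eps ->
    filter_prod Fa Fb (fun ab => norm (minus (RInt f (fst ab) (snd ab)) l) < eps).
Proof.
intros Hf; split; intros H.
- intros eps He.
  assert (HP : locally l (fun x => norm (minus x l) < eps)).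
  { exact (locally_le_locally_norm l _ (ex_intro _ (mkposreal eps He) (fun y Hy => Hy))). }
  specialize (H _ HP); revert H; unfold filtermapi; apply filter_imp.
  intros ab [v [Hv Pv]]; rewrite (is_RInt_unique _ _ _ _ Hv); exact Pv.
- intros P HP.
  destruct (locally_norm_le_locally l P HP) as [eps He].
  generalize (H eps (cond_pos eps)); unfold filtermapi; apply filter_imp.
  intros ab Hab; eexists; split;
    [apply (RInt_correct (V := W)), (ex_RInt_continuous (V := W)); intros; apply Hf |].
  apply He; exact Hab.
Qed.

(** The absolute value on the right allows [b < a], as happens for integrals from a point to minus
    infinity. *)
Lemma norm_RInt_le_abs f (g : R -> R) a b :
  (forall t, continuous f t) -> (forall t, continuous g t) ->
  (forall t, norm (f t) <= g t) -> norm (RInt f a b) <= Rabs (RInt g a b).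
Proof.
intros Hf Hg Hfg.
assert (Ef : forall a b, ex_RInt f a b)
  by (intros; apply (ex_RInt_continuous (V := W)); intros; apply Hf).
assert (Eg : forall a b, ex_RInt g a b)
  by (intros; apply (ex_RInt_continuous (V := R_CompleteNormedModule)); intros; apply Hg).
assert (A : forall a b, a <= b -> norm (RInt f a b) <= RInt g a b).
{ intros c d Hcd.
  apply (norm_RInt_le f g c d); [exact Hcd | intros; apply Hfg
  | apply RInt_correct, Ef | apply (RInt_correct (V := R_CompleteNormedModule)), Eg]. }
destruct (Rle_dec a b) as [Hab|Hab].
- eapply Rle_trans; [apply A, Hab | apply Rle_abs].
- assert (Hba : b <= a) by lra.
  rewrite <- opp_RInt_swap by apply Ef.
  refine (Rle_trans _ _ _ (Req_le _ _ (norm_opp _)) _).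
  eapply Rle_trans; [apply A, Hba |].
  replace (RInt g b a) with (- RInt g a b); [rewrite <- Rabs_Ropp; apply Rle_abs|].
  apply (opp_RInt_swap (V := R_CompleteNormedModule)), Eg.
Qed.

(* The oscillation of [RInt f] over the filter is controlled by that of
   [RInt g]. *)
Lemma ex_RInt_gen_dominated (Fa Fb : (R -> Prop) -> Prop)
    {FFa : ProperFilter Fa} {FFb : ProperFilter Fb} f (g : R -> R) m :
  (forall t, continuous f t) -> (forall t, continuous g t) ->
  (forall t, norm (f t) <= g t) -> is_RInt_gen g Fa Fb m ->
  exists l, is_RInt_gen f Fa Fb l.
Proof.
intros Hf Hg Hfg Hm.
assert (Ef : forall a b, ex_RInt f a b)
  by (intros; apply (ex_RInt_continuous (V := W)); intros; apply Hf).
assert (Eg : forall a b, ex_RInt g a b)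
  by (intros; apply (ex_RInt_continuous (V := R_CompleteNormedModule)); intros; apply Hg).
assert (Hm' : forall eps, 0 < eps ->
    filter_prod Fa Fb (fun ab => Rabs (RInt g (fst ab) (snd ab) - m) < eps)).
{ intros eps He.
  specialize (Hm _ (locally_ball m (mkposreal eps He))); revert Hm.
  unfold filtermapi; apply filter_imp; intros ab [v [Hv Pv]].
  rewrite (is_RInt_unique _ _ _ _ Hv); exact Pv. }
destruct (proj1 (filterlim_locally_cauchy (U := W) (F := filter_prod Fa Fb)
   (fun ab => RInt f (fst ab) (snd ab)))) as [l Hl].
- intros eps.
  destruct (Hm' (eps / 4)) as [Q1 Q2 H1 H2 H]; [generalize (cond_pos eps); lra|].
  exists (fun ab => Q1 (fst ab) /\ Q2 (snd ab)); split; [exists Q1 Q2; tauto|].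
  intros [a b] [a' b'] [Ha Hb] [Ha' Hb']; simpl in *.
  apply (norm_compat1 (V := W)).
  assert (E : minus (RInt f a' b') (RInt f a b) = plus (RInt f a' a) (RInt f b b')).
  { symmetry; rewrite <- (RInt_Chasles f a' a b'), <- (RInt_Chasles f a b b') by apply Ef.
      exact (plus_minus_inner W _ _ _). }
  refine (eq_ind_r (fun z => norm z < eps) _ E).
  assert (Aa : Rabs (RInt g a' a) < eps / 2).
  { generalize (H _ _ Ha Hb) (H _ _ Ha' Hb); simpl.
    rewrite <- (RInt_Chasles (V := R_CompleteNormedModule) g a' a b) by apply Eg.
    unfold plus; simpl; intros B1 B2; apply Rabs_def2 in B1; apply Rabs_def2 in B2.
    apply Rabs_def1; lra. }
  assert (Ab : Rabs (RInt g b b') < eps / 2).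
  { generalize (H _ _ Ha Hb) (H _ _ Ha Hb'); simpl.
    rewrite <- (RInt_Chasles (V := R_CompleteNormedModule) g a b b') by apply Eg.
    unfold plus; simpl; intros B1 B2; apply Rabs_def2 in B1; apply Rabs_def2 in B2.
    apply Rabs_def1; lra. }
  eapply Rle_lt_trans; [exact (norm_triangle _ _)|].
  eapply Rle_lt_trans; [exact (Rplus_le_compat _ _ _ _ (norm_RInt_le_abs f g a' a Hf Hg Hfg)
    (norm_RInt_le_abs f g b b' Hf Hg Hfg))|]; lra.
- exists l; apply (is_RInt_gen_iff Fa Fb f l Hf).
  intros eps He.
  exact (proj1 (filterlim_locally_ball_norm (K := R_AbsRing) _ l) Hl (mkposreal eps He)).
Qed.

End RealDomination.

(** * Integrals valued in a complex Banach space *)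

Section Integrals.
Variable V : CBanach.
Implicit Types (f g : R -> V) (l : V).

Lemma norm_eq0 (x y : V) : (forall eps, 0 < eps -> norm (x -v y) <= eps) -> x = y.
Proof.
intros H.
assert (E : norm (x -v y) = 0).
{ apply Rle_antisym; [|apply norm_ge_0].
  apply le_epsilon; intros e He; rewrite Rplus_0_l; auto. }
apply norm_eq_zero in E.
transitivity ((x -v y) +v y); [vring V|]. rewrite E; vring V.
Qed.

Lemma norm_sub_triangle (x y z : V) : norm (x -v z) <= norm (x -v y) + norm (y -v z).
Proof.
replace (x -v z) with ((x -v y) +v (y -v z)) by vring V. exact (norm_triangle _ _).
Qed.

Lemma norm_plus_le (x y : V) : norm (x +v y) <= norm x + norm y.
Proof. exact (norm_triangle x y). Qed.

Lemma norm_zeroC : norm (vzero : V) = 0.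
Proof. exact norm_zero. Qed.

Lemma norm_oppC (x : V) : norm (vopp x) = norm x.
Proof. exact (norm_opp x). Qed.

Lemma norm_minus_le (x y : V) : norm (x -v y) <= norm x + norm y.
Proof. rewrite <- (norm_oppC y). exact (norm_triangle x (vopp y)). Qed.

Lemma norm_minus_sym (x y : V) : norm (x -v y) = norm (y -v x).
Proof. rewrite <- norm_oppC; f_equal; vring V. Qed.

Lemma norm_scal_le (c : C) (x : V) : norm (c *v x) <= Cmod c * norm x.
Proof. exact (norm_scal c x). Qed.

(** A normed module only postulates one inequality; the other is the same inequality for [/ c]. *)
Lemma norm_scal_eq (c : C) (x : V) : norm (c *v x) = Cmod c * norm x.
Proof.
apply Rle_antisym; [apply norm_scal_le|].
destruct (Req_dec (Cmod c) 0) as [E|E].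
- rewrite E, Rmult_0_l; apply norm_ge_0.
- assert (Hc : c <> RtoC 0) by (intros ->; apply E, Cmod_0).
  replace x with ((/ c)%C *v (c *v x)) at 1 by (vlin V; field; exact Hc).
  apply Rle_trans with (Cmod c * (Cmod (/ c)%C * norm (c *v x))).
  + apply Rmult_le_compat_l; [apply Cmod_ge_0 | apply norm_scal_le].
  + rewrite Cmod_inv by exact Hc.
    right; field; exact E.
Qed.

Lemma filterlim_norm_lt (T : Type) (F : (T -> Prop) -> Prop) {FF : Filter F} (f : T -> V) l :
  filterlim f F (locally l) <->
  forall eps, 0 < eps -> F (fun x => norm (f x -v l) < eps).
Proof.
rewrite (filterlim_locally_ball_norm (K := C_AbsRing) (U := V)). split.
- intros H eps He; exact (H (mkposreal eps He)).
- intros H eps; exact (H eps (cond_pos eps)).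
Qed.

Lemma is_RInt_rint f a b :
  (forall t, Rmin a b <= t <= Rmax a b -> contin V f t) ->
  @is_RInt (restr V) f a b (rint V f a b).
Proof.
intros H; apply (@RInt_correct (restrC V)), (@ex_RInt_continuous (restrC V)); exact H.
Qed.

Lemma rint_unique f a b l : @is_RInt (restr V) f a b l -> rint V f a b = l.
Proof. exact (@is_RInt_unique (restrC V) f a b l). Qed.

Lemma rint_Chasles f a b c : (forall t, contin V f t) ->
  rint V f a b +v rint V f b c = rint V f a c.
Proof.
intros Hf; symmetry; apply rint_unique.
apply (is_RInt_Chasles (V := restr V)) with b; apply is_RInt_rint; intros; apply Hf.
Qed.

(** [L] commutes with Riemann sums by linearity and with their limit by continuity. *)
Lemma is_RInt_lin (W : CBanach) (L : V -> W) f a b l :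
  is_linear L -> @is_RInt (restr V) f a b l ->
  @is_RInt (restr W) (fun t => L (f t)) a b (L l).
Proof.
intros HL Hf.
assert (L0 : L vzero = vzero).
{ transitivity (L (RtoC 0 *v vzero)); [f_equal; vring V|].
  rewrite (linear_scal L HL); vring W. }
assert (HR : forall ptd, @Riemann_sum (restr W) (fun t => L (f t)) ptd
                = L (@Riemann_sum (restr V) f ptd)).
{ intros ptd.
  apply (SF_cons_ind (T := R) (fun p => @Riemann_sum (restr W) (fun t => L (f t)) p
                = L (@Riemann_sum (restr V) f p))).
  - intros x0; symmetry; exact L0.
  - intros h p IH; rewrite 2!Riemann_sum_cons, IH.
    refine (eq_sym (eq_trans (linear_plus L HL _ _) _)).
    change (L (scal (RtoC (SF_h p - fst h)) (f (snd h))) +v L (@Riemann_sum (restr V) f p) = (scal (RtoC (SF_h p - fst h)) (L (f (snd h)))) +v L (@Riemann_sum (restr V) f p)).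
    f_equal; apply (linear_scal L HL). }
assert (Hl : filterlim L (locally l) (locally (L l))) by exact (linear_cont L l HL).
assert (H := filterlim_comp _ _ _ _ _ _ _ _ Hf Hl).
refine (filterlim_ext _ _ _ H).
intros ptd; rewrite HR.
exact (linear_scal L HL (RtoC (sign (b - a))) _).
Qed.

Lemma is_linear_scal (c : C) : is_linear (fun x : V => c *v x).
Proof.
split.
- intros x y; vring V.
- intros k x; vring V.
- exists (Cmod c + 1); split; [generalize (Cmod_ge_0 c); lra|].
  intros x; eapply Rle_trans; [apply norm_scal_le|].
  apply Rmult_le_compat_r; [apply norm_ge_0 | lra].
Qed.

(** The map [r -> r v] starts from [R], which is not a complex space, so this is not an instance of
    [is_RInt_lin]; the argument on Riemann sums is repeated. *)
Lemma is_RInt_scal_vec (g : R -> R) (v : V) a b m :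
  is_RInt g a b m ->
  @is_RInt (restr V) (fun t => RtoC (g t) *v v) a b (RtoC m *v v).
Proof.
intros Hg.
set (L (r : R) := RtoC r *v v).
assert (HR : forall ptd, @Riemann_sum (restr V) (fun t => L (g t)) ptd = L (Riemann_sum g ptd)).
{ intros ptd.
  apply (SF_cons_ind (T := R) (fun p => @Riemann_sum (restr V) (fun t => L (g t)) p
                = L (Riemann_sum g p))).
  - intros x0; symmetry; exact (scal_zero_l v).
  - intros h p IH; rewrite 2!Riemann_sum_cons, IH.
    change ((RtoC (SF_h p - fst h) *v (RtoC (g (snd h)) *v v)) +v RtoC (Riemann_sum g p) *v v
     = RtoC ((SF_h p - fst h) * g (snd h) + Riemann_sum g p) *v v).
    vring V. }
assert (Hl : filterlim L (locally m) (locally (L m))).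
{ exact (filterlim_comp _ _ _ _ _ _ _ _ (@filterlim_RtoC m) (filterlim_scal_l (RtoC m) v)). }
assert (H := filterlim_comp _ _ _ _ _ _ _ _ Hg Hl).
refine (filterlim_ext _ _ _ H).
intros ptd; change (fun t : R => RtoC (g t) *v v) with (fun t => L (g t)); rewrite HR.
change (RtoC (sign (b - a) * Riemann_sum g ptd) *v v
   = RtoC (sign (b - a)) *v (RtoC (Riemann_sum g ptd) *v v)).
vring V.
Qed.

Section Gen.
Variables (Fa Fb : (R -> Prop) -> Prop).
Context {FFa : ProperFilter Fa} {FFb : ProperFilter Fb}.

Lemma is_int_unique f l l' : is_int V f Fa Fb l -> is_int V f Fa Fb l' -> l = l'.
Proof.
intros H H'.
rewrite <- (is_RInt_gen_unique (V := restrC V) f l H).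
exact (is_RInt_gen_unique (V := restrC V) f l' H').
Qed.

Lemma is_int_lin (W : CBanach) (L : V -> W) f l :
  is_linear L -> is_int V f Fa Fb l -> is_int W (fun t => L (f t)) Fa Fb (L l).
Proof.
intros HL Hf P HP.
assert (Hl : filterlim L (locally l) (locally (L l))) by exact (linear_cont L l HL).
specialize (Hf _ (Hl _ HP)); revert Hf; unfold filtermapi.
apply filter_imp; intros ab [v [Hv Pv]].
exists (L v); split; [| exact Pv].
exact (is_RInt_lin W L f _ _ _ HL Hv).
Qed.

Lemma is_int_scal_vec (g : R -> R) (v : V) m :
  is_RInt_gen g Fa Fb m -> is_int V (fun t => RtoC (g t) *v v) Fa Fb (RtoC m *v v).
Proof.
intros Hg P HP.
assert (Hl : filterlim (fun r => RtoC r *v v) (locally m) (locally (RtoC m *v v))).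
{ exact (filterlim_comp _ _ _ _ _ _ _ _ (filterlim_RtoC m) (filterlim_scal_l (RtoC m) v)). }
specialize (Hg _ (Hl _ HP)); revert Hg; unfold filtermapi.
apply filter_imp; intros ab [r [Hr Pr]].
exists (RtoC r *v v); split; [| exact Pr].
exact (is_RInt_scal_vec g v _ _ _ Hr).
Qed.

Lemma is_int_scal c f l : is_int V f Fa Fb l -> is_int V (fun t => c *v f t) Fa Fb (c *v l).
Proof. exact (is_int_lin V (fun x => c *v x) f l (is_linear_scal c)). Qed.

Lemma is_int_plus f g l m : is_int V f Fa Fb l -> is_int V g Fa Fb m ->
  is_int V (fun t => f t +v g t) Fa Fb (l +v m).
Proof. exact (is_RInt_gen_plus (V := restr V) f g l m). Qed.

Lemma is_int_minus f g l m : is_int V f Fa Fb l -> is_int V g Fa Fb m ->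
  is_int V (fun t => f t -v g t) Fa Fb (l -v m).
Proof. exact (is_RInt_gen_minus (V := restr V) f g l m). Qed.

Lemma is_int_ext f g l : (forall t, f t = g t) -> is_int V f Fa Fb l -> is_int V g Fa Fb l.
Proof.
intros E; apply (is_RInt_gen_ext (V := restr V)).
apply filter_forall; intros ab x _; apply E.
Qed.

Lemma is_int_iff f l : (forall t, contin V f t) ->
  is_int V f Fa Fb l <->
  forall eps, 0 < eps ->
    filter_prod Fa Fb (fun ab => norm (rint V f (fst ab) (snd ab) -v l) < eps).
Proof. exact (is_RInt_gen_iff (restrC V) Fa Fb f l). Qed.

Lemma is_int_norm f (g : R -> R) l m :
  filter_prod Fa Fb (fun ab => fst ab <= snd ab) ->
  (forall t, norm (f t) <= g t) ->
  is_int V f Fa Fb l -> is_RInt_gen g Fa Fb m -> norm l <= m.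
Proof.
intros Hab Hfg Hf Hg.
apply (RInt_gen_norm (V := restrC V) f g l m Hab); [| exact Hf | exact Hg].
apply filter_forall; intros ab t _; apply Hfg.
Qed.

Lemma ex_int_dom f (g : R -> R) m :
  (forall t, contin V f t) -> (forall t, continuous g t) ->
  (forall t, norm (f t) <= g t) -> is_RInt_gen g Fa Fb m ->
  exists l, is_int V f Fa Fb l.
Proof. exact (ex_RInt_gen_dominated (restrC V) Fa Fb f g m). Qed.

End Gen.

Lemma le_minf_pinf : filter_prod minf pinf (fun ab => fst ab <= snd ab).
Proof.
exists (fun x => x < 0) (fun x => 0 < x); [exists 0; auto | exists 0; auto |].
simpl; intros; lra.
Qed.

Lemma is_int_Chasles f Fa Fc b l m {FFa : Filter Fa} {FFc : Filter Fc} :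
  is_int V f Fa (at_point b) l -> is_int V f (at_point b) Fc m -> is_int V f Fa Fc (l +v m).
Proof. exact (is_RInt_gen_Chasles (V := restr V) f b l m). Qed.

Lemma is_int_affine f u v l : 0 < u -> is_int V f minf pinf l ->
  is_int V (fun t => f (u * t + v)) minf pinf (RtoC (/ u) *v l).
Proof.
intros Hu H P HP.
assert (Hl : filterlim (fun x : V => RtoC (/ u) *v x) (locally l) (locally (RtoC (/ u) *v l)))
  by exact (filterlim_scal_r (RtoC (/ u)) l).
destruct (H _ (Hl _ HP)) as [Q1 Q2 [m1 H1] [m2 H2] HQ].
exists (fun x => x < (m1 - v) / u) (fun x => (m2 - v) / u < x); [eexists; eauto | eexists; eauto |].
simpl; intros x y Hx Hy.
assert (Hx' : u * x + v < m1).
{ apply (Rmult_lt_compat_r u) in Hx; [|exact Hu].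
  replace ((m1 - v) / u * u) with (m1 - v) in Hx by (field; lra); lra. }
assert (Hy' : m2 < u * y + v).
{ apply (Rmult_lt_compat_r u) in Hy; [|exact Hu].
  replace ((m2 - v) / u * u) with (m2 - v) in Hy by (field; lra); lra. }
destruct (HQ _ _ (H1 _ Hx') (H2 _ Hy')) as [w [Hw Pw]]; simpl in Hw.
exists (RtoC (/ u) *v w); split; [| exact Pw].
apply (is_RInt_comp_lin (V := restr V)) in Hw.
apply (is_RInt_scal (V := restr V) _ _ _ (/ u)) in Hw.
refine (is_RInt_ext (V := restr V) _ _ _ _ _ _ Hw).
intros t _.
change (RtoC (/ u) *v (RtoC u *v f (u * t + v)) = f (u * t + v)).
vlin V; rewrite Cmult_assoc, <- RtoC_mult, Rinv_l by lra; ring.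
Qed.

Lemma is_derive_quad f (t : R) (d : V) K :
  (exists delta, 0 < delta /\ forall s, Rabs (s - t) < delta ->
     norm (f s -v f t -v RtoC (s - t) *v d) <= K * (s - t) ^ 2) ->
  @is_derive R_AbsRing (restr V) f t d.
Proof.
intros (delta & Hd & H); split.
- exact (is_linear_scal_l (V := restr V) d).
- intros x Hx eps.
  apply (is_filter_lim_locally_unique (V := R_NormedModule)) in Hx; subst x.
  assert (Hk : 0 < Rabs K + 1) by (generalize (Rabs_pos K); lra).
  assert (Hp : 0 < Rmin delta (eps / (Rabs K + 1))).
  { apply Rmin_pos; [exact Hd | apply Rdiv_lt_0_compat; [apply cond_pos | exact Hk]]. }
  exists (mkposreal _ Hp); intros s Hs.
  change (Rabs (s - t) < Rmin delta (eps / (Rabs K + 1))) in Hs.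
  apply Rmin_Rgt in Hs; destruct Hs as [Hs1 Hs2].
  change (norm (f s -v f t -v RtoC (s - t) *v d) <= eps * Rabs (s - t)).
  eapply Rle_trans; [apply H; exact Hs1|].
  rewrite <- (pow2_abs (s - t)); simpl; rewrite Rmult_1_r, <- Rmult_assoc.
  apply Rmult_le_compat_r; [apply Rabs_pos|].
  apply Rle_trans with ((Rabs K + 1) * Rabs (s - t)).
  + apply Rmult_le_compat_r; [apply Rabs_pos|]; generalize (Rle_abs K); lra.
  + apply Rlt_le; apply Rgt_lt in Hs2; apply (Rmult_lt_compat_l (Rabs K + 1)) in Hs2; [|exact Hk].
    replace ((Rabs K + 1) * (eps / (Rabs K + 1))) with (pos eps) in Hs2 by (field; lra); exact Hs2.
Qed.

Lemma rint_FTC f df a b :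
  (forall t, Rmin a b <= t <= Rmax a b -> @is_derive R_AbsRing (restr V) f t (df t)) ->
  (forall t, Rmin a b <= t <= Rmax a b -> contin V df t) ->
  @is_RInt (restr V) df a b (f b -v f a).
Proof. exact (is_RInt_derive (V := restrC V) f df a b). Qed.

Lemma is_int_FTC f df la lb :
  (forall t, @is_derive R_AbsRing (restr V) f t (df t)) -> (forall t, contin V df t) ->
  filterlim f minf (locally la) -> filterlim f pinf (locally lb) ->
  is_int V df minf pinf (lb -v la).
Proof.
intros Hd Hc Ha Hb; apply (is_int_iff minf pinf); [exact Hc|].
intros eps He.
assert (He2 : 0 < eps / 2) by lra.
assert (Ha' := proj1 (filterlim_norm_lt _ _ f la) Ha _ He2).
assert (Hb' := proj1 (filterlim_norm_lt _ _ f lb) Hb _ He2).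
exists (fun t => norm (f t -v la) < eps / 2) (fun t => norm (f t -v lb) < eps / 2);
  [exact Ha' | exact Hb' |].
simpl; intros x y Hx Hy.
rewrite (rint_unique df x y (f y -v f x)) by (apply rint_FTC; intros; auto).
replace (f y -v f x -v (lb -v la)) with ((f y -v lb) -v (f x -v la)) by vring V.
generalize (norm_minus_le (f y -v lb) (f x -v la)); lra.
Qed.

End Integrals.

(** * Cauchy's theorem on rectangles *)

(** Cutting [[p, q]] into [N] equal steps bounds the total increment by [K (q - p)^2 / N]. This
    replaces the vanishing of a derivative, for functions of which only increments are
    controlled. *)
Lemma constant_of_quadratic_increments (V : CBanach) (W : R -> V) (p q K : R) :
  p <= q ->
  (forall s t, p <= s -> s <= t -> t <= q -> t - s <= 1 ->
     norm (W t -v W s) <= K * (t - s) ^ 2) ->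
  W p = W q.
Proof.
intros Hpq H; apply norm_eq0; intros eps He.
(* The two summands make the steps at most 1 and the accumulated error at most [eps]. *)
destruct (nfloor_ex (q - p + Rabs K * (q - p) ^ 2 / eps)) as [n [_ Hn]].
{ assert (0 <= Rabs K * (q - p) ^ 2 / eps); [|lra].
  apply Rdiv_le_0_compat; [|exact He].
  apply Rmult_le_pos; [apply Rabs_pos | apply pow2_ge_0]. }
set (N := INR n + 1) in *.
assert (HN1 : 1 <= N) by (unfold N; generalize (pos_INR n); lra).
assert (HK : 0 <= Rabs K * (q - p) ^ 2 / eps).
{ apply Rdiv_le_0_compat; [|exact He].
  apply Rmult_le_pos; [apply Rabs_pos | apply pow2_ge_0]. }
set (h := (q - p) / N).
assert (Hh : 0 <= h) by (apply Rdiv_le_0_compat; lra).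
assert (Hh1 : h <= 1).
{ apply (Rmult_le_reg_r N); [lra|].
  unfold h; replace ((q - p) / N * N) with (q - p) by (field; lra); lra. }
assert (HNh : N * h = q - p) by (unfold h; field; lra).
assert (A : forall k, INR k <= N -> norm (W p -v W (p + INR k * h)) <= INR k * (Rabs K * h ^ 2)).
{ induction k as [|k IH].
  - intros _; simpl.
    replace (W p -v W (p + 0 * h)) with (vzero : V).
    2:{ replace (p + 0 * h) with p by ring; vring V. }
    rewrite norm_zeroC; lra.
  - rewrite S_INR; intros Hk.
    assert (IH' := IH ltac:(lra)); clear IH.
    assert (B : norm (W (p + (INR k + 1) * h) -v W (p + INR k * h)) <= Rabs K * h ^ 2).
    { generalize (pos_INR k); intros Hk0.
      assert (0 <= INR k * h) by (apply Rmult_le_pos; lra).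
      assert ((INR k + 1) * h <= N * h) by (apply Rmult_le_compat_r; lra).
      eapply Rle_trans; [apply H; lra|].
      replace (p + (INR k + 1) * h - (p + INR k * h)) with h by ring.
      apply Rmult_le_compat_r; [apply pow2_ge_0 | apply Rle_abs]. }
    rewrite norm_minus_sym in B.
    eapply Rle_trans; [apply (norm_sub_triangle _ _ (W (p + INR k * h))) | lra]. }
specialize (A (S n)); rewrite S_INR in A; fold N in A.
rewrite HNh in A; replace (p + (q - p)) with q in A by ring.
eapply Rle_trans; [apply A; lra|].
replace (N * (Rabs K * h ^ 2)) with (Rabs K * (q - p) ^ 2 / N) by (rewrite <- HNh; field; lra).
apply (Rmult_le_reg_r (N / eps)); [apply Rdiv_lt_0_compat; lra|].
replace (Rabs K * (q - p) ^ 2 / N * (N / eps)) with (Rabs K * (q - p) ^ 2 / eps) by (field; lra).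
replace (eps * (N / eps)) with N by (field; lra); lra.
Qed.

(** Complex differentiability, with derivative [f1] and a uniform quadratic
    remainder. *)
Definition C11 (V : CBanach) (S : C -> Prop) (f f1 : C -> V) : Prop :=
  exists K, 0 <= K /\ forall w w', S w -> S w' ->
    norm (f w) <= K /\ norm (f1 w) <= K /\
    norm (f w' -v f w) <= K * Cmod (w' - w) /\
    norm (f w' -v f w -v (w' - w)%C *v f1 w) <= K * Cmod (w' - w) ^ 2.

Definition interior_pt (S : C -> Prop) (w : C) : Prop :=
  exists delta, 0 < delta /\ forall w', Cmod (w' - w) < delta -> S w'.

Lemma interior_pt_in S w : interior_pt S w -> S w.
Proof.
intros (d & Hd & H); apply H.
replace (w - w)%C with (RtoC 0) by ring; rewrite Cmod_0; exact Hd.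
Qed.

(** Derivatives along a horizontal line need only this. It also admits sets inside the real axis,
    which have no interior in the plane; the resolvent of an abstract family is known to exist only
    there. *)
Definition interior_hor (S : C -> Prop) (x y : R) : Prop :=
  exists delta, 0 < delta /\ forall s, Rabs (s - x) < delta -> S (s, y).

Lemma Cmod_Ci : Cmod Ci = 1.
Proof.
unfold Cmod; simpl.
replace (0 * (0 * 1) + 1 * (1 * 1)) with 1 by ring; apply sqrt_1.
Qed.

(** * Calculus with quadratic remainders, and Cauchy's theorem *)

Section C11Theory.
Variable V : CBanach.

(** Adding the expansions from [w] to [w'] and from [w'] to [w] cancels the values of [f] and leaves
    [(w' - w) (f1 w' - f1 w)], of second order. *)
Lemma C11_deriv_lipschitz S (f f1 : C -> V) K w w' :
  (forall w w', S w -> S w' ->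
    norm (f w' -v f w -v (w' - w)%C *v f1 w) <= K * Cmod (w' - w) ^ 2) ->
  S w -> S w' -> norm (f1 w' -v f1 w) <= 2 * K * Cmod (w' - w).
Proof.
intros H Hw Hw'.
destruct (Req_dec (Cmod (w' - w)) 0) as [E|E].
- apply Cmod_eq_0 in E.
  replace w' with w by (transitivity (w + (w' - w))%C; [rewrite E|]; ring).
  replace (f1 w -v f1 w) with (vzero : V) by vring V.
  rewrite norm_zeroC.
  replace (w - w)%C with (RtoC 0) by ring; rewrite Cmod_0; lra.
- assert (Hp : 0 < Cmod (w' - w)) by (generalize (Cmod_ge_0 (w' - w)); lra).
  apply (Rmult_le_reg_l (Cmod (w' - w))); [exact Hp|].
  rewrite <- norm_scal_eq.
  assert (A := H w w' Hw Hw'); assert (B := H w' w Hw' Hw).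
  replace (w - w')%C with (- (w' - w))%C in B by ring; rewrite Cmod_opp in B.
  replace ((w' - w)%C *v (f1 w' -v f1 w)) with
    ((f w' -v f w -v (w' - w)%C *v f1 w) +v (f w -v f w' -v (- (w' - w))%C *v f1 w'))
    by vring V.
  eapply Rle_trans; [apply norm_plus_le|].
  eapply Rle_trans; [apply Rplus_le_compat; [exact A | exact B]|]; right; ring.
Qed.

Lemma C11_mult S (e e1 : C -> C) (f f1 : C -> V) :
  C11 C_CompleteNormedModule S e e1 -> C11 V S f f1 ->
  C11 V S (fun w => e w *v f w) (fun w => e1 w *v f w +v e w *v f1 w).
Proof.
intros [K [HK He]] [L [HL Hf]].
exists (2 * (K * L) + K * L).
assert (HKL : 0 <= K * L) by (apply Rmult_le_pos; assumption).
split; [lra|]; intros w w' Hw Hw'; cbv beta.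
destruct (He w w' Hw Hw') as (E0 & E1 & E2 & E3).
destruct (He w' w Hw' Hw) as (E0' & _).
destruct (Hf w w' Hw Hw') as (F0 & F1 & F2 & F3).
change (Cmod (e w) <= K) in E0. change (Cmod (e w') <= K) in E0'.
change (Cmod (e1 w) <= K) in E1.
change (Cmod (e w' - e w) <= K * Cmod (w' - w)) in E2.
change (Cmod (e w' - e w - (w' - w) * e1 w) <= K * Cmod (w' - w) ^ 2) in E3.
assert (M : forall (c : C) (x : V) (a b : R), Cmod c <= a -> norm x <= b -> norm (c *v x) <= a * b).
{ intros c x a b Ha Hb; rewrite norm_scal_eq.
  apply Rmult_le_compat; [apply Cmod_ge_0 | apply norm_ge_0 | assumption ..]. }
set (d := Cmod (w' - w)) in *.
assert (Hd : 0 <= d) by apply Cmod_ge_0.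
assert (H1 : norm (e w *v f w) <= K * L) by auto.
assert (H2 := M _ _ _ _ E1 F0).
assert (H3 := M _ _ _ _ E0 F1).
split; [lra|]; split.
{ eapply Rle_trans; [apply norm_plus_le|]; lra. }
split.
- replace (e w' *v f w' -v e w *v f w)
    with (e w' *v (f w' -v f w) +v (e w' - e w)%C *v f w) by vring V.
  eapply Rle_trans; [apply norm_plus_le|].
  assert (A := M _ _ _ _ E0' F2); assert (B := M _ _ _ _ E2 F0).
  assert (0 <= K * L * d) by (apply Rmult_le_pos; assumption).
  lra.
- replace (e w' *v f w' -v e w *v f w -v (w' - w)%C *v (e1 w *v f w +v e w *v f1 w))
    with (e w' *v (f w' -v f w -v (w' - w)%C *v f1 w)
          +v (e w' - e w - (w' - w) * e1 w)%C *v f w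
          +v (e w' - e w)%C *v ((w' - w)%C *v f1 w)) by vring V.
  assert (A := M _ _ _ _ E0' F3); assert (B := M _ _ _ _ E3 F0).
  assert (D := M _ _ _ _ E2 (M _ _ _ _ (Rle_refl d : Cmod (w' - w) <= d) F1)).
  eapply Rle_trans; [apply norm_plus_le|].
  eapply Rle_trans; [apply Rplus_le_compat_r, norm_plus_le|].
  replace ((2 * (K * L) + K * L) * d ^ 2)
    with (K * (L * d ^ 2) + K * d ^ 2 * L + K * d * (d * L)) by ring.
  lra.
Qed.

Lemma C11_comp S S' (g g1 : C -> C) (f f1 : C -> V) :
  C11 C_CompleteNormedModule S g g1 -> C11 V S' f f1 ->
  (forall w, S w -> S' (g w)) ->
  C11 V S (fun w => f (g w)) (fun w => g1 w *v f1 (g w)).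
Proof.
intros [K [HK Hg]] [L [HL Hf]] HS.
assert (HKL : 0 <= K * L) by (apply Rmult_le_pos; assumption).
assert (HKKL : 0 <= K * K * L) by (apply Rmult_le_pos; [apply Rmult_le_pos|]; assumption).
exists (L + K * L + K * K * L).
split; [lra|]; intros w w' Hw Hw'; cbv beta.
destruct (Hg w w' Hw Hw') as (E0 & E1 & E2 & E3).
destruct (Hf (g w) (g w') (HS _ Hw) (HS _ Hw')) as (F0 & F1 & F2 & F3).
change (Cmod (g1 w) <= K) in E1.
change (Cmod (g w' - g w) <= K * Cmod (w' - w)) in E2.
change (Cmod (g w' - g w - (w' - w) * g1 w) <= K * Cmod (w' - w) ^ 2) in E3.
set (d := Cmod (w' - w)) in *.
assert (Hd : 0 <= d) by apply Cmod_ge_0.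
assert (Hd2 : 0 <= d ^ 2) by apply pow2_ge_0.
split; [lra|]; split.
{ rewrite norm_scal_eq.
  assert (Cmod (g1 w) * norm (f1 (g w)) <= K * L)
    by (apply Rmult_le_compat; [apply Cmod_ge_0 | apply norm_ge_0 | assumption ..]).
  lra. }
split.
- eapply Rle_trans; [exact F2|].
  apply Rle_trans with (L * (K * d)); [apply Rmult_le_compat_l; assumption|].
  assert (0 <= L * d) by (apply Rmult_le_pos; assumption).
  assert (0 <= K * K * L * d) by (apply Rmult_le_pos; assumption).
  lra.
- replace (f (g w') -v f (g w) -v (w' - w)%C *v (g1 w *v f1 (g w)))
    with ((f (g w') -v f (g w) -v (g w' - g w)%C *v f1 (g w))
          +v (g w' - g w - (w' - w) * g1 w)%C *v f1 (g w)) by vring V.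
  eapply Rle_trans; [apply norm_plus_le|].
  rewrite norm_scal_eq.
  assert (A : Cmod (g w' - g w - (w' - w) * g1 w) * norm (f1 (g w)) <= K * d ^ 2 * L)
    by (apply Rmult_le_compat; [apply Cmod_ge_0 | apply norm_ge_0 | assumption ..]).
  assert (B : L * Cmod (g w' - g w) ^ 2 <= L * (K * d) ^ 2).
  { apply Rmult_le_compat_l; [exact HL|].
    apply pow_incr; split; [apply Cmod_ge_0 | exact E2]. }
  replace (L * (K * d) ^ 2) with (K * K * L * d ^ 2) in B by ring.
  assert (0 <= L * d ^ 2) by (apply Rmult_le_pos; assumption).
  lra.
Qed.

Lemma C11_subset (S S' : C -> Prop) (f f1 : C -> V) :
  (forall w, S w -> S' w) -> C11 V S' f f1 -> C11 V S f f1.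
Proof. intros HS [K [HK H]]; exists K; split; auto. Qed.

Lemma C11_ext S (f f1 g g1 : C -> V) :
  (forall w, S w -> f w = g w) -> (forall w, S w -> f1 w = g1 w) ->
  C11 V S f f1 -> C11 V S g g1.
Proof.
intros E E1 [K [HK H]]; exists K; split; [exact HK|]; intros w w' Hw Hw'; cbv beta.
rewrite <- !E, <- !E1 by assumption; auto.
Qed.

Lemma C11_const S (v : V) : C11 V S (fun _ => v) (fun _ => vzero).
Proof.
exists (norm v); split; [apply norm_ge_0|]; intros w w' _ _; cbv beta.
assert (Z : norm (v -v v) = 0).
{ replace (v -v v) with (vzero : V) by vring V; apply norm_zeroC. }
assert (Z' : norm (v -v v -v (w' - w)%C *v vzero) = 0).
{ replace (v -v v -v (w' - w)%C *v vzero) with (vzero : V) by vring V; apply norm_zeroC. }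
rewrite Z, Z', norm_zeroC.
split; [lra|]; split; [apply norm_ge_0|]; split.
- apply Rmult_le_pos; [apply norm_ge_0 | apply Cmod_ge_0].
- apply Rmult_le_pos; [apply norm_ge_0 | apply pow2_ge_0].
Qed.

Lemma C11_plus S (f f1 g g1 : C -> V) :
  C11 V S f f1 -> C11 V S g g1 ->
  C11 V S (fun w => f w +v g w) (fun w => f1 w +v g1 w).
Proof.
intros [K [HK Hf]] [L [HL Hg]]; exists (K + L); split; [lra|].
intros w w' Hw Hw'; cbv beta.
destruct (Hf w w' Hw Hw') as (F0 & F1 & F2 & F3).
destruct (Hg w w' Hw Hw') as (G0 & G1 & G2 & G3).
split; [eapply Rle_trans; [apply norm_plus_le | lra]|].
split; [eapply Rle_trans; [apply norm_plus_le | lra]|].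
split.
- replace ((f w' +v g w') -v (f w +v g w)) with ((f w' -v f w) +v (g w' -v g w)) by vring V.
  eapply Rle_trans; [apply norm_plus_le | lra].
- replace ((f w' +v g w') -v (f w +v g w) -v (w' - w)%C *v (f1 w +v g1 w))
    with ((f w' -v f w -v (w' - w)%C *v f1 w) +v (g w' -v g w -v (w' - w)%C *v g1 w)) by vring V.
  eapply Rle_trans; [apply norm_plus_le | lra].
Qed.

Lemma contin_lipschitz (f : R -> V) t K :
  (exists delta, 0 < delta /\ forall s, Rabs (s - t) < delta ->
     norm (f s -v f t) <= K * Rabs (s - t)) -> contin V f t.
Proof.
intros (d & Hd & H); apply (filterlim_norm_lt V R _ f (f t)); intros eps He.
assert (Hk : 0 < Rabs K + 1) by (generalize (Rabs_pos K); lra).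
assert (Hp : 0 < Rmin d (eps / (Rabs K + 1)))
  by (apply Rmin_pos; [exact Hd | apply Rdiv_lt_0_compat; assumption]).
exists (mkposreal _ Hp); intros s Hs.
change (Rabs (s - t) < Rmin d (eps / (Rabs K + 1))) in Hs.
apply Rmin_Rgt in Hs; destruct Hs as [Hs1 Hs2].
eapply Rle_lt_trans; [apply H; exact Hs1|].
apply Rle_lt_trans with ((Rabs K + 1) * Rabs (s - t)).
- apply Rmult_le_compat_r; [apply Rabs_pos|]; generalize (Rle_abs K); lra.
- apply Rgt_lt in Hs2; apply (Rmult_lt_compat_l (Rabs K + 1)) in Hs2; [|exact Hk].
  replace ((Rabs K + 1) * (eps / (Rabs K + 1))) with eps in Hs2 by (field; lra); exact Hs2.
Qed.

Lemma Cmod_horizontal (s t y : R) : Cmod ((s, y) - (t, y)) = Rabs (s - t).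
Proof.
replace ((s, y) - (t, y))%C with (RtoC (s - t)) by
  (apply injective_projections; simpl; ring).
apply Cmod_R.
Qed.

Lemma Cmod_vertical (s t x : R) : Cmod ((x, s) - (x, t)) = Rabs (s - t).
Proof.
replace ((x, s) - (x, t))%C with (Ci * RtoC (s - t))%C by
  (apply injective_projections; simpl; ring).
rewrite Cmod_mult, Cmod_R, Cmod_Ci; ring.
Qed.

Lemma interior_pt_hor (S : C -> Prop) x y : interior_pt S (x, y) -> interior_hor S x y.
Proof.
intros (d & Hd & H); exists d; split; [exact Hd|]; intros s Hs.
apply H; rewrite Cmod_horizontal; exact Hs.
Qed.

Lemma interior_hor_in (S : C -> Prop) x y : interior_hor S x y -> S (x, y).
Proof. intros (d & Hd & H); apply H; rewrite Rminus_diag, Rabs_R0; exact Hd. Qed.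

Section Rectangle.
Variables (S : C -> Prop) (f f1 : C -> V).
Hypothesis Hf : C11 V S f f1.

Lemma C11_contin_horizontal x y : interior_hor S x y -> contin V (fun x => f (x, y)) x.
Proof.
intros HS; assert (H0 := interior_hor_in _ _ _ HS); destruct HS as (d & Hd & H).
destruct Hf as [K [HK HC]]; apply contin_lipschitz with K.
exists d; split; [exact Hd|]; intros s Hs.
rewrite <- Cmod_horizontal with (y := y).
apply HC; auto.
Qed.

Lemma C11_contin_vertical x y : interior_pt S (x, y) -> contin V (fun y => f (x, y)) y.
Proof.
intros HS; assert (H0 := interior_pt_in _ _ HS); destruct HS as (d & Hd & H).
destruct Hf as [K [HK HC]]; apply contin_lipschitz with K.
exists d; split; [exact Hd|]; intros s Hs.
rewrite <- Cmod_vertical with (x := x) in *.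
apply HC; auto.
Qed.

Lemma C11_contin_deriv x y : interior_hor S x y -> contin V (fun x => f1 (x, y)) x.
Proof.
intros HS; assert (H0 := interior_hor_in _ _ _ HS); destruct HS as (d & Hd & H).
destruct Hf as [K [HK HC]]; apply contin_lipschitz with (2 * K).
exists d; split; [exact Hd|]; intros s Hs.
rewrite <- Cmod_horizontal with (y := y).
apply C11_deriv_lipschitz with (S := S) (f := f); auto.
intros; apply HC; auto.
Qed.

Lemma C11_derive_horizontal x y : interior_hor S x y ->
  @is_derive R_AbsRing (restr V) (fun x => f (x, y)) x (f1 (x, y)).
Proof.
intros HS; assert (H0 := interior_hor_in _ _ _ HS); destruct HS as (d & Hd & H).
destruct Hf as [K [HK HC]]; apply is_derive_quad with K.
exists d; split; [exact Hd|]; intros s Hs.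
replace (RtoC (s - x)) with ((s, y) - (x, y))%C by
  (apply injective_projections; simpl; ring).
rewrite <- pow2_abs, <- Cmod_horizontal with (y := y).
apply HC; auto.
Qed.

Lemma is_RInt_norm_const (g : R -> V) a b (l : V) M :
  (forall t, Rmin a b <= t <= Rmax a b -> norm (g t) <= M) ->
  @is_RInt (restr V) g a b l -> norm l <= Rabs (b - a) * M.
Proof.
intros HM Hl.
destruct (Rle_dec a b) as [Hab|Hab].
- rewrite Rabs_pos_eq by lra.
  apply (norm_RInt_le_const (V := restr V) g); [exact Hab | | exact Hl].
  intros; apply HM; rewrite Rmin_left, Rmax_right; lra.
- rewrite Rabs_left by lra.
  rewrite <- norm_oppC; replace (- (b - a)) with (a - b) by ring.
  apply (norm_RInt_le_const (V := restr V) g); [lra | |].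
  + intros; apply HM; rewrite Rmin_right, Rmax_left; lra.
  + apply (is_RInt_swap (V := restr V)); exact Hl.
Qed.

(** The defect [W y] of the identity for the part of the rectangle below height [y] has increments
    of second order in [y], hence is constant. *)
Theorem Cauchy_rectangle a b p q : p <= q ->
  (forall x y, Rmin a b <= x <= Rmax a b -> p <= y <= q -> interior_pt S (x, y)) ->
  rint V (fun x => f (x, q)) a b -v rint V (fun x => f (x, p)) a b
  = Ci *v (rint V (fun y => f (b, y)) p q -v rint V (fun y => f (a, y)) p q).
Proof.
intros Hpq HS.
set (h y := rint V (fun x => f (x, y)) a b).
set (v x y := rint V (fun y => f (x, y)) p y).
assert (Ha : Rmin a b <= a <= Rmax a b) by (split; [apply Rmin_l | apply Rmax_l]).
assert (Hb : Rmin a b <= b <= Rmax a b) by (split; [apply Rmin_r | apply Rmax_r]).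
assert (Hh : forall y, p <= y <= q -> @is_RInt (restr V) (fun x => f (x, y)) a b (h y)).
{ intros y Hy; apply is_RInt_rint; intros; apply C11_contin_horizontal, interior_pt_hor; auto. }
assert (Hv : forall x s t, Rmin a b <= x <= Rmax a b -> p <= s -> s <= t -> t <= q ->
   @is_RInt (restr V) (fun y => f (x, y)) s t (rint V (fun y => f (x, y)) s t)).
{ intros x s t Hx Hs Hst Ht; apply is_RInt_rint; intros y Hy.
  rewrite Rmin_left, Rmax_right in Hy by lra.
  apply C11_contin_vertical, HS; lra. }
set (W y := h y -v Ci *v (v b y -v v a y)).
enough (E : W p = W q).
{ unfold W in E.
  assert (Z : forall x, v x p = vzero) by (intros x; apply (RInt_point (V := restrC V))).
  rewrite !Z in E.
  change (h q -v h p = Ci *v (v b q -v v a q)).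
  transitivity ((h q -v Ci *v (v b q -v v a q)) -v h p +v Ci *v (v b q -v v a q)); [vring V|].
  rewrite <- E; vring V. }
destruct Hf as [K [HK HC]].
apply constant_of_quadratic_increments with (K := (Rabs (b - a) + 2) * K); [exact Hpq|].
intros s t Hs Hst Ht _.
set (r := RtoC (t - s)).
(* Holomorphy enters here: the vertical derivative is [Ci] times the horizontal one, which
   integrates over the edge to the difference of its end values. *)
assert (I1 : @is_RInt (restr V) (fun x => Ci *v (r *v f1 (x, s))) a b
              (Ci *v (r *v (f (b, s) -v f (a, s))))).
{ apply (is_RInt_lin V V (fun x => Ci *v x)); [apply is_linear_scal|].
  apply (is_RInt_lin V V (fun x => r *v x)); [apply is_linear_scal|].
  apply (rint_FTC V (fun x => f (x, s)) (fun x => f1 (x, s)));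
    intros x Hx; [apply C11_derive_horizontal | apply C11_contin_deriv]; apply interior_pt_hor, HS; lra. }
assert (I2 : @is_RInt (restr V)
   (fun x => (f (x, t) -v f (x, s)) -v Ci *v (r *v f1 (x, s))) a b
   ((h t -v h s) -v (Ci *v (r *v (f (b, s) -v f (a, s)))))).
{ apply (is_RInt_minus (V := restr V)); [|exact I1].
  apply (is_RInt_minus (V := restr V)); apply Hh; lra. }
assert (N2 : norm ((h t -v h s) -v (Ci *v (r *v (f (b, s) -v f (a, s)))))
   <= Rabs (b - a) * (K * (t - s) ^ 2)).
{ refine (is_RInt_norm_const _ _ _ _ _ _ I2); intros x Hx.
  assert (Sx : forall y, p <= y <= q -> S (x, y)) by (intros; apply interior_pt_in; auto).
  destruct (HC (x, s) (x, t)) as (_ & _ & _ & E); [apply Sx; lra .. |].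
  rewrite Cmod_vertical, pow2_abs in E.
  replace ((x, t) - (x, s))%C with (Ci * r)%C in E by
    (unfold r; apply injective_projections; simpl; ring).
  replace (Ci *v (r *v f1 (x, s))) with ((Ci * r)%C *v f1 (x, s)) by vring V.
  exact E. }
assert (N3 : forall x, Rmin a b <= x <= Rmax a b ->
  norm ((v x t -v v x s) -v r *v f (x, s)) <= K * (t - s) ^ 2).
{ intros x Hx.
  assert (E : v x t -v v x s = rint V (fun y => f (x, y)) s t).
  { replace (v x t) with (v x s +v rint V (fun y => f (x, y)) s t); [vring V|].
    symmetry; apply rint_unique, (is_RInt_Chasles (V := restr V)) with s; apply Hv; lra. }
  assert (I : @is_RInt (restr V) (fun y => f (x, y) -v f (x, s)) s t
     (rint V (fun y => f (x, y)) s t -v r *v f (x, s))).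
  { apply (is_RInt_minus (V := restr V)); [apply Hv; lra|].
    exact (is_RInt_const (V := restr V) s t (f (x, s))). }
  rewrite E.
  apply (is_RInt_norm_const _ _ _ _ (K * (t - s))) in I.
  - rewrite Rabs_pos_eq in I by lra; simpl; lra.
  - intros y Hy; rewrite Rmin_left, Rmax_right in Hy by lra.
    assert (Sx : forall y, p <= y <= q -> S (x, y)) by (intros; apply interior_pt_in; auto).
    destruct (HC (x, s) (x, y)) as (_ & _ & E' & _); [apply Sx; lra .. |].
    rewrite Cmod_vertical, Rabs_pos_eq in E' by lra.
    eapply Rle_trans; [exact E'|]; apply Rmult_le_compat_l; lra. }
assert (Nb := N3 b Hb); assert (Na := N3 a Ha).
replace (W t -v W s) with
  (((h t -v h s) -v (Ci *v (r *v (f (b, s) -v f (a, s)))))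
   -v Ci *v (((v b t -v v b s) -v r *v f (b, s)) -v ((v a t -v v a s) -v r *v f (a, s))))
  by (unfold W; vring V).
eapply Rle_trans; [apply norm_minus_le|].
rewrite norm_scal_eq, Cmod_Ci.
generalize (norm_minus_le V ((v b t -v v b s) -v r *v f (b, s)) ((v a t -v v a s) -v r *v f (a, s))).
lra.
Qed.

End Rectangle.
End C11Theory.

(** * The complex exponential and the reflection formula *)

(** Written with [ray], so that [(t, y)] is mapped to the point of argument [y] and modulus [e^t]
    with [y] unreduced: the sheet of the logarithm is remembered. *)
Definition cexp (w : C) : C := ray (snd w) (exp (fst w)).

Lemma cexp_plus w z : cexp (w + z)%C = (cexp w * cexp z)%C.
Proof.
unfold cexp, ray, cis; destruct w as [a b], z as [c d]; simpl.
rewrite exp_plus, cos_plus, sin_plus.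
apply injective_projections; simpl; ring.
Qed.

Lemma Cmod_cis t : Cmod (cis t) = 1.
Proof.
unfold Cmod, cis; simpl.
replace (cos t * (cos t * 1) + sin t * (sin t * 1)) with (Rsqr (sin t) + Rsqr (cos t))
  by (unfold Rsqr; ring).
rewrite sin2_cos2; apply sqrt_1.
Qed.

Lemma Cmod_ray t r : 0 <= r -> Cmod (ray t r) = r.
Proof.
intros Hr; unfold ray; rewrite Cmod_mult, Cmod_cis, Cmod_R, Rabs_pos_eq by exact Hr; ring.
Qed.

Lemma Cmod_cexp w : Cmod (cexp w) = exp (fst w).
Proof. apply Cmod_ray, Rlt_le, exp_pos. Qed.

Lemma Cmod_le_abs (z : C) : Cmod z <= Rabs (fst z) + Rabs (snd z).
Proof.
destruct z as [x y]; simpl.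
replace ((x, y) : C) with (RtoC x + Ci * RtoC y)%C by
  (apply injective_projections; simpl; ring).
eapply Rle_trans; [apply Cmod_triangle|].
rewrite Cmod_mult, !Cmod_R, Cmod_Ci; lra.
Qed.

Lemma mean_value_bound (f f' : R -> R) (x M : R) :
  f 0 = 0 ->
  (forall t, is_derive f t (f' t)) -> (forall t, Rmin 0 x <= t <= Rmax 0 x -> Rabs (f' t) <= M) ->
  Rabs (f x) <= M * Rabs x.
Proof.
intros H0 Hd HM.
destruct (MVT_gen f 0 x f') as [c [Hc E]].
- intros t _; apply Hd.
- intros t _; apply derivable_continuous_pt; exists (f' t).
  apply is_derive_Reals, Hd.
- rewrite H0, !Rminus_0_r in E; rewrite E, Rabs_mult.
  apply Rmult_le_compat_r; [apply Rabs_pos | apply HM, Hc].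
Qed.

Lemma Rabs_between x c : Rmin 0 x <= c <= Rmax 0 x -> Rabs c <= Rabs x.
Proof.
unfold Rmin, Rmax, Rabs; destruct (Rle_dec 0 x), (Rcase_abs c), (Rcase_abs x); lra.
Qed.

Lemma sin_abs_le y : Rabs (sin y) <= Rabs y.
Proof.
replace (Rabs y) with (1 * Rabs y) by ring.
apply (mean_value_bound sin cos); [apply sin_0 | |].
- intros t; auto_derive; [exact I | ring].
- intros t _; apply Rabs_le; apply COS_bound.
Qed.

Lemma cos_minus_1_abs_le y : Rabs (cos y - 1) <= y ^ 2 /\ Rabs (cos y - 1) <= Rabs y.
Proof.
split.
- rewrite <- pow2_abs; replace (Rabs y ^ 2) with (Rabs y * Rabs y) by ring.
  apply (mean_value_bound (fun y => cos y - 1) (fun y => - sin y)); [rewrite cos_0; ring | |].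
  + intros t; auto_derive; [exact I | ring].
  + intros t Ht; rewrite Rabs_Ropp; eapply Rle_trans; [apply sin_abs_le|].
    apply Rabs_between, Ht.
- replace (Rabs y) with (1 * Rabs y) by ring.
  apply (mean_value_bound (fun y => cos y - 1) (fun y => - sin y)); [rewrite cos_0; ring | |].
  + intros t; auto_derive; [exact I | ring].
  + intros t Ht; rewrite Rabs_Ropp; apply Rabs_le, SIN_bound.
Qed.

Lemma sin_minus_id_abs_le y : Rabs (sin y - y) <= y ^ 2.
Proof.
rewrite <- pow2_abs; replace (Rabs y ^ 2) with (Rabs y * Rabs y) by ring.
apply (mean_value_bound (fun y => sin y - y) (fun y => cos y - 1)); [rewrite sin_0; ring | |].
- intros t; auto_derive; [exact I | ring].
- intros t Ht; eapply Rle_trans; [apply cos_minus_1_abs_le|].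
  apply Rabs_between, Ht.
Qed.

Lemma exp_between x c : Rmin 0 x <= c <= Rmax 0 x -> exp c <= exp (Rmax x 0).
Proof.
intros Hc; rewrite Rmax_comm in Hc; destruct (Rle_lt_or_eq_dec _ _ (proj2 Hc)) as [H|H].
- apply Rlt_le, exp_increasing, H.
- rewrite H; lra.
Qed.

Lemma exp_minus_1_abs_le x : Rabs (exp x - 1) <= exp (Rmax x 0) * Rabs x.
Proof.
apply (mean_value_bound (fun x => exp x - 1) exp); [rewrite exp_0; ring | |].
- intros t; auto_derive; [exact I | ring].
- intros t Ht; rewrite Rabs_pos_eq by (apply Rlt_le, exp_pos).
  apply exp_between, Ht.
Qed.

Lemma exp_le x y : x <= y -> exp x <= exp y.
Proof.
intros [H| ->]; [apply Rlt_le, exp_increasing, H | apply Rle_refl].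
Qed.

Lemma exp_taylor_abs_le x : Rabs (exp x - 1 - x) <= exp (Rmax x 0) * x ^ 2.
Proof.
rewrite <- (pow2_abs x); replace (exp (Rmax x 0) * Rabs x ^ 2)
  with (exp (Rmax x 0) * Rabs x * Rabs x) by ring.
apply (mean_value_bound (fun x => exp x - 1 - x) (fun x => exp x - 1)); [rewrite exp_0; ring | |].
- intros t; auto_derive; [exact I | ring].
- intros t Ht; eapply Rle_trans; [apply exp_minus_1_abs_le|].
  apply Rmult_le_compat; [apply Rlt_le, exp_pos | apply Rabs_pos | | apply Rabs_between, Ht].
  apply exp_le; revert Ht; unfold Rmin, Rmax; destruct (Rle_dec 0 x), (Rle_dec t 0), (Rle_dec x 0); lra.
Qed.

(** The factor [exp (Rmax (fst d) 0)] is kept because it is later multiplied by [|e^u|]; a bound for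
    bounded [d] alone would not be uniform on a half-plane. *)
Lemma cexp_taylor (d : C) :
  Cmod (cexp d - 1) <= 3 * exp (Rmax (fst d) 0) * Cmod d /\
  Cmod (cexp d - 1 - d) <= 4 * exp (Rmax (fst d) 0) * Cmod d ^ 2.
Proof.
destruct d as [x y]; simpl fst.
set (m := exp (Rmax x 0)).
assert (Hm : 1 <= m) by (rewrite <- exp_0; apply exp_le, Rmax_r).
assert (Hx : exp x <= m) by apply exp_le, Rmax_l.
assert (He := exp_pos x).
assert (Dx : Rabs x <= Cmod (x, y)) by exact (re_le_Cmod (x, y)).
assert (Dy : Rabs y <= Cmod (x, y)).
{ eapply Rle_trans; [|apply (Rmax_Cmod (x, y))]; apply Rmax_r. }
set (D := Cmod (x, y)) in *.
assert (Px := Rabs_pos x); assert (Py := Rabs_pos y).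
assert (E1 := exp_minus_1_abs_le x); assert (E2 := exp_taylor_abs_le x).
fold m in E1, E2.
destruct (cos_minus_1_abs_le y) as [C2 C1].
assert (S1 := sin_abs_le y); assert (S2 := sin_minus_id_abs_le y).
rewrite <- (pow2_abs y) in C2, S2; rewrite <- (pow2_abs x) in E2.
assert (Q : forall u v U W, Rabs u <= U -> Rabs v <= W -> Rabs (u * v) <= U * W).
{ intros u v U W Hu Hv; rewrite Rabs_mult.
  apply Rmult_le_compat; [apply Rabs_pos | apply Rabs_pos | assumption ..]. }
assert (Ex : Rabs (exp x) <= m) by (rewrite Rabs_pos_eq; lra).
assert (Cy : Rabs (cos y) <= 1) by (apply Rabs_le, COS_bound).
split.
- eapply Rle_trans; [apply Cmod_le_abs|]; unfold cexp, ray, cis; simpl.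
  replace (exp x * cos y - 0 * sin y + - (1)) with ((exp x - 1) * cos y + (cos y - 1)) by ring.
  replace (exp x * sin y + 0 * cos y + - 0) with (exp x * sin y) by ring.
  assert (A := Q _ _ _ _ E1 Cy); assert (B := Q _ _ _ _ Ex S1).
  generalize (Rabs_triang ((exp x - 1) * cos y) (cos y - 1)).
  assert (m * Rabs x <= m * D) by (apply Rmult_le_compat_l; lra).
  assert (m * Rabs y <= m * D) by (apply Rmult_le_compat_l; lra).
  assert (Rabs y <= m * D) by (apply Rle_trans with (1 * D); [lra | apply Rmult_le_compat_r; lra]).
  lra.
- eapply Rle_trans; [apply Cmod_le_abs|]; unfold cexp, ray, cis; simpl.
  replace (exp x * cos y - 0 * sin y + - (1) + - x) with ((exp x - 1 - x) + exp x * (cos y - 1)) by ring.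
  replace (exp x * sin y + 0 * cos y + - 0 + - y) with (exp x * (sin y - y) + (exp x - 1) * y) by ring.
  assert (A := Q _ _ _ _ Ex C2); assert (B := Q _ _ _ _ Ex S2).
  assert (F := Q _ _ _ _ E1 (Rle_refl (Rabs y))).
  generalize (Rabs_triang (exp x - 1 - x) (exp x * (cos y - 1)))
             (Rabs_triang (exp x * (sin y - y)) ((exp x - 1) * y)).
  assert (M2 : forall u v, 0 <= u <= D -> 0 <= v <= D -> m * (u * v) <= m * (D * D)).
  { intros u v Hu Hv; apply Rmult_le_compat_l; [lra|].
    apply Rmult_le_compat; lra. }
  assert (N1 := M2 _ _ (conj Px Dx) (conj Px Dx)).
  assert (N2 := M2 _ _ (conj Px Dx) (conj Py Dy)).
  assert (N3 := M2 _ _ (conj Py Dy) (conj Py Dy)).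
  simpl in *; lra.
Qed.

Lemma C11_cexp (c N : R) : 0 <= c ->
  C11 C_CompleteNormedModule (fun w => fst w <= N)
    (fun w => cexp (RtoC c * w)) (fun w => (RtoC c * cexp (RtoC c * w))%C).
Proof.
intros Hc; set (m := exp (c * N)).
assert (Hm : 0 < m) by apply exp_pos.
assert (Hcm : 0 <= c * m) by (apply Rmult_le_pos; lra).
assert (Hccm : 0 <= c * c * m) by (apply Rmult_le_pos; [apply Rmult_le_pos|]; lra).
exists (m + 3 * c * m + 4 * c * c * m); split; [lra|].
intros w w' Hw Hw'.
set (u := (RtoC c * w)%C); set (u' := (RtoC c * w')%C).
set (d := (RtoC c * (w' - w))%C).
assert (Eu : u' = (u + d)%C) by (unfold u, u', d; ring).
assert (Fu : fst u = c * fst w) by (unfold u; simpl; ring).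
assert (Fd : fst u + fst d = c * fst w') by (unfold u, d; simpl; ring).
assert (Dd : Cmod d = c * Cmod (w' - w)).
{ unfold d; rewrite Cmod_mult, Cmod_R, Rabs_pos_eq by exact Hc; reflexivity. }
assert (Bu : exp (fst u) <= m).
{ apply exp_le; rewrite Fu; apply Rmult_le_compat_l; assumption. }
(* The product is [e] to the larger of the real parts of [u] and [u'], both at most [c N]. *)
assert (Bd : exp (fst u) * exp (Rmax (fst d) 0) <= m).
{ rewrite <- exp_plus; apply exp_le.
  unfold Rmax; destruct (Rle_dec (fst d) 0).
  - rewrite Rplus_0_r, Fu; apply Rmult_le_compat_l; assumption.
  - rewrite Fd; apply Rmult_le_compat_l; assumption. }
destruct (cexp_taylor d) as [T1 T2].
rewrite Dd in T1, T2.
set (D := Cmod (w' - w)) in *.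
assert (HD : 0 <= D) by apply Cmod_ge_0.
assert (Pu := exp_pos (fst u)).
change (Cmod (cexp u) <= m + 3 * c * m + 4 * c * c * m /\
  Cmod (RtoC c * cexp u) <= m + 3 * c * m + 4 * c * c * m /\
  Cmod (cexp u' - cexp u) <= (m + 3 * c * m + 4 * c * c * m) * D /\
  Cmod (cexp u' - cexp u - (w' - w) * (RtoC c * cexp u)) <= (m + 3 * c * m + 4 * c * c * m) * D ^ 2).
rewrite Eu, cexp_plus.
replace (cexp u * cexp d - cexp u)%C with (cexp u * (cexp d - 1))%C by ring.
replace (cexp u * (cexp d - 1) - (w' - w) * (RtoC c * cexp u))%C
  with (cexp u * (cexp d - 1 - d))%C by (unfold d; ring).
rewrite !Cmod_mult, Cmod_cexp, Cmod_R, (Rabs_pos_eq c) by exact Hc.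
split; [lra|]; split.
{ assert (c * exp (fst u) <= c * m) by (apply Rmult_le_compat_l; lra). lra. }
split.
- apply Rle_trans with (3 * (exp (fst u) * exp (Rmax (fst d) 0)) * (c * D)).
  { eapply Rle_trans; [apply Rmult_le_compat_l; [lra | exact T1]|]; right; ring. }
  apply Rle_trans with (3 * m * (c * D)).
  { apply Rmult_le_compat_r; [apply Rmult_le_pos; lra | lra]. }
  replace (3 * m * (c * D)) with (3 * c * m * D) by ring.
  apply Rmult_le_compat_r; lra.
- apply Rle_trans with (4 * (exp (fst u) * exp (Rmax (fst d) 0)) * (c * D) ^ 2).
  { eapply Rle_trans; [apply Rmult_le_compat_l; [lra | exact T2]|]; right; ring. }
  apply Rle_trans with (4 * m * (c * D) ^ 2).
  { apply Rmult_le_compat_r; [apply pow2_ge_0 | lra]. }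
  replace (4 * m * (c * D) ^ 2) with (4 * c * c * m * D ^ 2) by ring.
  apply Rmult_le_compat_r; [apply pow2_ge_0 | lra].
Qed.

(** [s^(-a) / (1 + s) ds] in the variable [s = e^t]. *)
Definition kern (a t : R) : R := exp ((1 - a) * t) / (1 + exp t).

Lemma kern_pos a t : 0 < kern a t.
Proof.
apply Rdiv_lt_0_compat; [apply exp_pos | generalize (exp_pos t); lra].
Qed.

Lemma kern_continuous a t : continuous (kern a) t.
Proof.
apply (ex_derive_continuous (V := R_NormedModule)); unfold kern; auto_derive.
generalize (exp_pos t); lra.
Qed.

Lemma kern_le_l a t : kern a t <= exp ((1 - a) * t).
Proof.
unfold kern; assert (H := exp_pos t); assert (H' := exp_pos ((1 - a) * t)).
apply (Rmult_le_reg_r (1 + exp t)); [lra|].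
replace (exp ((1 - a) * t) / (1 + exp t) * (1 + exp t)) with (exp ((1 - a) * t) * 1) by (field; lra).
apply Rmult_le_compat_l; lra.
Qed.

Lemma kern_le_r a t : kern a t <= exp (- a * t).
Proof.
unfold kern; assert (H := exp_pos t); assert (H' := exp_pos (- a * t)).
apply (Rmult_le_reg_r (1 + exp t)); [lra|].
replace (exp ((1 - a) * t) / (1 + exp t) * (1 + exp t)) with (exp ((1 - a) * t)) by (field; lra).
replace ((1 - a) * t) with (- a * t + t) by ring; rewrite exp_plus.
apply Rmult_le_compat_l; lra.
Qed.

Lemma exp_lim_minf c : 0 < c -> filterlim (fun t => exp (c * t)) minf (locally 0).
Proof.
intros Hc.
apply (filterlim_comp _ _ _ (fun t => c * t) exp _ minf _).
- intros P [M HP]; exists (M / c); intros x Hx; apply HP.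
  apply (Rmult_lt_compat_l c) in Hx; [|exact Hc].
  replace (c * (M / c)) with M in Hx by (field; lra); exact Hx.
- exact is_lim_exp_m.
Qed.

Lemma exp_lim_pinf c : 0 < c -> filterlim (fun t => exp (- c * t)) pinf (locally 0).
Proof.
intros Hc.
apply (filterlim_comp _ _ _ (fun t => - c * t) exp _ minf _).
- intros P [M HP]; exists (- M / c); intros x Hx; apply HP.
  apply (Rmult_lt_compat_l c) in Hx; [|exact Hc].
  replace (c * (- M / c)) with (- M) in Hx by (field; lra); lra.
- exact is_lim_exp_m.
Qed.

Lemma filterlim_squeeze0 (F : (R -> Prop) -> Prop) {FF : Filter F} (f g : R -> R) :
  (forall t, 0 <= f t <= g t) -> filterlim g F (locally 0) -> filterlim f F (locally 0).
Proof.
intros H Hg P [eps HP].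
generalize (Hg _ (locally_ball 0 eps)); unfold filtermap; apply filter_imp.
intros t Ht; apply HP; change (Rabs (f t - 0) < eps).
change (Rabs (g t - 0) < eps) in Ht; rewrite Rminus_0_r in *.
destruct (H t); rewrite Rabs_pos_eq in * by lra; lra.
Qed.

Lemma kern_lim_minf a : a < 1 -> filterlim (kern a) minf (locally 0).
Proof.
intros Ha; apply filterlim_squeeze0 with (fun t => exp ((1 - a) * t)); [exact _ | |].
- intros t; split; [apply Rlt_le, kern_pos | apply kern_le_l].
- apply exp_lim_minf; lra.
Qed.

Lemma kern_lim_pinf a : 0 < a -> filterlim (kern a) pinf (locally 0).
Proof.
intros Ha; apply filterlim_squeeze0 with (fun t => exp (- a * t)); [exact _ | |].
- intros t; split; [apply Rlt_le, kern_pos | apply kern_le_r].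
- apply exp_lim_pinf; lra.
Qed.

Lemma is_RInt_gen_primitive (Fa Fb : (R -> Prop) -> Prop) {FFa : Filter Fa} {FFb : Filter Fb}
    (f df : R -> R) la lb :
  (forall t, is_derive f t (df t)) -> (forall t, continuous df t) ->
  filterlim f Fa (locally la) -> filterlim f Fb (locally lb) ->
  is_RInt_gen df Fa Fb (lb - la).
Proof.
intros Hd Hc Ha Hb.
assert (E : forall t, Derive f t = df t) by (intros; apply is_derive_unique, Hd).
apply (is_RInt_gen_ext (V := R_NormedModule) (Derive f)).
- apply filter_forall; intros ab x _; apply E.
- apply is_RInt_gen_Derive; [| | exact Ha | exact Hb].
  + apply filter_forall; intros ab x _; exists (df x); apply Hd.
  + apply filter_forall; intros ab x _; apply continuous_ext with df; [|apply Hc].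
    intros; symmetry; apply E.
Qed.

(** The ends at which the primitive of the function dominating [kern] converges; it treats both
    infinities and finite points alike. *)
Definition sigmoid_lim (F : (R -> Prop) -> Prop) : Prop :=
  forall c, 0 < c -> exists l, filterlim (fun t => 1 - / (1 + exp (c * t))) F (locally l).

Lemma sigmoid_lim_minf : sigmoid_lim minf.
Proof.
intros c Hc; exists (1 - / (1 + 0)).
apply (filterlim_comp _ _ _ (fun t => exp (c * t)) (fun u => 1 - / (1 + u)) _ (locally 0) _).
- apply exp_lim_minf, Hc.
- apply (ex_derive_continuous (V := R_NormedModule) (fun u => 1 - / (1 + u))).
  auto_derive; lra.
Qed.

Lemma sigmoid_lim_pinf : sigmoid_lim pinf.
Proof.
intros c Hc; exists (/ (1 + 0)).
apply filterlim_ext with (fun t => / (1 + exp (- c * t))).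
- intros t; replace (- c * t) with (- (c * t)) by ring; rewrite exp_Ropp.
  field; repeat split; generalize (exp_pos (c * t)); lra.
- apply (filterlim_comp _ _ _ (fun t => exp (- c * t)) (fun u => / (1 + u)) _ (locally 0) _).
  + apply exp_lim_pinf, Hc.
  + apply (ex_derive_continuous (V := R_NormedModule) (fun u => / (1 + u))).
    auto_derive; lra.
Qed.

Lemma sigmoid_lim_point x : sigmoid_lim (at_point x).
Proof.
intros c _; exists (1 - / (1 + exp (c * x))).
intros P HP; exact (locally_singleton _ _ HP).
Qed.

(* [kern a <= 4 e^(d t) / (1 + e^(d t))^2] for [d = min (a, 1 - a)], and the
   bound has the primitive [(4 / d) e^(d t) / (1 + e^(d t))]. *)
Lemma ex_int_kern (Fa Fb : (R -> Prop) -> Prop) {FFa : ProperFilter Fa} {FFb : ProperFilter Fb} a :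
  sigmoid_lim Fa -> sigmoid_lim Fb -> 0 < a < 1 -> exists m, is_RInt_gen (kern a) Fa Fb m.
Proof.
intros La Lb Ha; set (d := Rmin a (1 - a)).
assert (Hd : 0 < d) by (apply Rmin_pos; lra).
assert (Hd1 : d <= a) by apply Rmin_l.
assert (Hd2 : d <= 1 - a) by apply Rmin_r.
set (g t := 4 * (exp (d * t) / (1 + exp (d * t)) ^ 2)).
assert (Gc : forall t, continuous g t).
{ intros t; apply (ex_derive_continuous (V := R_NormedModule)); unfold g; auto_derive.
  generalize (exp_pos (d * t)); intros H; apply Rgt_not_eq, Rmult_lt_0_compat; lra. }
destruct (La d Hd) as [la Hla]; destruct (Lb d Hd) as [lb Hlb].
refine (ex_RInt_gen_dominated R_CompleteNormedModule Fa Fb (kern a) g (4 / d * lb - 4 / d * la) _ Gc _ _).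
- apply kern_continuous.
- intros t; change (Rabs (kern a t) <= g t).
  rewrite Rabs_pos_eq by apply Rlt_le, kern_pos.
  unfold kern, g.
  assert (P1 := exp_pos t); assert (P2 := exp_pos (d * t)); assert (P3 := exp_pos ((1 - a) * t)).
  apply (Rmult_le_reg_r ((1 + exp t) * (1 + exp (d * t)) ^ 2)).
  { apply Rmult_lt_0_compat; [lra | apply pow_lt; lra]. }
  replace (exp ((1 - a) * t) / (1 + exp t) * ((1 + exp t) * (1 + exp (d * t)) ^ 2))
    with (exp ((1 - a) * t) * (1 + exp (d * t)) ^ 2) by (field; lra).
  replace (4 * (exp (d * t) / (1 + exp (d * t)) ^ 2) * ((1 + exp t) * (1 + exp (d * t)) ^ 2))
    with (4 * (exp (d * t) * (1 + exp t))) by (field; lra).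
  destruct (Rle_dec 0 t) as [Ht|Ht].
  + assert (H1 : 1 <= exp (d * t)).
    { rewrite <- exp_0; apply exp_le, Rmult_le_pos; lra. }
    assert (H2 : exp ((1 - a) * t) * exp (d * t) <= exp t).
    { rewrite <- exp_plus; apply exp_le; rewrite <- Rmult_plus_distr_r.
      rewrite <- (Rmult_1_l t) at 2; apply Rmult_le_compat_r; lra. }
    apply Rle_trans with (exp ((1 - a) * t) * (2 * exp (d * t)) ^ 2).
    { apply Rmult_le_compat_l; [lra | apply pow_incr; lra]. }
    replace (exp ((1 - a) * t) * (2 * exp (d * t)) ^ 2)
      with (4 * (exp (d * t) * (exp ((1 - a) * t) * exp (d * t)))) by ring.
    apply Rmult_le_compat_l; [lra|]; apply Rmult_le_compat_l; lra.
  + assert (H1 : exp (d * t) <= 1).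
    { rewrite <- exp_0; apply exp_le.
      replace (d * t) with (- (d * - t)) by ring.
      assert (0 <= d * - t) by (apply Rmult_le_pos; lra); lra. }
    assert (H2 : exp ((1 - a) * t) <= exp (d * t)).
    { apply exp_le. assert (0 <= (1 - a - d) * - t) by (apply Rmult_le_pos; lra); lra. }
    apply Rle_trans with (exp ((1 - a) * t) * 4).
    { apply Rmult_le_compat_l; [lra|].
      replace 4 with (2 ^ 2) by ring; apply pow_incr; lra. }
    apply Rle_trans with (exp (d * t) * 4); [lra|].
    rewrite (Rmult_comm _ 4); apply Rmult_le_compat_l; [lra|].
    rewrite <- (Rmult_1_r (exp (d * t))) at 1; apply Rmult_le_compat_l; lra.
- apply (is_RInt_gen_primitive Fa Fb (fun t => (4 / d) * (1 - / (1 + exp (d * t))))).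
  + intros t; unfold g; auto_derive.
    { generalize (exp_pos (d * t)); lra. }
    field; split; [generalize (exp_pos (d * t)); lra | lra].
  + exact Gc.
  + exact (filterlim_comp _ _ _ _ _ _ _ _ Hla (filterlim_scal_r (V := R_NormedModule) (4 / d) la)).
  + exact (filterlim_comp _ _ _ _ _ _ _ _ Hlb (filterlim_scal_r (V := R_NormedModule) (4 / d) lb)).
Qed.

Definition kappa (a : R) : R := RInt_gen (V := R_CompleteNormedModule) (kern a) minf pinf.

Lemma is_int_kern a : 0 < a < 1 -> is_RInt_gen (kern a) minf pinf (kappa a).
Proof.
intros Ha; apply (RInt_gen_correct (V := R_CompleteNormedModule)).
exact (ex_int_kern minf pinf a sigmoid_lim_minf sigmoid_lim_pinf Ha).
Qed.

(** * Cauchy's theorem on half-strips *)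

Section HalfLine.
Variable V : CBanach.

Lemma ex_int_kern_dom (Fa Fb : (R -> Prop) -> Prop) {FFa : ProperFilter Fa}
    {FFb : ProperFilter Fb} (f : R -> V) K a :
  sigmoid_lim Fa -> sigmoid_lim Fb -> 0 < a < 1 -> (forall t, contin V f t) ->
  (forall t, norm (f t) <= K * kern a t) -> exists l, is_int V f Fa Fb l.
Proof.
intros La Lb Ha Hc Hf.
destruct (ex_int_kern Fa Fb a La Lb Ha) as [m Hm].
apply (ex_int_dom V Fa Fb f (fun t => K * kern a t) (K * m)); [exact Hc | | exact Hf |].
- intros t; exact (continuous_scal_r (V := R_NormedModule) K (kern a) t (kern_continuous a t)).
- exact (is_RInt_gen_scal (V := R_NormedModule) (kern a) K m Hm).
Qed.

Lemma is_int_kern_norm (f : R -> V) K a l :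
  0 < a < 1 -> (forall t, norm (f t) <= K * kern a t) -> is_int V f minf pinf l ->
  norm l <= K * kappa a.
Proof.
intros Ha Hf Hl.
apply (is_int_norm V minf pinf f (fun t => K * kern a t)); [exact le_minf_pinf | exact Hf | exact Hl |].
exact (is_RInt_gen_scal (V := R_NormedModule) (kern a) K _ (is_int_kern a Ha)).
Qed.

Lemma is_int_line (f : R -> V) l1 l2 x :
  is_int V f (at_point x) minf l1 -> is_int V f (at_point x) pinf l2 ->
  is_int V f minf pinf (l2 -v l1).
Proof.
intros H1 H2.
replace (l2 -v l1) with (vopp l1 +v l2) by vring V.
refine (is_int_Chasles V f minf pinf x _ _ _ H2).
exact (is_RInt_gen_swap (V := restr V) f l1 H1).
Qed.

(** The far side of the rectangle is at most [(q - p) K kern alpha b], which tends to 0. The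
    rectangle identity is asked only eventually along [F], since some half-strips lie in the domain
    of the integrand only in one direction. *)
Lemma Cauchy_half_line (F : (R -> Prop) -> Prop) {FF : ProperFilter F}
    (f : C -> V) (a p q K alpha : R) lp lq :
  p <= q -> 0 <= K -> filterlim (kern alpha) F (locally 0) ->
  (forall x, contin V (fun x => f (x, p)) x) -> (forall x, contin V (fun x => f (x, q)) x) ->
  (forall y, p <= y <= q -> contin V (fun y => f (a, y)) y) ->
  F (fun b => (forall y, p <= y <= q -> contin V (fun y => f (b, y)) y /\
                norm (f (b, y)) <= K * kern alpha b) /\
       rint V (fun x => f (x, q)) a b -v rint V (fun x => f (x, p)) a b
        = Ci *v (rint V (fun y => f (b, y)) p q -v rint V (fun y => f (a, y)) p q)) ->
  is_int V (fun x => f (x, p)) (at_point a) F lp ->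
  is_int V (fun x => f (x, q)) (at_point a) F lq ->
  lq -v lp = vopp (Ci *v rint V (fun y => f (a, y)) p q).
Proof.
intros Hpq HK Hk Cp Cq Ca HF Hp Hq.
apply norm_eq0; intros eps He.
assert (He3 : 0 < eps / 3) by lra.
assert (Hd : 0 < eps / 3 / ((q - p) * K + 1)).
{ apply Rdiv_lt_0_compat; [exact He3|].
  assert (0 <= (q - p) * K) by (apply Rmult_le_pos; lra); lra. }
destruct (proj1 (is_int_iff V (at_point a) F _ lp Cp) Hp _ He3) as [P1 P2 HP1 HP2 HP].
destruct (proj1 (is_int_iff V (at_point a) F _ lq Cq) Hq _ He3) as [Q1 Q2 HQ1 HQ2 HQ].
assert (Hk' := Hk _ (locally_ball 0 (mkposreal _ Hd))).
change (F (fun t => Rabs (kern alpha t - 0) < eps / 3 / ((q - p) * K + 1))) in Hk'.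
destruct (filter_ex (F := F) _ (filter_and _ _ (filter_and _ _ HP2 HQ2) (filter_and _ _ HF Hk')))
  as [b [[B1 B2] [[B3 B4] B5]]].
specialize (HP a b HP1 B1); specialize (HQ a b HQ1 B2); simpl in HP, HQ.
rewrite Rminus_0_r, Rabs_pos_eq in B5 by apply Rlt_le, kern_pos.
set (Ip := rint V (fun x => f (x, p)) a b) in *.
set (Iq := rint V (fun x => f (x, q)) a b) in *.
set (Ja := rint V (fun y => f (a, y)) p q) in *.
assert (HJ : @is_RInt (restr V) (fun y => f (b, y)) p q (rint V (fun y => f (b, y)) p q)).
{ apply is_RInt_rint; intros y Hy; rewrite Rmin_left, Rmax_right in Hy by lra; apply B3, Hy. }
set (Jb := rint V (fun y => f (b, y)) p q) in *.
assert (N : norm Jb <= eps / 3).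
{ apply (is_RInt_norm_const V _ _ _ _ (K * kern alpha b)) in HJ.
  2:{ intros y Hy; rewrite Rmin_left, Rmax_right in Hy by lra; apply B3, Hy. }
  rewrite Rabs_pos_eq in HJ by lra.
  eapply Rle_trans; [exact HJ|].
  assert (0 <= (q - p) * K) by (apply Rmult_le_pos; lra).
  apply Rle_trans with (((q - p) * K + 1) * kern alpha b).
  { generalize (kern_pos alpha b); intros; lra. }
  apply Rlt_le, (Rmult_le_compat_l ((q - p) * K + 1)) in B5; [|lra].
  eapply Rle_trans; [exact B5|]; right; field; lra. }
(* What remains is the far side and the two truncation errors, each at most [eps / 3]. *)
replace (lq -v lp -v vopp (Ci *v Ja)) with
  (Ci *v Jb -v ((Iq -v lq) -v (Ip -v lp))).
2:{ transitivity (Ci *v (Jb -v Ja) -v (Iq -v Ip) +v (lq -v lp) +v Ci *v Ja); [vring V|].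
    rewrite <- B4; vring V. }
eapply Rle_trans; [apply norm_minus_le|].
rewrite norm_scal_eq, Cmod_Ci.
generalize (norm_minus_le V (Iq -v lq) (Ip -v lp)); lra.
Qed.

End HalfLine.

(** * Rotation of the integral of [1 / (1 + z)] by a right angle *)

Section Reflection.

Notation CC := C_CompleteNormedModule.

Lemma fst_cexp x y : fst (cexp (x, y)) = exp x * cos y.
Proof. unfold cexp, ray, cis; simpl; ring. Qed.

(** The half-plane keeps [1 + z] at distance [1/2] from 0 and is a neighbourhood of the closed right
    half-plane, which contains [e^w] for [0 <= Im w <= PI / 2]. The constant 8 bounds three inverses
    of modulus at most 2. *)
Lemma C11_inv :
  C11 CC (fun z => - / 2 < fst z) (fun z => / (1 + z))%C (fun z => - (/ (1 + z) * / (1 + z)))%C.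
Proof.
assert (B : forall z : C, - / 2 < fst z -> (1 + z)%C <> 0 /\ Cmod (/ (1 + z)) <= 2).
{ intros z Hz.
  assert (H : / 2 < Cmod (1 + z)).
  { apply Rlt_le_trans with (fst (1 + z)%C); [simpl; lra|].
    eapply Rle_trans; [apply Rle_abs | apply re_le_Cmod]. }
  assert (Hn : (1 + z)%C <> 0) by (intros E; rewrite E, Cmod_0 in H; lra).
  split; [exact Hn|].
  rewrite Cmod_inv by exact Hn.
  replace 2 with (/ / 2) by field.
  apply Rinv_le_contravar; lra. }
exists 8; split; [lra|]; intros z z' Hz Hz'.
destruct (B z Hz) as [N M]; destruct (B z' Hz') as [N' M'].
change (Cmod (/ (1 + z)) <= 8 /\ Cmod (- (/ (1 + z) * / (1 + z))) <= 8 /\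
  Cmod (/ (1 + z') - / (1 + z)) <= 8 * Cmod (z' - z) /\
  Cmod (/ (1 + z') - / (1 + z) - (z' - z) * - (/ (1 + z) * / (1 + z))) <= 8 * Cmod (z' - z) ^ 2).
replace (/ (1 + z') - / (1 + z) - (z' - z) * - (/ (1 + z) * / (1 + z)))%C
  with (((z' - z) * (z' - z)) * (/ (1 + z') * (/ (1 + z) * / (1 + z))))%C
  by (field; split; assumption).
replace (/ (1 + z') - / (1 + z))%C with (- (z' - z) * (/ (1 + z') * / (1 + z)))%C
  by (field; split; assumption).
rewrite !Cmod_mult, !Cmod_opp, !Cmod_mult.
set (u := Cmod (/ (1 + z))) in *; set (u' := Cmod (/ (1 + z'))) in *; set (D := Cmod (z' - z)).
assert (Hu : 0 <= u) by apply Cmod_ge_0; assert (Hu' : 0 <= u') by apply Cmod_ge_0.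
assert (HD : 0 <= D) by apply Cmod_ge_0.
assert (uu : u * u <= 2 * 2) by (apply Rmult_le_compat; assumption).
assert (u'u : u' * u <= 2 * 2) by (apply Rmult_le_compat; assumption).
assert (uuu : u' * (u * u) <= 2 * (2 * 2)).
{ apply Rmult_le_compat; try assumption; apply Rmult_le_pos; assumption. }
split; [lra|]; split; [lra|]; split.
- rewrite (Rmult_comm 8); apply Rmult_le_compat_l; lra.
- replace (8 * D ^ 2) with (D * D * 8) by ring; apply Rmult_le_compat_l; [|lra].
  apply Rmult_le_pos; assumption.
Qed.

Variable a : R.
Hypothesis Ha : 0 < a < 1.

Let e (w : C) : C := cexp (RtoC (1 - a) * w).
Let f (w : C) : C := (e w * / (1 + cexp w))%C.
Let S (N : R) (w : C) : Prop := fst w <= N /\ - / 2 < fst (cexp w).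

Lemma C11_cexp1 N : C11 CC (fun w => fst w <= N) cexp cexp.
Proof.
refine (C11_ext CC _ _ _ _ _ _ _ (C11_cexp 1 N ltac:(lra))).
- intros w _; f_equal; ring.
- intros w _; replace (RtoC 1 * w)%C with w by ring.
  replace (cexp w) with (RtoC 1 * cexp w)%C at 2 by ring; reflexivity.
Qed.

Lemma reflection_C11 N : exists f1, C11 CC (S N) f f1.
Proof.
eexists; apply (C11_mult CC (S N) e (fun w => RtoC (1 - a) * e w)%C (fun w => / (1 + cexp w))%C
  (fun w => cexp w * - (/ (1 + cexp w) * / (1 + cexp w)))%C).
- apply (C11_subset CC _ (fun w => fst w <= N)); [intros w Hw; apply Hw|].
  apply (C11_cexp (1 - a)); lra.
- apply (C11_comp CC (S N) (fun z => - / 2 < fst z) cexp cexp (fun z => / (1 + z))%C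
    (fun z => - (/ (1 + z) * / (1 + z)))%C).
  + apply (C11_subset CC _ (fun w => fst w <= N)); [intros w Hw; apply Hw | apply C11_cexp1].
  + apply C11_inv.
  + intros w Hw; apply Hw.
Qed.

Lemma reflection_interior N x y :
  x < N -> 0 <= y <= PI / 2 -> interior_pt (S N) (x, y).
Proof.
intros Hx Hy.
destruct (C11_cexp1 N) as [K [HK H]].
assert (Hp : 0 < Rmin (N - x) (/ 2 / (K + 1))).
{ apply Rmin_pos; [lra | apply Rdiv_lt_0_compat; lra]. }
exists (Rmin (N - x) (/ 2 / (K + 1))); split; [exact Hp|].
intros w' Hw'; apply Rmin_Rgt in Hw'; destruct Hw' as [H1 H2].
assert (X : fst w' <= N).
{ assert (A := re_le_Cmod (w' - (x, y))%C); simpl in A.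
  unfold Re in A; simpl in A.
  generalize (Rle_abs (fst w' + - x)); lra. }
split; [exact X|].
destruct (H (x, y) w') as (_ & _ & D & _); [simpl; lra | exact X |].
change (Cmod (cexp w' - cexp (x, y)) <= K * Cmod (w' - (x, y))) in D.
assert (A := re_le_Cmod (cexp w' - cexp (x, y))%C).
change (Rabs (fst (cexp w') - fst (cexp (x, y))) <= Cmod (cexp w' - cexp (x, y))) in A.
assert (P : 0 <= fst (cexp (x, y))).
{ rewrite fst_cexp; apply Rmult_le_pos; [apply Rlt_le, exp_pos | apply cos_ge_0; lra]. }
assert (Q : K * Cmod (w' - (x, y)) < / 2).
{ apply Rle_lt_trans with ((K + 1) * Cmod (w' - (x, y))).
  - apply Rmult_le_compat_r; [apply Cmod_ge_0 | lra].
  - apply Rgt_lt, (Rmult_lt_compat_l (K + 1)) in H2; [|lra].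
    replace ((K + 1) * (/ 2 / (K + 1))) with (/ 2) in H2 by (field; lra); exact H2. }
revert A; unfold Rabs; destruct Rcase_abs; lra.
Qed.

(** For [Re z >= 0] both 1 and [|z|] are at most [|1 + z|], hence so is their mean; this is the
    factor 2. *)
Lemma reflection_bound x y : 0 <= y <= PI / 2 -> Cmod (f (x, y)) <= 2 * kern a x.
Proof.
intros Hy; unfold f, e; rewrite Cmod_mult, Cmod_cexp.
assert (P : 0 <= fst (cexp (x, y))).
{ rewrite fst_cexp; apply Rmult_le_pos; [apply Rlt_le, exp_pos | apply cos_ge_0; lra]. }
assert (E1 : 1 <= Cmod (1 + cexp (x, y))).
{ eapply Rle_trans; [|apply re_le_Cmod]; eapply Rle_trans; [|apply Rle_abs]; simpl in *; lra. }
assert (E2 : exp x <= Cmod (1 + cexp (x, y))).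
{ change (exp x) with (exp (fst (x, y))); rewrite <- Cmod_cexp; unfold Cmod.
  apply sqrt_le_1_alt; simpl in *. nra. }
assert (N : (1 + cexp (x, y))%C <> 0) by (intros E; rewrite E, Cmod_0 in E1; lra).
rewrite Cmod_inv by exact N; unfold kern.
replace (fst (RtoC (1 - a) * (x, y))%C) with ((1 - a) * x) by (simpl; ring).
replace (2 * (exp ((1 - a) * x) / (1 + exp x))) with (exp ((1 - a) * x) * (/ ((1 + exp x) / 2)))
  by (field; generalize (exp_pos x); lra).
apply Rmult_le_compat_l; [apply Rlt_le, exp_pos|].
apply Rinv_le_contravar; [generalize (exp_pos x)|]; lra.
Qed.

Lemma reflection_contin_h x y : 0 <= y <= PI / 2 -> contin CC (fun x => f (x, y)) x.
Proof.
intros Hy; destruct (reflection_C11 (x + 1)) as [f1 H].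
apply (C11_contin_horizontal CC (S (x + 1)) f f1 H), interior_pt_hor, reflection_interior; [lra | exact Hy].
Qed.

Lemma reflection_contin_v x y : 0 <= y <= PI / 2 -> contin CC (fun y => f (x, y)) y.
Proof.
intros Hy; destruct (reflection_C11 (x + 1)) as [f1 H].
apply (C11_contin_vertical CC (S (x + 1)) f f1 H), reflection_interior; [lra | exact Hy].
Qed.

Lemma reflection_half (F : (R -> Prop) -> Prop) {FF : ProperFilter F} :
  sigmoid_lim F -> filterlim (kern a) F (locally 0) ->
  exists lp lq, is_int CC (fun x => f (x, 0)) (at_point 0) F lp /\
    is_int CC (fun x => f (x, PI / 2)) (at_point 0) F lq /\
    lq -v lp = vopp (Ci *v rint CC (fun y => f (0, y)) 0 (PI / 2)).
Proof.
intros HF Hk; assert (HPI := PI_RGT_0).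
assert (E : forall y, 0 <= y <= PI / 2 -> exists l, is_int CC (fun x => f (x, y)) (at_point 0) F l).
{ intros y Hy; apply (ex_int_kern_dom CC (at_point 0) F _ 2 a (sigmoid_lim_point 0) HF Ha).
  - intros t; apply reflection_contin_h, Hy.
  - intros t; apply reflection_bound, Hy. }
destruct (E 0) as [lp Hp]; [lra|]; destruct (E (PI / 2)) as [lq Hq]; [lra|].
exists lp, lq; split; [exact Hp | split; [exact Hq|]].
apply (Cauchy_half_line CC F f 0 0 (PI / 2) 2 a lp lq); try assumption; try lra.
- intros x; apply reflection_contin_h; lra.
- intros x; apply reflection_contin_h; lra.
- intros y Hy; apply reflection_contin_v, Hy.
- apply filter_forall; intros b; split.
  + intros y Hy; split; [apply reflection_contin_v, Hy | apply reflection_bound, Hy].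
  + destruct (reflection_C11 (Rmax 0 b + 1)) as [f1 H].
    apply (Cauchy_rectangle CC _ f f1 H); [lra|].
    intros x y Hx Hy; apply reflection_interior; lra.
Qed.

(** The left and the right half-strip share the vertical side over 0, whose contributions cancel; on
    the line of angle 0 the integrand is [kern a]. *)
Lemma reflection_rotation l :
  is_int CC (fun x => f (x, PI / 2)) minf pinf l -> l = RtoC (kappa a).
Proof.
intros Hl.
destruct (reflection_half minf sigmoid_lim_minf (kern_lim_minf a ltac:(lra)))
  as (p1 & q1 & P1 & Q1 & E1).
destruct (reflection_half pinf sigmoid_lim_pinf (kern_lim_pinf a ltac:(lra)))
  as (p2 & q2 & P2 & Q2 & E2).
rewrite (is_int_unique CC minf pinf _ _ _ Hl (is_int_line CC _ _ _ _ Q1 Q2)).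
transitivity (p2 -v p1).
{ transitivity ((q2 -v p2) -v (q1 -v p1) +v (p2 -v p1)); [vring CC|].
  rewrite E1, E2; vring CC. }
apply (is_int_unique CC minf pinf _ _ _ (is_int_line CC _ _ _ _ P1 P2)).
assert (K := is_int_scal_vec CC minf pinf (kern a) (RtoC 1) (kappa a) (is_int_kern a Ha)).
replace (RtoC (kappa a)) with (RtoC (kappa a) *v RtoC 1)
  by (change ((RtoC (kappa a) * RtoC 1)%C = RtoC (kappa a)); ring).
refine (is_int_ext CC minf pinf _ _ _ _ K).
intros t; change ((RtoC (kern a t) * RtoC 1)%C = f (t, 0)).
unfold f, e, kern.
assert (D : forall u, cexp (u, 0) = RtoC (exp u)).
{ intros u; unfold cexp, ray, cis; simpl; rewrite cos_0, sin_0.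
  apply injective_projections; simpl; ring. }
replace (RtoC (1 - a) * (t, 0))%C with (((1 - a) * t, 0) : C)
  by (apply injective_projections; simpl; ring).
rewrite !D; unfold Rdiv; rewrite RtoC_mult, RtoC_inv, RtoC_plus; [ring|].
generalize (exp_pos t); lra.
Qed.

(* At the angle [PI / 2] the integrand is [i^(1-a) e^((1-a)x) (1 - i e^x) /
   (1 + e^(2x))], whose parts are rescaled kernels of exponents [(1 + a) / 2]
   and [a / 2]. *)
Lemma kappa_half : kappa (a / 2) = 2 * cos (PI * a / 2) * kappa a.
Proof.
assert (K1 := is_int_scal_vec CC minf pinf _ (RtoC 1) _ (is_int_kern ((1 + a) / 2) ltac:(lra))).
assert (K2 := is_int_scal_vec CC minf pinf _ (RtoC 1) _ (is_int_kern (a / 2) ltac:(lra))).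
apply (is_int_affine CC _ 2 0) in K1; [|lra].
apply (is_int_affine CC _ 2 0) in K2; [|lra].
apply (is_int_scal CC minf pinf (- Ci)%C) in K2.
assert (K3 := is_int_scal CC minf pinf (cis ((1 - a) * (PI / 2))) _ _ (is_int_plus CC minf pinf _ _ _ _ K1 K2)).
set (P := kappa ((1 + a) / 2)) in *; set (Q := kappa (a / 2)) in *.
match type of K3 with is_int _ _ _ _ ?l => assert (E : l = RtoC (kappa a)) end.
{ apply reflection_rotation; refine (is_int_ext CC minf pinf _ _ _ _ K3).
  intros t; cbv beta.
  change (cis ((1 - a) * (PI / 2)) * (RtoC (kern ((1 + a) / 2) (2 * t + 0)) * RtoC 1
     + - Ci * (RtoC (kern (a / 2) (2 * t + 0)) * RtoC 1)) = f (t, PI / 2)%R)%C.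
  unfold f, e, kern.
  replace (RtoC (1 - a) * (t, PI / 2)%R)%C with (((1 - a) * t, (1 - a) * (PI / 2)) : C)
    by (apply injective_projections; simpl; ring).
  unfold cexp; simpl fst; simpl snd.
  assert (D : ray (PI / 2) (exp t) = (Ci * RtoC (exp t))%C).
  { unfold ray, cis; rewrite cos_PI2, sin_PI2; apply injective_projections; simpl; ring. }
  rewrite D; unfold ray.
  replace ((1 - (1 + a) / 2) * (2 * t + 0)) with ((1 - a) * t) by field.
  replace ((1 - a / 2) * (2 * t + 0)) with ((1 - a) * t + t) by field.
  replace (2 * t + 0) with (t + t) by ring.
  rewrite !exp_plus.
  assert (X := exp_pos t).
  assert (0 <= exp t * exp t) by (apply Rmult_le_pos; lra).
  unfold Rdiv; rewrite !RtoC_mult, !RtoC_inv, !RtoC_plus, !RtoC_mult by lra.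
  assert (N : (1 + RtoC (exp t) * RtoC (exp t))%C <> 0).
  { rewrite <- RtoC_mult, <- RtoC_plus; intros Z; apply RtoC_inj in Z; lra. }
  assert (F : (1 + RtoC (exp t) * RtoC (exp t) = (1 + Ci * RtoC (exp t)) * (1 - Ci * RtoC (exp t)))%C).
  { apply injective_projections; simpl; ring. }
  rewrite F in N |- *.
  assert (N1 : (1 + Ci * RtoC (exp t))%C <> 0) by (intros Z; apply N; rewrite Z; ring).
  assert (N2 : (1 - Ci * RtoC (exp t))%C <> 0) by (intros Z; apply N; rewrite Z; ring).
  field; split; assumption. }
change (cis ((1 - a) * (PI / 2)) * (RtoC (/ 2) * (RtoC P * RtoC 1) + - Ci * (RtoC (/ 2) * (RtoC Q * RtoC 1))) = RtoC (kappa a))%C in E.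
unfold cis in E.
replace ((1 - a) * (PI / 2)) with (PI / 2 - PI * a / 2) in E by field.
rewrite cos_shift, sin_shift in E.
set (c := cos (PI * a / 2)) in *; set (s := sin (PI * a / 2)) in *.
assert (T : s * s + c * c = 1).
{ generalize (sin2_cos2 (PI * a / 2)); unfold Rsqr; fold c s; auto. }
(* Real and imaginary parts give two equations, whose matrix in [(P, Q)] is orthogonal; the
   combination below isolates [Q]. *)
assert (R1 := f_equal fst E); assert (R2 := f_equal snd E); simpl in R1, R2.
assert (S1 : s * P + c * Q = 2 * kappa a) by lra.
assert (S2 : c * P - s * Q = 0) by lra.
transitivity (c * (s * P + c * Q) - s * (c * P - s * Q)).
- transitivity ((s * s + c * c) * Q); [rewrite T; ring | ring].
- rewrite S1, S2; ring.
Qed.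

End Reflection.

(** * The behaviour of [kappa] at 0 and the reflection formula *)

Lemma is_RInt_gen_ge0 (f : R -> R) (l : R) :
  (forall t, 0 <= f t) -> is_RInt_gen f minf pinf l -> 0 <= l.
Proof.
intros Hf Hl.
assert (Z : is_RInt_gen (fun _ : R => 0) minf pinf 0).
{ refine (eq_ind (0 * l) (fun z => is_RInt_gen (fun _ : R => 0) minf pinf z) _ 0 (Rmult_0_l l)).
  refine (is_RInt_gen_ext (V := R_NormedModule) _ _ _ _ (is_RInt_gen_scal (V := R_NormedModule) f 0 l Hl)).
  apply filter_forall; intros ab x _; apply Rmult_0_l. }
refine (Rle_trans _ _ _ (norm_ge_0 (V := R_NormedModule) 0) _).
refine (RInt_gen_norm (V := R_CompleteNormedModule) (fun _ => 0) f 0 l le_minf_pinf _ Z Hl).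
apply filter_forall; intros ab x _.
change (Rabs 0 <= f x); rewrite Rabs_R0; apply Hf.
Qed.

Lemma is_RInt_gen_le_line (f g : R -> R) (l m : R) :
  (forall t, f t <= g t) -> is_RInt_gen f minf pinf l -> is_RInt_gen g minf pinf m -> l <= m.
Proof.
intros H Hf Hg.
assert (0 <= m - l); [|lra].
apply (is_RInt_gen_ge0 (fun t => g t - f t)).
- intros t; generalize (H t); lra.
- exact (is_RInt_gen_minus (V := R_NormedModule) g f m l Hg Hf).
Qed.

(** Convexity of [exp], obtained from [1 + u <= e^u] at [u = - p x] and [u = (1 - p) x]: with
    weights [1 - p] and [p] the linear terms cancel. *)
Lemma exp_weighted_mean p x : 0 <= p <= 1 -> exp (p * x) <= 1 - p + p * exp x.
Proof.
intros Hp.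
assert (A := exp_ineq1_le (- (p * x))); assert (B := exp_ineq1_le ((1 - p) * x)).
assert (E := exp_pos (p * x)).
assert (A' : exp (p * x) * (1 + - (p * x)) <= 1).
{ replace 1 with (exp (p * x) * exp (- (p * x))) at 2.
  - apply Rmult_le_compat_l; lra.
  - rewrite <- exp_plus; replace (p * x + - (p * x)) with 0 by ring; apply exp_0. }
assert (B' : exp (p * x) * (1 + (1 - p) * x) <= exp x).
{ replace x with (p * x + (1 - p) * x) at 3 by ring; rewrite exp_plus.
  apply Rmult_le_compat_l; lra. }
apply (Rmult_le_compat_l (1 - p)) in A'; [|lra].
apply (Rmult_le_compat_l p) in B'; [|lra].
lra.
Qed.

(* Integration by parts gives [b * kappa b = Int e^(-b t) w] for the density
   [w = e^t / (1 + e^t)^2] of total mass 1, and [e^(-b t)] is compared with 1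
   by convexity in [b]. *)
Lemma kappa_asymptotics b : 0 < b <= / 2 ->
  Rabs (b * kappa b - 1) <= 2 * b * (kappa (/ 2) + 1).
Proof.
intros Hb.
set (w t := exp t / (1 + exp t) ^ 2).
set (s t := exp t / (1 + exp t)).
assert (Wc : forall t, continuous w t).
{ intros t; apply (ex_derive_continuous (V := R_NormedModule)); unfold w; auto_derive.
  generalize (exp_pos t); intros H; apply Rgt_not_eq, Rmult_lt_0_compat; lra. }
assert (Iw : is_RInt_gen w minf pinf (1 - 0)).
{ apply (is_RInt_gen_primitive minf pinf (fun t => 1 - / (1 + exp (1 * t)))); [| exact Wc | |].
  - intros t; unfold w; auto_derive; [generalize (exp_pos (1 * t)); lra|].
    rewrite !Rmult_1_l; field; generalize (exp_pos t); lra.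
  - replace 0 with (1 - / (1 + 0)) at 1 by (field; lra).
    apply (filterlim_comp _ _ _ (fun t => exp (1 * t)) (fun u => 1 - / (1 + u)) _ (locally 0) _).
    + apply exp_lim_minf; lra.
    + apply (ex_derive_continuous (V := R_NormedModule) (fun u => 1 - / (1 + u))).
      auto_derive; lra.
  - apply filterlim_ext with (fun t => / (1 + exp (- 1 * t))).
    + intros t; replace (- 1 * t) with (- t) by ring; rewrite Rmult_1_l, exp_Ropp.
      field; repeat split; generalize (exp_pos t); lra.
    + replace (locally 1) with (locally (/ (1 + 0))) by (f_equal; field; lra).
      apply (filterlim_comp _ _ _ (fun t => exp (- 1 * t)) (fun u => / (1 + u)) _ (locally 0) _).
      * exact (exp_lim_pinf 1 Rlt_0_1).
      * apply (ex_derive_continuous (V := R_NormedModule) (fun u => / (1 + u))).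
        auto_derive; lra. }
assert (Ik := is_int_kern b ltac:(lra)).
assert (Ik2 := is_int_kern (/ 2) ltac:(lra)).
assert (Ip : is_RInt_gen (fun t => - (b * kern b t) + exp (- b * t) * w t) minf pinf (0 - 0)).
{ apply (is_RInt_gen_primitive minf pinf (kern b)).
  - intros t; unfold kern, w; auto_derive; [generalize (exp_pos t); lra|].
    replace ((1 - b) * t) with (- b * t + t) by ring; rewrite exp_plus.
    field; generalize (exp_pos t); lra.
  - intros t; apply (continuous_plus (V := R_NormedModule)).
    + apply (continuous_opp (V := R_NormedModule)).
      exact (continuous_scal_r (V := R_NormedModule) b (kern b) t (kern_continuous b t)).
    + apply (continuous_mult (K := R_AbsRing)); [|apply Wc].
      apply (ex_derive_continuous (V := R_NormedModule)); auto_derive; exact I.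
  - apply kern_lim_minf; lra.
  - apply kern_lim_pinf; lra. }
assert (Im : is_RInt_gen (fun t => exp (- b * t) * w t) minf pinf (b * kappa b)).
{ replace (b * kappa b) with ((0 - 0) + b * kappa b) by ring.
  refine (is_RInt_gen_ext (V := R_NormedModule) _ _ _ _
    (is_RInt_gen_plus (V := R_NormedModule) _ _ _ _ Ip (is_RInt_gen_scal (V := R_NormedModule) _ b _ Ik))).
  apply filter_forall; intros ab x _.
  change (- (b * kern b x) + exp (- b * x) * w x + b * kern b x = exp (- b * x) * w x); ring. }
assert (Wp : forall t, 0 < w t).
{ intros t; apply Rdiv_lt_0_compat; [apply exp_pos | apply pow_lt; generalize (exp_pos t); lra]. }
assert (K1 : forall t, exp (- (/ 2) * t) * w t <= kern (/ 2) t).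
{ intros t; assert (X := exp_pos t); unfold w, kern.
  replace ((1 - / 2) * t) with (- (/ 2) * t + t) by field; rewrite exp_plus.
  unfold Rdiv; rewrite Rmult_assoc; apply Rmult_le_compat_l; [apply Rlt_le, exp_pos|].
  apply Rmult_le_compat_l; [lra|]; apply Rinv_le_contravar; [lra|]; nra. }
assert (K2 : forall t, exp (/ 2 * t) * w t <= kern (/ 2) t).
{ intros t; assert (X := exp_pos t); unfold w, kern.
  replace (1 - / 2) with (/ 2) by field.
  unfold Rdiv; apply Rmult_le_compat_l; [apply Rlt_le, exp_pos|].
  apply (Rmult_le_reg_r ((1 + exp t) ^ 2)); [apply pow_lt; lra|].
  replace (exp t * / (1 + exp t) ^ 2 * (1 + exp t) ^ 2) with (exp t) by (field; lra).
  replace (/ (1 + exp t) * (1 + exp t) ^ 2) with (1 + exp t) by (field; lra); lra. }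
assert (U : b * kappa b <= (1 - 2 * b) * (1 - 0) + 2 * b * kappa (/ 2)).
{ refine (is_RInt_gen_le_line _ _ _ _ _ Im (is_RInt_gen_plus (V := R_NormedModule) _ _ _ _
    (is_RInt_gen_scal (V := R_NormedModule) _ (1 - 2 * b) _ Iw)
    (is_RInt_gen_scal (V := R_NormedModule) _ (2 * b) _ Ik2))).
  intros t; change (exp (- b * t) * w t <= (1 - 2 * b) * w t + 2 * b * kern (/ 2) t).
  (* The exponent [- b t] is the mean of 0 and [- t / 2] with weight [2 b]; hence the restriction to
     [b <= / 2]. *)
  assert (E := exp_weighted_mean (2 * b) (- (/ 2) * t) ltac:(lra)).
  replace (2 * b * (- / 2 * t)) with (- b * t) in E by field.
  apply (Rmult_le_compat_r (w t)) in E; [|apply Rlt_le, Wp].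
  assert (F := K1 t); apply (Rmult_le_compat_l (2 * b)) in F; lra. }
assert (L : (1 + 2 * b) * (1 - 0) - 2 * b * kappa (/ 2) <= b * kappa b).
{ refine (is_RInt_gen_le_line _ _ _ _ _ (is_RInt_gen_minus (V := R_NormedModule) _ _ _ _
    (is_RInt_gen_scal (V := R_NormedModule) _ (1 + 2 * b) _ Iw)
    (is_RInt_gen_scal (V := R_NormedModule) _ (2 * b) _ Ik2)) Im).
  intros t; change ((1 + 2 * b) * w t - 2 * b * kern (/ 2) t <= exp (- b * t) * w t).
  (* The lower bound uses tangents: in [e^(-b t) + 2 b e^(t/2)] the linear terms [- b t] and [b t]
     cancel. *)
  assert (E1 := exp_ineq1_le (- b * t)); assert (E2 := exp_ineq1_le (/ 2 * t)).
  assert (E : (1 + 2 * b) <= exp (- b * t) + 2 * b * exp (/ 2 * t)).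
  { apply (Rmult_le_compat_l (2 * b)) in E2; lra. }
  apply (Rmult_le_compat_r (w t)) in E; [|apply Rlt_le, Wp].
  assert (F := K2 t); apply (Rmult_le_compat_l (2 * b)) in F; lra. }
assert (P : 0 <= 2 * b * kappa (/ 2)).
{ apply Rmult_le_pos; [lra|]; apply (is_RInt_gen_ge0 (kern (/ 2))); [|exact Ik2].
  intros; apply Rlt_le, kern_pos. }
apply Rabs_le; lra.
Qed.

(** The left side is invariant under halving of [a]: the factor [2 cos] of [kappa_half] completes
    the double-angle formula. Along [a / 2^n] it converges to [PI], because [b kappa b] tends to 1
    and [sin (PI b) / b] to [PI]. *)
Theorem kappa_reflection a : 0 < a < 1 -> kappa a * sin (PI * a) = PI.
Proof.
intros Ha; assert (HPI := PI_RGT_0).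
assert (Pw : forall n, 0 < a / 2 ^ n < 1).
{ intros n; assert (H : 1 <= 2 ^ n) by (apply pow_R1_Rle; lra).
  split; [apply Rdiv_lt_0_compat; lra|].
  apply (Rmult_lt_reg_r (2 ^ n)); [lra|].
  replace (a / 2 ^ n * 2 ^ n) with a by (field; lra); lra. }
assert (I : forall n, kappa (a / 2 ^ n) * sin (PI * (a / 2 ^ n)) = kappa a * sin (PI * a)).
{ induction n as [|n IH].
  - simpl; replace (a / 1) with a by field; reflexivity.
  - rewrite <- IH.
    assert (N2 : 2 ^ n <> 0) by (apply pow_nonzero; lra).
    replace (a / 2 ^ S n) with (a / 2 ^ n / 2) by (simpl; field; exact N2).
    rewrite kappa_half by apply Pw.
    set (b := a / 2 ^ n).
    replace (sin (PI * b)) with (2 * sin (PI * b / 2) * cos (PI * b / 2))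
      by (rewrite <- sin_2a; f_equal; field).
    replace (PI * (b / 2)) with (PI * b / 2) by field.
    ring. }
set (K := kappa (/ 2)).
assert (KP : 0 <= K).
{ apply (is_RInt_gen_ge0 (kern (/ 2))); [intros; apply Rlt_le, kern_pos | apply is_int_kern; lra]. }
set (M := (1 + (K + 1)) * PI ^ 2 + PI * (2 * (K + 1))).
assert (MP : 0 <= M).
{ unfold M; assert (0 <= PI ^ 2) by apply pow2_ge_0.
  assert (0 <= (1 + (K + 1)) * PI ^ 2) by (apply Rmult_le_pos; lra).
  assert (0 <= PI * (2 * (K + 1))) by (apply Rmult_le_pos; lra); lra. }
assert (B : forall n, (1 <= n)%nat -> Rabs (kappa a * sin (PI * a) - PI) <= M * (a / 2 ^ n)).
{ intros n Hn; rewrite <- (I n); set (b := a / 2 ^ n).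
  assert (Hb : 0 < b <= / 2).
  { split; [apply Pw|].
    assert (H : 2 ^ 1 <= 2 ^ n) by (apply Rle_pow; [lra | exact Hn]); simpl in H.
    apply (Rmult_le_reg_r (2 ^ n)); [lra|].
    unfold b; replace (a / 2 ^ n * 2 ^ n) with a by (field; lra); lra. }
  assert (A1 := kappa_asymptotics b Hb); fold K in A1.
  assert (A2 := sin_minus_id_abs_le (PI * b)).
  assert (A3 : Rabs (b * kappa b) <= 1 + (K + 1)).
  { replace (b * kappa b) with ((b * kappa b - 1) + 1) by ring.
    eapply Rle_trans; [apply Rabs_triang|]; rewrite Rabs_R1.
    assert (2 * b * (K + 1) <= 1 * (K + 1)) by (apply Rmult_le_compat_r; lra); lra. }
  replace (kappa b * sin (PI * b) - PI)
    with ((b * kappa b) * ((sin (PI * b) - PI * b) / b) + PI * (b * kappa b - 1)) by (field; lra).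
  eapply Rle_trans; [apply Rabs_triang|]; rewrite !Rabs_mult, (Rabs_pos_eq PI) by lra.
  assert (A4 : Rabs ((sin (PI * b) - PI * b) / b) <= PI ^ 2 * b).
  { unfold Rdiv; rewrite Rabs_mult, Rabs_inv, (Rabs_pos_eq b) by lra.
    apply (Rmult_le_reg_r b); [lra|]; rewrite Rmult_assoc, Rinv_l, Rmult_1_r by lra.
    eapply Rle_trans; [exact A2|]; right; ring. }
  assert (A5 : Rabs (b * kappa b) * Rabs ((sin (PI * b) - PI * b) / b) <= (1 + (K + 1)) * (PI ^ 2 * b)).
  { apply Rmult_le_compat; try apply Rabs_pos; assumption. }
  rewrite Rabs_mult in A5.
  apply (Rmult_le_compat_l PI) in A1; [|lra].
  unfold M; lra. }
destruct (Req_dec (kappa a * sin (PI * a)) PI) as [E|E]; [exact E|exfalso].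
assert (D : 0 < Rabs (kappa a * sin (PI * a) - PI)) by (apply Rabs_pos_lt; lra).
set (D0 := Rabs (kappa a * sin (PI * a) - PI)) in *.
destruct (pow_lt_1_zero (/ 2) ltac:(rewrite Rabs_pos_eq; lra) (D0 / (M + 1))
  ltac:(apply Rdiv_lt_0_compat; lra)) as [N HN].
specialize (HN (S N) ltac:(lia)); specialize (B (S N) ltac:(lia)).
rewrite Rabs_pos_eq in HN by (apply pow_le; lra).
rewrite pow_inv in HN.
assert (PW : 0 < / 2 ^ S N) by (apply Rinv_0_lt_compat, pow_lt; lra).
assert (a / 2 ^ S N <= / 2 ^ S N).
{ unfold Rdiv; rewrite <- (Rmult_1_l (/ 2 ^ S N)) at 2; apply Rmult_le_compat_r; lra. }
apply (Rmult_lt_compat_l (M + 1)) in HN; [|lra].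
replace ((M + 1) * (D0 / (M + 1))) with D0 in HN by (field; lra).
assert (M * (a / 2 ^ S N) <= M * / 2 ^ S N) by (apply Rmult_le_compat_l; assumption).
lra.
Qed.

(** * Resolvent families *)

(** What the calculus of powers uses of an operator, in terms of bounded maps only; it applies both
    to [A] and to [Lambda4]. Injectivity stands for single-valuedness of the operator. *)
Record resolvent_family (V : CBanach) (G : C -> Prop) (K : R) (r : C -> V -> V) : Prop := {
  rf_K : 0 <= K;
  rf_nonneg : forall s, 0 <= s -> G (RtoC s);
  rf_plus : forall z x y, G z -> r z (x +v y) = r z x +v r z y;
  rf_scal : forall z c x, G z -> r z (c *v x) = c *v r z x;
  rf_bound : forall z x, G z -> (1 + Cmod z) * norm (r z x) <= K * norm x;
  rf_id : forall z z' x, G z -> G z' ->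
    r z x -v r z' x = (z' - z)%C *v r z (r z' x);
  rf_inj : forall z x, G z -> r z x = vzero -> x = vzero }.

Section ResolventFamily.
Variables (V : CBanach) (G : C -> Prop) (K : R) (r : C -> V -> V).
Hypothesis Hr : resolvent_family V G K r.

Lemma rf_norm z x : G z -> norm (r z x) <= K * norm x.
Proof.
intros Hz; assert (B := rf_bound _ _ _ _ Hr z x Hz).
assert (0 <= Cmod z * norm (r z x)) by (apply Rmult_le_pos; [apply Cmod_ge_0 | apply norm_ge_0]).
lra.
Qed.

Lemma rf_linear z : G z -> is_linear (r z).
Proof.
intros Hz; split.
- intros x y; apply (rf_plus _ _ _ _ Hr _ _ _ Hz).
- intros c x; apply (rf_scal _ _ _ _ Hr _ _ _ Hz).
- exists (K + 1); split; [generalize (rf_K _ _ _ _ Hr); lra|].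
  intros x; eapply Rle_trans; [apply (rf_norm z x Hz)|].
  apply Rmult_le_compat_r; [apply norm_ge_0 | lra].
Qed.

(** The resolvent identity expresses both products by the same difference divided by [z' - z]. *)
Lemma rf_comm z z' x : G z -> G z' -> r z (r z' x) = r z' (r z x).
Proof.
intros Hz Hz'.
destruct (excluded_middle_informative (z = z')) as [->|N]; [reflexivity|].
assert (A := rf_id _ _ _ _ Hr z z' x Hz Hz').
assert (B := rf_id _ _ _ _ Hr z' z x Hz' Hz).
assert (N' : (z' - z)%C <> 0).
{ intros E; apply N; transitivity (z + (z' - z))%C; [rewrite E|]; ring. }
transitivity ((/ (z' - z))%C *v (r z x -v r z' x)).
- rewrite A; vlin V; field; exact N'.
- transitivity ((- / (z' - z))%C *v (r z' x -v r z x)); [vring V|].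
  rewrite B; vlin V; field; exact N'.
Qed.

(** Iterating the resolvent identity gives the remainder exactly, [(w - w')^2 r(w') r(w)^2 x], so
    the constant is uniform on [G]. *)
Lemma C11_resolvent x : C11 V G (fun z => r z x) (fun z => vopp (r z (r z x))).
Proof.
assert (HK := rf_K _ _ _ _ Hr).
assert (Hx := norm_ge_0 x).
assert (B1 : forall z, G z -> norm (r z x) <= K * norm x) by (intros; apply rf_norm; assumption).
assert (B2 : forall z z', G z -> G z' -> norm (r z (r z' x)) <= K * K * norm x).
{ intros z z' Hz Hz'; eapply Rle_trans; [apply rf_norm, Hz|].
  rewrite Rmult_assoc; apply Rmult_le_compat_l; auto. }
assert (B3 : forall z z' z'', G z -> G z' -> G z'' ->
  norm (r z (r z' (r z'' x))) <= K * K * K * norm x).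
{ intros z z' z'' Hz Hz' Hz''; eapply Rle_trans; [apply rf_norm, Hz|].
  replace (K * K * K * norm x) with (K * (K * K * norm x)) by ring.
  apply Rmult_le_compat_l; auto. }
assert (P1 : 0 <= K * norm x) by (apply Rmult_le_pos; assumption).
assert (P2 : 0 <= K * K * norm x) by (apply Rmult_le_pos; [apply Rmult_le_pos|]; assumption).
assert (P3 : 0 <= K * K * K * norm x).
{ apply Rmult_le_pos; [apply Rmult_le_pos; [apply Rmult_le_pos|]|]; assumption. }
exists (K * norm x + K * K * norm x + K * K * K * norm x); split; [lra|].
intros w w' Hw Hw'; cbv beta.
assert (HD := Cmod_ge_0 (w' - w)); set (D := Cmod (w' - w)) in *.
assert (E : r w' x -v r w x = (w - w')%C *v r w' (r w x)) by (apply (rf_id _ _ _ _ Hr); assumption).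
assert (D' : Cmod (w - w') = D).
{ unfold D; rewrite <- Cmod_opp; f_equal; ring. }
split; [generalize (B1 w Hw); lra|]; split.
{ rewrite norm_oppC; generalize (B2 w w Hw Hw); lra. }
split.
- rewrite E, norm_scal_eq, D'.
  rewrite (Rmult_comm D); apply Rmult_le_compat_r; [exact HD|].
  generalize (B2 w' w Hw' Hw); lra.
- replace (r w' x -v r w x -v (w' - w)%C *v vopp (r w (r w x)))
    with (((w - w') * (w - w'))%C *v r w' (r w (r w x))).
  + rewrite norm_scal_eq, Cmod_mult, D'.
    replace (D ^ 2) with (D * D) by ring; rewrite (Rmult_comm _ (D * D)).
    apply Rmult_le_compat_l; [apply Rmult_le_pos; exact HD|].
    generalize (B3 w' w w Hw' Hw Hw); lra.
  + assert (E' : r w' (r w x) -v r w (r w x) = (w - w')%C *v r w' (r w (r w x)))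
      by (apply (rf_id _ _ _ _ Hr); assumption).
    rewrite E.
    transitivity ((w - w')%C *v ((w - w')%C *v r w' (r w (r w x)))); [vring V|].
    rewrite <- E'; vring V.
Qed.

End ResolventFamily.

(** Neumann series: the iterates [S n] are its partial sums. *)
Lemma contraction_fixed_point (V : CBanach) (L : V -> V) (a : V) :
  (forall x y, L (x +v y) = L x +v L y) -> (forall x, norm (L x) <= / 2 * norm x) ->
  exists l, l = a +v L l.
Proof.
intros HL HN.
assert (Lm : forall x y, L (x -v y) = L x -v L y).
{ intros x y; transitivity (L (x -v y) +v L y -v L y); [vring V|].
  rewrite <- HL; f_equal; f_equal; vring V. }
set (S := fix S n := match n with O => vzero : V | Datatypes.S m => a +v L (S m) end).
assert (Inc : forall n, norm (S (Datatypes.S n) -v S n) <= (/ 2) ^ n * norm a).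
{ induction n as [|n IH].
  - change (norm (a +v L vzero -v vzero) <= 1 * norm a).
    assert (Z : L vzero = vzero).
    { transitivity (L (a -v a)); [f_equal; vring V | rewrite Lm; vring V]. }
    rewrite Z; replace (a +v vzero -v vzero) with a by vring V; lra.
  - change (norm ((a +v L (S (Datatypes.S n))) -v (a +v L (S n))) <= / 2 * (/ 2) ^ n * norm a).
    replace ((a +v L (S (Datatypes.S n))) -v (a +v L (S n)))
      with (L (S (Datatypes.S n) -v S n)) by (rewrite Lm; vring V).
    eapply Rle_trans; [apply HN|]; rewrite Rmult_assoc; apply Rmult_le_compat_l; [lra | exact IH]. }
(* The factor [1 - (/ 2) ^ k] is the partial geometric sum, which lets the induction on [k]
   close. *)
assert (Cau : forall n k, norm (S (n + k)%nat -v S n) <= 2 * (/ 2) ^ n * norm a * (1 - (/ 2) ^ k)).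
{ intros n; induction k as [|k IH].
  - rewrite Nat.add_0_r; replace (S n -v S n) with (vzero : V) by vring V.
    rewrite norm_zeroC; simpl; lra.
  - rewrite Nat.add_succ_r.
    eapply Rle_trans; [apply (norm_sub_triangle V _ (S (n + k)%nat))|].
    assert (I := Inc (n + k)%nat); rewrite pow_add in I.
    change ((/ 2) ^ Datatypes.S k) with (/ 2 * (/ 2) ^ k).
    lra. }
assert (Cau' : forall n m, (n <= m)%nat -> norm (S m -v S n) <= 2 * norm a * (/ 2) ^ n).
{ intros n m Hnm; replace m with (n + (m - n))%nat by lia.
  eapply Rle_trans; [apply Cau|].
  assert (P := pow_le (/ 2) (m - n) ltac:(lra)).
  assert (Q : 0 <= 2 * norm a * (/ 2) ^ n).
  { apply Rmult_le_pos; [apply Rmult_le_pos; [lra | apply norm_ge_0] | apply pow_le; lra]. }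
  apply Rle_trans with (2 * norm a * (/ 2) ^ n * 1); [|lra].
  replace (2 * (/ 2) ^ n * norm a * (1 - (/ 2) ^ (m - n)))
    with (2 * norm a * (/ 2) ^ n * (1 - (/ 2) ^ (m - n))) by ring.
  apply Rmult_le_compat_l; lra. }
assert (Small : forall eps, 0 < eps -> exists N, forall n, (N <= n)%nat -> 2 * norm a * (/ 2) ^ n < eps).
{ intros eps He.
  assert (Ha : 0 < 2 * norm a + 1) by (generalize (norm_ge_0 a); lra).
  destruct (pow_lt_1_zero (/ 2) ltac:(rewrite Rabs_pos_eq; lra) (eps / (2 * norm a + 1))
    ltac:(apply Rdiv_lt_0_compat; lra)) as [N HN'].
  exists N; intros n Hn; specialize (HN' n Hn).
  assert (P := pow_le (/ 2) n ltac:(lra)).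
  rewrite Rabs_pos_eq in HN' by exact P.
  apply (Rmult_lt_compat_l (2 * norm a + 1)) in HN'; [|exact Ha].
  replace ((2 * norm a + 1) * (eps / (2 * norm a + 1))) with eps in HN' by (field; lra).
  lra. }
destruct (proj1 (filterlim_locally_cauchy (U := V) (F := eventually) S)) as [l Hl].
{ intros eps; destruct (Small (eps / 2)) as [N HN']; [generalize (cond_pos eps); lra|].
  exists (fun n => (N <= n)%nat); split; [exists N; auto|].
  intros u v Hu Hv; apply (norm_compat1 (V := V)).
  change (norm (S v -v S u) < eps).
  assert (A := Cau' N v Hv); assert (B := Cau' N u Hu); rewrite norm_minus_sym in B.
  specialize (HN' N (le_n N)).
  eapply Rle_lt_trans; [apply (norm_sub_triangle V _ (S N))|]; lra. }
exists l; apply norm_eq0; intros eps He.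
destruct (proj1 (filterlim_norm_lt V _ eventually S l) Hl (eps / 2) ltac:(lra)) as [N HN'].
assert (A := HN' N (le_n N)); assert (B := HN' (Datatypes.S N) (le_S _ _ (le_n N))).
change (norm ((a +v L (S N)) -v l) < eps / 2) in B.
replace (l -v (a +v L l)) with (L (S N -v l) -v ((a +v L (S N)) -v l)) by (rewrite Lm; vring V).
eapply Rle_trans; [apply norm_minus_le|].
generalize (HN (S N -v l)) (norm_ge_0 (S N -v l)); lra.
Qed.

(** * The resolvent of a positive operator *)

(** The points where the Neumann series of the resolvent around some [s > 0]
    has ratio less than [1/2]. *)
Definition near_halfline (M : R) (z : C) : Prop :=
  exists s, 0 < s /\ M * Cmod (z - RtoC s) < (1 + s) / 2.

Section PositiveOperator.
Variables (V : CBanach) (T : lrel V V) (M : R).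
Hypothesis HT : positive_with T M.

(** A total function of [z] obtained by choice, meaningful where the resolvent exists. It does not
    depend on [M], so the same function serves every admissible constant. *)
Definition res (z : C) (x : V) : V :=
  epsilon (inhabits vzero) (fun y => resolvent T z x y).

Lemma resolvent_shift z s x y :
  resolvent T z x y -> resolvent T s (x -v (z - s)%C *v y) y.
Proof.
intros [w [Hw E]]; exists w; split; [exact Hw|].
change (x -v (z - s)%C *v y = s *v y +v w); change (x = z *v y +v w) in E.
rewrite E; vring V.
Qed.

(** Seen from [s], half of [(1 + s) norm y] is absorbed, leaving [2 M norm x]; and [1 + |z|] is at
    most [3/2 (1 + s)]. Their product gives the factor 3. *)
Lemma resolvent_bound z x y : near_halfline M z -> resolvent T z x y ->
  (1 + Cmod z) * norm y <= 3 * M * norm x.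
Proof.
intros (s & Hs & HM) Hy; destruct HT as (M1 & _ & _ & _ & _ & HB).
assert (B := HB s Hs _ _ (resolvent_shift _ (RtoC s) _ _ Hy)).
set (D := Cmod (z - RtoC s)) in *.
assert (A : norm (x -v (z - RtoC s)%C *v y) <= norm x + D * norm y).
{ eapply Rle_trans; [apply norm_minus_le|]; rewrite norm_scal_eq; apply Rle_refl. }
change ((1 + s) * norm y <= M * norm (x -v (z - RtoC s)%C *v y)) in B.
assert (Hy0 : 0 <= norm y) by apply norm_ge_0.
assert (B1 : (1 + s) * norm y <= M * norm x + M * D * norm y).
{ eapply Rle_trans; [exact B|]; rewrite Rmult_assoc, <- Rmult_plus_distr_l.
  apply Rmult_le_compat_l; lra. }
assert (B2 : M * D * norm y <= (1 + s) / 2 * norm y) by (apply Rmult_le_compat_r; lra).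
assert (Z : Cmod z <= s + D).
{ replace z with (RtoC s + (z - RtoC s))%C by ring.
  eapply Rle_trans; [apply Cmod_triangle|]; rewrite Cmod_R, Rabs_pos_eq by lra; apply Rle_refl. }
assert (HD : D <= M * D).
{ rewrite <- (Rmult_1_l D) at 1; apply Rmult_le_compat_r; [apply Cmod_ge_0 | lra]. }
assert (B3 : (1 + Cmod z) * norm y <= 3 / 2 * (1 + s) * norm y) by (apply Rmult_le_compat_r; lra).
lra.
Qed.

(** With [f] the resolvent at [s] and [d = z - s], the equation becomes [y = f (x - d y)], a
    contraction of ratio [1/2]. *)
Lemma resolvent_ex z x : near_halfline M z -> exists y, resolvent T z x y.
Proof.
intros (s & Hs & HM); destruct HT as (M1 & _ & _ & _ & HR & HB).
destruct (HR s (Rlt_le _ _ Hs)) as [f [Lf Hf]].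
set (d := (z - RtoC s)%C) in *.
destruct (contraction_fixed_point V (fun y => f ((- d)%C *v y)) (f x)) as [y Hy].
- intros u v; rewrite <- (linear_plus f Lf); f_equal; vring V.
- intros u.
  assert (B := HB s Hs _ _ (proj2 (Hf ((- d)%C *v u) _) eq_refl)).
  change ((1 + s) * norm (f ((- d)%C *v u)) <= M * norm ((- d)%C *v u)) in B.
  rewrite norm_scal_eq, Cmod_opp in B.
  apply (Rmult_le_reg_l (1 + s)); [lra|].
  eapply Rle_trans; [exact B|]; rewrite <- !Rmult_assoc.
  apply Rmult_le_compat_r; [apply norm_ge_0 | lra].
- exists y.
  assert (Hy' : f (x -v d *v y) = y).
  { rewrite Hy at 2; change (f x +v f ((- d)%C *v y)) with (plus (f x) (f ((- d)%C *v y))).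
    rewrite <- (linear_plus f Lf); f_equal; vring V. }
  apply Hf in Hy'.
  apply (resolvent_shift _ z) in Hy'.
  replace (x -v d *v y -v (RtoC s - z)%C *v y) with x in Hy'; [exact Hy'|].
  unfold d; vring V.
Qed.

Lemma resolvent_unique z x y y' : near_halfline M z ->
  resolvent T z x y -> resolvent T z x y' -> y = y'.
Proof.
intros Hz Hy Hy'.
assert (H := lrel_plus Hy (lrel_scal (RtoC (-1)) Hy')).
apply (resolvent_bound z _ _ Hz) in H.
change ((1 + Cmod z) * norm (y +v RtoC (-1) *v y') <= 3 * M * norm (x +v RtoC (-1) *v x)) in H.
replace (x +v RtoC (-1) *v x) with (vzero : V) in H.
2:{ vlin V; apply injective_projections; simpl; ring. }
rewrite norm_zeroC, Rmult_0_r in H.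
apply norm_eq0; intros eps He; replace (y -v y') with (y +v RtoC (-1) *v y').
2:{ vlin V; apply injective_projections; simpl; ring. }
assert (0 <= Cmod z * norm (y +v RtoC (-1) *v y'))
  by (apply Rmult_le_pos; [apply Cmod_ge_0 | apply norm_ge_0]).
lra.
Qed.

Lemma res_spec z x y : near_halfline M z -> resolvent T z x y <-> y = res z x.
Proof.
intros Hz.
assert (S : resolvent T z x (res z x))
  by exact (epsilon_spec (inhabits vzero) (fun y => resolvent T z x y) (resolvent_ex z x Hz)).
split; [intros H; exact (resolvent_unique z x _ _ Hz H S) | intros E; subst y; exact S].
Qed.

Lemma near_halfline_nonneg s : 0 <= s -> near_halfline M (RtoC s).
Proof.
intros [Hs|Hs]; destruct HT as [M1 _].
- exists s; split; [exact Hs|].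
  replace (RtoC s - RtoC s)%C with (RtoC 0) by ring; rewrite Cmod_0; lra.
(* Centres must be positive, so 0 is reached from [s = 1 / (2 M)], where [M s = 1/2] is less than
   [(1 + s) / 2]. *)
- exists (/ (2 * M)); rewrite <- Hs.
  assert (0 < / (2 * M)) by (apply Rinv_0_lt_compat; lra).
  split; [assumption|].
  replace (RtoC 0 - RtoC (/ (2 * M)))%C with (- RtoC (/ (2 * M)))%C by ring.
  rewrite Cmod_opp, Cmod_R, Rabs_pos_eq by lra.
  replace (M * / (2 * M)) with (/ 2) by (field; lra); lra.
Qed.

Lemma res_family : resolvent_family V (near_halfline M) (3 * M) res.
Proof.
split.
- destruct HT as [M1 _]; lra.
- exact near_halfline_nonneg.
- intros z x y Hz; symmetry; apply (res_spec z _ _ Hz).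
  apply (lrel_plus (l := resolvent T z)); apply (res_spec z _ _ Hz); reflexivity.
- intros z c x Hz; symmetry; apply (res_spec z _ _ Hz).
  apply (lrel_scal (l := resolvent T z)); apply (res_spec z _ _ Hz); reflexivity.
- intros z x Hz; apply resolvent_bound; [exact Hz|]; apply (res_spec z _ _ Hz); reflexivity.
- intros z z' x Hz Hz'.
  assert (S' : resolvent T z' x (res z' x)) by (apply (res_spec z' _ _ Hz'); reflexivity).
  apply (resolvent_shift _ z) in S'.
  apply (res_spec z _ _ Hz) in S'.
  assert (L : res z (x -v (z' - z)%C *v res z' x) = res z x -v (z' - z)%C *v res z (res z' x)).
  { symmetry; apply (res_spec z _ _ Hz).
    assert (A : resolvent T z x (res z x)) by (apply (res_spec z _ _ Hz); reflexivity).
    assert (B : resolvent T z (res z' x) (res z (res z' x))) by (apply (res_spec z _ _ Hz); reflexivity).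
    assert (Q := lrel_plus A (lrel_scal (- (z' - z))%C B)).
    replace (x -v (z' - z)%C *v res z' x) with (x +v (- (z' - z))%C *v res z' x) by vring V.
    replace (res z x -v (z' - z)%C *v res z (res z' x))
      with (res z x +v (- (z' - z))%C *v res z (res z' x)) by vring V.
    exact Q. }
  transitivity (res z x -v (res z x -v (z' - z)%C *v res z (res z' x))); [|vring V].
  f_equal; rewrite <- L; exact S'.
- intros z x Hz E.
  assert (S : resolvent T z x vzero) by (apply (res_spec z _ _ Hz); auto).
  destruct S as [w [Hw Ew]]; change (x = z *v vzero +v w) in Ew.
  destruct HT as (_ & F & _).
  rewrite Ew, (F _ _ _ Hw (lrel_zero T)); vring V.
Qed.

Lemma res_0_spec y w : T y w <-> y = res (RtoC 0) w.
Proof.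
rewrite <- (res_spec (RtoC 0) w y (near_halfline_nonneg 0 (Rle_refl 0))).
split.
- intros H; exists w; split; [exact H|]; change (w = RtoC 0 *v y +v w); vring V.
- intros [w' [Hw' E]]; change (w = RtoC 0 *v y +v w') in E.
  replace w with w'; [exact Hw'|]; rewrite E; vring V.
Qed.

End PositiveOperator.

(** * Fractional powers and the semigroup law *)

Lemma kappa_pos a : 0 < a < 1 -> 0 < kappa a.
Proof.
intros Ha; assert (HPI := PI_RGT_0).
assert (S : 0 < sin (PI * a)).
{ apply sin_gt_0; [apply Rmult_lt_0_compat; lra|].
  rewrite <- (Rmult_1_r PI) at 2; apply Rmult_lt_compat_l; lra. }
assert (E := kappa_reflection a Ha).
destruct (Rlt_le_dec 0 (kappa a)) as [H|H]; [exact H|].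
assert (kappa a * sin (PI * a) <= 0) by nra; lra.
Qed.

Lemma contin_real_scal (V : CBanach) (g : R -> R) (f : R -> V) t :
  continuous g t -> contin V f t -> contin V (fun t => RtoC (g t) *v f t) t.
Proof.
intros Hg Hf.
apply (continuous_scal (K := C_AbsRing) (V := V) (fun t => RtoC (g t)) f t); [|exact Hf].
exact (filterlim_comp _ _ _ _ _ _ _ _ Hg (filterlim_RtoC (g t))).
Qed.

(** The substitution [s -> m s], in the shape that [is_int_affine] produces with slope 1. *)
Lemma exp_pow_kern a t m : 0 < m ->
  exp ((1 - a) * (1 * t + ln m)) / (exp (1 * t + ln m) + m) = exp (- a * ln m) * kern a t.
Proof.
intros Hm; unfold kern.
rewrite Rmult_1_l, exp_plus, exp_ln by exact Hm.
replace ((1 - a) * (t + ln m)) with ((1 - a) * t + - a * ln m + ln m) by ring.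
rewrite !exp_plus, exp_ln by exact Hm.
field; split; generalize (exp_pos t); [lra|]; intros.
assert (0 < exp t * m) by (apply Rmult_lt_0_compat; lra); lra.
Qed.

Lemma is_int_kern_scaled_norm (V : CBanach) (f : R -> V) B a m l :
  0 < a < 1 -> 0 < m ->
  (forall t, norm (f t) <= B * (exp ((1 - a) * t) / (exp t + m))) ->
  is_int V f minf pinf l -> norm l <= B * exp (- a * ln m) * kappa a.
Proof.
intros Ha Hm Hf Hl.
apply (is_int_affine V f 1 (ln m)) in Hl; [|lra].
apply (is_int_kern_norm V _ (B * exp (- a * ln m)) a) in Hl; [|exact Ha |].
- replace (RtoC (/ 1) *v l) with l in Hl; [exact Hl|].
  rewrite Rinv_1; vring V.
- intros t; rewrite Rmult_assoc, <- exp_pow_kern by exact Hm; apply Hf.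
Qed.

Lemma is_int_kern_scaled (V : CBanach) (v : V) a m :
  0 < a < 1 -> 0 < m ->
  is_int V (fun t => RtoC (exp ((1 - a) * t) / (exp t + m)) *v v) minf pinf
    (RtoC (exp (- a * ln m) * kappa a) *v v).
Proof.
intros Ha Hm.
assert (H := is_int_scal_vec V minf pinf _ v _ (is_int_kern a Ha)).
apply (is_int_affine V _ 1 (- ln m)) in H; [|lra].
apply (is_int_scal V minf pinf (RtoC (exp (- a * ln m)))) in H.
replace (RtoC (exp (- a * ln m) * kappa a) *v v)
  with (RtoC (exp (- a * ln m)) *v (RtoC (/ 1) *v (RtoC (kappa a) *v v))).
2:{ rewrite Rinv_1; vring V. }
refine (is_int_ext V minf pinf _ _ _ _ H).
intros t; cbv beta.
assert (E := exp_pow_kern a (1 * t + - ln m) m Hm).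
replace (1 * (1 * t + - ln m) + ln m) with t in E by ring.
rewrite E; vring V.
Qed.

(** [(m + A)^(-a) x] by Balakrishnan's formula, in the variable [s = e^t], for
    the resolvent [r] of [A]. *)
Definition neg_frac (V : CBanach) (r : C -> V -> V) (a m : R) (x : V) : V :=
  RtoC (/ kappa a) *v
    epsilon (inhabits vzero) (fun l =>
      is_int V (fun t => RtoC (exp ((1 - a) * t)) *v r (RtoC (exp t + m)) x) minf pinf l).

Section Semigroup.
Variables (V : CBanach) (G : C -> Prop) (K : R) (r : C -> V -> V).
Hypothesis Hr : resolvent_family V G K r.

Let rr (s : R) (x : V) : V := r (RtoC s) x.

Lemma rr_norm s x : 0 <= s -> (1 + s) * norm (rr s x) <= K * norm x.
Proof.
intros Hs; assert (B := rf_bound _ _ _ _ Hr (RtoC s) x (rf_nonneg _ _ _ _ Hr s Hs)).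
rewrite Cmod_R, Rabs_pos_eq in B by exact Hs; exact B.
Qed.

Lemma rr_norm1 s x : 0 <= s -> norm (rr s x) <= K * norm x.
Proof. intros Hs; apply (rf_norm V G K r Hr), (rf_nonneg _ _ _ _ Hr s Hs). Qed.

Lemma rr_comm s t x : 0 <= s -> 0 <= t -> rr s (rr t x) = rr t (rr s x).
Proof. intros Hs Ht; apply (rf_comm V G K r Hr); apply (rf_nonneg _ _ _ _ Hr); assumption. Qed.

Lemma rr_id s t x : 0 <= s -> 0 <= t -> rr s x -v rr t x = RtoC (t - s) *v rr s (rr t x).
Proof.
intros Hs Ht; rewrite RtoC_minus; apply (rf_id _ _ _ _ Hr); apply (rf_nonneg _ _ _ _ Hr); assumption.
Qed.

Lemma rr_linear s : 0 <= s -> is_linear (rr s).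
Proof. intros Hs; apply (rf_linear V G K r Hr), (rf_nonneg _ _ _ _ Hr s Hs). Qed.

Lemma rr_plus s x y : 0 <= s -> rr s (x +v y) = rr s x +v rr s y.
Proof. intros Hs; exact (linear_plus _ (rr_linear s Hs) x y). Qed.

Lemma rr_scal s c x : 0 <= s -> rr s (c *v x) = c *v rr s x.
Proof. intros Hs; exact (linear_scal _ (rr_linear s Hs) c x). Qed.

Lemma rr_minus s x y : 0 <= s -> rr s (x -v y) = rr s x -v rr s y.
Proof.
intros Hs; replace (x -v y) with (x +v (- RtoC 1)%C *v y) by vring V.
rewrite rr_plus, rr_scal by exact Hs; vring V.
Qed.

Lemma rr_contin s x : 0 < s -> contin V (fun s => rr s x) s.
Proof.
intros Hs; apply contin_lipschitz with (K * (K * norm x)).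
exists s; split; [exact Hs|]; intros s' Hs'.
apply Rabs_def2 in Hs'.
rewrite rr_id by lra; rewrite norm_scal_eq, Cmod_R.
rewrite <- Rabs_Ropp, Rmult_comm; replace (- (s - s')) with (s' - s) by ring.
apply Rmult_le_compat_r; [apply Rabs_pos|].
eapply Rle_trans; [apply rr_norm1; lra|]; apply Rmult_le_compat_l; [apply (rf_K _ _ _ _ Hr)|].
apply rr_norm1; lra.
Qed.

Let w (a m : R) (x : V) (t : R) : V := RtoC (exp ((1 - a) * t)) *v rr (exp t + m) x.

Lemma exp_shift_pos t m : 0 <= m -> 0 < exp t + m.
Proof. intros Hm; generalize (exp_pos t); lra. Qed.

Lemma exp_contin c t : continuous (fun t => exp (c * t)) t.
Proof. apply (ex_derive_continuous (V := R_NormedModule)); auto_derive; exact I. Qed.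

Lemma rr_exp_contin m x t : 0 <= m -> contin V (fun t => rr (exp t + m) x) t.
Proof.
intros Hm.
apply (continuous_comp (fun t => exp t + m) (fun s => rr s x) t).
- apply (ex_derive_continuous (V := R_NormedModule)); auto_derive; exact I.
- apply rr_contin, exp_shift_pos, Hm.
Qed.

Lemma w_contin a m x t : 0 <= m -> contin V (w a m x) t.
Proof.
intros Hm; apply contin_real_scal; [apply exp_contin | apply rr_exp_contin, Hm].
Qed.

Lemma exp_scal_norm a m t B (y : V) : 0 <= m -> (exp t + m) * norm y <= B ->
  norm (RtoC (exp ((1 - a) * t)) *v y) <= B * (exp ((1 - a) * t) / (exp t + m)).
Proof.
intros Hm HB; rewrite norm_scal_eq, Cmod_R, Rabs_pos_eq by (apply Rlt_le, exp_pos).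
assert (P := exp_shift_pos t m Hm); assert (Q := exp_pos ((1 - a) * t)).
apply (Rmult_le_reg_r (exp t + m)); [exact P|].
replace (B * (exp ((1 - a) * t) / (exp t + m)) * (exp t + m)) with (exp ((1 - a) * t) * B) by (field; lra).
rewrite Rmult_assoc; apply Rmult_le_compat_l; lra.
Qed.

Lemma w_norm a m x t : 0 <= m -> norm (w a m x t) <= K * norm x * kern a t.
Proof.
intros Hm; unfold kern; rewrite (Rplus_comm 1 (exp t)); apply exp_scal_norm; [lra|].
eapply Rle_trans; [|apply (rr_norm (exp t + m)); generalize (exp_pos t); lra].
apply Rmult_le_compat_r; [apply norm_ge_0 | lra].
Qed.

Lemma w_norm_scaled a m x t : 0 <= m ->
  norm (w a m x t) <= K * norm x * (exp ((1 - a) * t) / (exp t + m)).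
Proof.
intros Hm; apply exp_scal_norm; [exact Hm|].
eapply Rle_trans; [|apply (rr_norm (exp t + m)); generalize (exp_pos t); lra].
apply Rmult_le_compat_r; [apply norm_ge_0 | lra].
Qed.

Section OnePower.
Variable a : R.
Hypothesis Ha : 0 < a < 1.

Notation F := (neg_frac V r a).

Lemma neg_frac_int m x : 0 <= m ->
  is_int V (w a m x) minf pinf (RtoC (kappa a) *v F m x).
Proof.
intros Hm; unfold neg_frac.
assert (Hk := kappa_pos a Ha).
match goal with |- is_int _ _ _ _ (_ *v (_ *v ?l)) =>
  replace (RtoC (kappa a) *v (RtoC (/ kappa a) *v l)) with l end.
- apply epsilon_spec.
  apply (ex_int_kern_dom V minf pinf (w a m x) (K * norm x) a sigmoid_lim_minf sigmoid_lim_pinf Ha).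
  + intros t; apply w_contin, Hm.
  + intros t; apply w_norm, Hm.
- vlin V; rewrite Cmult_assoc, <- RtoC_mult, Rinv_r by lra; ring.
Qed.

Lemma neg_frac_unique m x l : 0 <= m ->
  is_int V (w a m x) minf pinf (RtoC (kappa a) *v l) -> F m x = l.
Proof.
intros Hm Hl; assert (Hk := kappa_pos a Ha).
assert (E := is_int_unique V minf pinf _ _ _ (neg_frac_int m x Hm) Hl).
apply (f_equal (fun v : V => RtoC (/ kappa a) *v v)) in E.
transitivity (RtoC (/ kappa a) *v (RtoC (kappa a) *v F m x)); [|rewrite E];
  vlin V; rewrite Cmult_assoc, <- RtoC_mult, Rinv_l by lra; ring.
Qed.

Lemma neg_frac_norm m x : 0 <= m -> norm (F m x) <= K * norm x.
Proof.
intros Hm; assert (Hk := kappa_pos a Ha).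
assert (B := is_int_kern_norm V _ _ a _ Ha (fun t => w_norm a m x t Hm) (neg_frac_int m x Hm)).
rewrite norm_scal_eq, Cmod_R, Rabs_pos_eq in B by lra.
apply (Rmult_le_reg_l (kappa a)); [exact Hk | lra].
Qed.

(** Scaling [s] by [m] turns the kernel [1 / (s + m)] into [m^(-a)] times [kern a]. Uniformity in
    [m] is what preserves asymptotics under products. *)
Lemma neg_frac_norm_scaled m x : 0 < m ->
  norm (RtoC (exp (a * ln m)) *v F m x) <= K * norm x.
Proof.
intros Hm; assert (Hk := kappa_pos a Ha).
assert (B := is_int_kern_scaled_norm V _ _ a m _ Ha Hm
  (fun t => w_norm_scaled a m x t (Rlt_le _ _ Hm)) (neg_frac_int m x (Rlt_le _ _ Hm))).
rewrite norm_scal_eq, Cmod_R, Rabs_pos_eq in B by lra.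
rewrite norm_scal_eq, Cmod_R, Rabs_pos_eq by (apply Rlt_le, exp_pos).
assert (P := exp_pos (a * ln m)); assert (Q := exp_pos (- a * ln m)).
assert (E : exp (a * ln m) * exp (- a * ln m) = 1).
{ rewrite <- exp_plus; replace (a * ln m + - a * ln m) with 0 by ring; apply exp_0. }
apply (Rmult_le_reg_l (kappa a)); [exact Hk|].
apply (Rmult_le_compat_l (exp (a * ln m))) in B; [|lra].
replace (exp (a * ln m) * (K * norm x * exp (- a * ln m) * kappa a))
  with (exp (a * ln m) * exp (- a * ln m) * (K * norm x * kappa a)) in B by ring.
rewrite E in B; lra.
Qed.

Lemma neg_frac_plus m x y : 0 <= m -> F m (x +v y) = F m x +v F m y.
Proof.
intros Hm; apply neg_frac_unique; [exact Hm|].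
replace (RtoC (kappa a) *v (F m x +v F m y))
  with (RtoC (kappa a) *v F m x +v RtoC (kappa a) *v F m y) by vring V.
refine (is_int_ext V minf pinf _ _ _ _
  (is_int_plus V minf pinf _ _ _ _ (neg_frac_int m x Hm) (neg_frac_int m y Hm))).
intros t; unfold w; rewrite rr_plus by (apply Rlt_le, exp_shift_pos, Hm); vring V.
Qed.

Lemma neg_frac_scal m c x : 0 <= m -> F m (c *v x) = c *v F m x.
Proof.
intros Hm; apply neg_frac_unique; [exact Hm|].
replace (RtoC (kappa a) *v (c *v F m x)) with (c *v (RtoC (kappa a) *v F m x)) by vring V.
refine (is_int_ext V minf pinf _ _ _ _ (is_int_scal V minf pinf c _ _ (neg_frac_int m x Hm))).
intros t; unfold w; rewrite rr_scal by (apply Rlt_le, exp_shift_pos, Hm); vring V.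
Qed.

Lemma neg_frac_linear m : 0 <= m -> is_linear (F m).
Proof.
intros Hm; split.
- intros x y; apply neg_frac_plus, Hm.
- intros c x; apply neg_frac_scal, Hm.
- exists (K + 1); split; [generalize (rf_K _ _ _ _ Hr); lra|].
  intros x; eapply Rle_trans; [apply (neg_frac_norm m x Hm)|].
  apply Rmult_le_compat_r; [apply norm_ge_0 | lra].
Qed.

Lemma neg_frac_minus m x y : 0 <= m -> F m (x -v y) = F m x -v F m y.
Proof.
intros Hm; replace (x -v y) with (x +v (- RtoC 1)%C *v y) by vring V.
rewrite neg_frac_plus, neg_frac_scal by exact Hm; vring V.
Qed.

Lemma neg_frac_comm m (L : V -> V) x : 0 <= m -> is_linear L ->
  (forall s x, 0 <= s -> L (rr s x) = rr s (L x)) -> L (F m x) = F m (L x).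
Proof.
intros Hm HL HC; symmetry; apply neg_frac_unique; [exact Hm|].
assert (H := is_int_lin V minf pinf V L _ _ HL (neg_frac_int m x Hm)).
assert (E : L (RtoC (kappa a) *v F m x) = RtoC (kappa a) *v L (F m x)) by apply (linear_scal L HL).
rewrite E in H.
refine (is_int_ext V minf pinf _ _ _ _ H); intros t; unfold w.
transitivity (RtoC (exp ((1 - a) * t)) *v L (rr (exp t + m) x)).
- exact (linear_scal L HL _ _).
- rewrite HC by (apply Rlt_le, exp_shift_pos, Hm); reflexivity.
Qed.

Lemma neg_frac_rr_comm m s x : 0 <= m -> 0 <= s -> rr s (F m x) = F m (rr s x).
Proof.
intros Hm Hs; apply neg_frac_comm; [exact Hm | apply rr_linear, Hs |].
intros t y Ht; apply rr_comm; assumption.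
Qed.

(* The derivative of [e^(-a t) (r m - r (e^t + m)) x] integrates to 0. *)
Lemma neg_frac_by_parts m x : 0 <= m ->
  is_int V (fun t => RtoC (exp ((1 - a) * t)) *v rr (exp t + m) (rr (exp t + m) x)) minf pinf
    (RtoC (kappa a) *v (RtoC a *v rr m (F m x))).
Proof.
intros Hm.
(* By the resolvent identity this is [e^(-a t) (r m - r (e^t + m)) x]; in the product form it is
   bounded by [kern a], hence vanishes at both ends. *)
set (f t := RtoC (exp ((1 - a) * t)) *v rr m (rr (exp t + m) x)).
set (df t := RtoC (exp ((1 - a) * t)) *v rr (exp t + m) (rr (exp t + m) x)
             -v RtoC a *v w a m (rr m x) t).
assert (HK := rf_K _ _ _ _ Hr).
assert (Nf : forall y t, norm (RtoC (exp ((1 - a) * t)) *v rr m (rr (exp t + m) y))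
               <= K * (K * norm y) * kern a t).
{ intros y t; replace (K * (K * norm y)) with (K * norm (y) * K) by ring.
  unfold kern; rewrite (Rplus_comm 1 (exp t)); apply exp_scal_norm; [lra|].
  assert (B := rr_norm (exp t + m) y (Rlt_le _ _ (exp_shift_pos t m Hm))).
  assert (A := rr_norm1 m (rr (exp t + m) y) Hm).
  assert (P := exp_pos t).
  apply Rle_trans with ((exp t + 1) * (K * norm (rr (exp t + m) y))).
  { apply Rmult_le_compat_l; lra. }
  apply Rle_trans with (K * ((1 + (exp t + m)) * norm (rr (exp t + m) y))).
  { replace ((exp t + 1) * (K * norm (rr (exp t + m) y)))
      with (K * ((exp t + 1) * norm (rr (exp t + m) y))) by ring.
    apply Rmult_le_compat_l; [exact HK|]; apply Rmult_le_compat_r; [apply norm_ge_0 | lra]. }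
  rewrite (Rmult_comm (K * norm y) K); apply Rmult_le_compat_l; lra. }
assert (Lim : forall (F0 : (R -> Prop) -> Prop) (FF : Filter F0), filterlim (kern a) F0 (locally 0) ->
   filterlim f F0 (locally (vzero : V))).
{ intros F0 FF Hk; apply filterlim_norm_lt; [exact FF|]; intros eps He.
  set (B := K * (K * norm x)) in *.
  assert (HB : 0 <= B).
  { apply Rmult_le_pos; [exact HK | apply Rmult_le_pos; [exact HK | apply norm_ge_0]]. }
  assert (Hd : 0 < eps / (B + 1)) by (apply Rdiv_lt_0_compat; lra).
  generalize (Hk _ (locally_ball 0 (mkposreal _ Hd))); unfold filtermap; apply filter_imp.
  intros t Ht; change (Rabs (kern a t - 0) < eps / (B + 1)) in Ht.
  rewrite Rminus_0_r, Rabs_pos_eq in Ht by (apply Rlt_le, kern_pos).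
  replace (f t -v vzero) with (f t) by vring V.
  eapply Rle_lt_trans; [apply Nf|]; fold B.
  assert (Kp := kern_pos a t).
  apply (Rmult_lt_compat_l (B + 1)) in Ht; [|lra].
  replace ((B + 1) * (eps / (B + 1))) with eps in Ht by (field; lra); lra. }
assert (CD : forall t, contin V df t /\ @is_derive R_AbsRing (restr V) f t (df t)).
(* [S] lies on the real axis, where [G] is known to contain the values of [z]; the rules for complex
   derivatives are used along it. *)
{ intros t0; set (S w := snd w = 0 /\ fst w <= t0 + 1).
  set (e w := cexp (RtoC (1 - a) * w)).
  set (z w := (cexp w + RtoC m)%C); set (y := rr m x).
  assert (CE : C11 C_CompleteNormedModule S e (fun w => RtoC (1 - a) * e w)%C).
  { apply (C11_subset _ _ (fun w => fst w <= t0 + 1)); [intros w' Hw; apply Hw|].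
    apply C11_cexp; lra. }
  assert (CZ : C11 C_CompleteNormedModule S z (fun w => cexp w + 0)%C).
  { apply (C11_plus C_CompleteNormedModule S cexp cexp (fun _ => RtoC m) (fun _ => RtoC 0)).
    - apply (C11_subset _ _ (fun w => fst w <= t0 + 1)); [intros w' Hw; apply Hw|].
      apply C11_cexp1.
    - exact (C11_const C_CompleteNormedModule S (RtoC m)). }
  assert (ZE : forall w', S w' -> z w' = RtoC (exp (fst w') + m)).
  { intros [p q] [Hq _]; simpl in Hq; subst q.
    unfold z, cexp, ray, cis; simpl; rewrite cos_0, sin_0.
    apply injective_projections; simpl; ring. }
  assert (CR : C11 V S (fun w => r (z w) y) (fun w => (cexp w + 0)%C *v vopp (r (z w) (r (z w) y)))).
  { apply (C11_comp V S G z _ (fun z => r z y) (fun z => vopp (r z (r z y))) CZ (C11_resolvent V G K r Hr y)).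
    intros w' Hw; rewrite ZE by exact Hw.
    apply (rf_nonneg _ _ _ _ Hr), Rlt_le, exp_shift_pos, Hm. }
  assert (CF := C11_mult V S _ _ _ _ CE CR).
  assert (HI : interior_hor S t0 0).
  { exists 1; split; [lra|]; intros s Hs; split; [reflexivity|].
    simpl; apply Rabs_def2 in Hs; lra. }
  assert (EE : forall t, e (t, 0) = RtoC (exp ((1 - a) * t))).
  { intros t; unfold e, cexp, ray, cis; simpl.
    replace ((1 - a) * 0 + 0 * t) with 0 by ring; rewrite cos_0, sin_0.
    replace ((1 - a) * t - 0 * 0) with ((1 - a) * t) by ring.
    apply injective_projections; simpl; ring. }
  assert (CX : forall t, cexp (t, 0) = RtoC (exp t)).
  { intros t; unfold cexp, ray, cis; simpl; rewrite cos_0, sin_0.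
    apply injective_projections; simpl; ring. }
  assert (ZZ : forall t, z (t, 0) = RtoC (exp t + m)).
  { intros t; unfold z; rewrite CX, RtoC_plus; reflexivity. }
  assert (E0 : forall t, e (t, 0) *v r (z (t, 0)) y = f t).
  { intros t; rewrite EE, ZZ; unfold f, y; f_equal.
    apply rr_comm; [apply Rlt_le, exp_shift_pos, Hm | exact Hm]. }
  assert (E1 : forall t, (RtoC (1 - a) * e (t, 0))%C *v r (z (t, 0)) y
     +v e (t, 0) *v ((cexp (t, 0) + 0)%C *v vopp (r (z (t, 0)) (r (z (t, 0)) y))) = df t).
  { intros t; rewrite EE, ZZ, CX; unfold df, w; fold (rr (exp t + m) y).
    fold (rr (exp t + m) (rr (exp t + m) y)).
    set (u := exp t + m); assert (Hu : 0 <= u) by (apply Rlt_le, exp_shift_pos, Hm).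
    (* The resolvent identity trades the growing factor [e^t] for a difference of resolvents. *)
    assert (I : RtoC (exp t) *v rr u y = y -v rr u x).
    { unfold y; rewrite rr_comm, rr_id by assumption.
      replace (u - m) with (exp t) by (unfold u; ring); reflexivity. }
    assert (J : RtoC (exp t) *v rr u (rr u y) = rr u y -v rr u (rr u x)).
    { rewrite <- rr_scal, I, rr_minus by exact Hu; reflexivity. }
    transitivity (RtoC (exp ((1 - a) * t)) *v (RtoC (1 - a) *v rr u y -v RtoC (exp t) *v rr u (rr u y)));
      [vring V|].
    rewrite J; fold y; vring V. }
  split.
  - exact (continuous_ext _ df t0 E1 (C11_contin_deriv V S _ _ CF t0 0 HI)).
  - rewrite <- E1.
    exact (is_derive_ext (V := restr V) _ f t0 _ E0 (C11_derive_horizontal V S _ _ CF t0 0 HI)). }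
assert (H := is_int_FTC V f df vzero vzero (fun t => proj2 (CD t)) (fun t => proj1 (CD t))
  (Lim minf _ (kern_lim_minf a ltac:(lra))) (Lim pinf _ (kern_lim_pinf a ltac:(lra)))).
assert (H' := is_int_plus V minf pinf _ _ _ _ H
  (is_int_scal V minf pinf (RtoC a) _ _ (neg_frac_int m (rr m x) Hm))).
replace (RtoC (kappa a) *v (RtoC a *v rr m (F m x)))
  with ((vzero -v vzero) +v RtoC a *v (RtoC (kappa a) *v F m (rr m x))).
2:{ rewrite neg_frac_rr_comm by exact Hm; vring V. }
refine (is_int_ext V minf pinf _ _ _ _ H').
intros t; unfold df; vring V.
Qed.

(** At [u = e^t + m] the second-order remainder of the integrand is
    [h^2 (u + h + A)^(-1) (u + A)^(-2) x]; the linear term is [neg_frac_by_parts]. *)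
Lemma neg_frac_flow m h x : 0 <= m -> 0 <= h ->
  norm (F (m + h) x -v F m x +v RtoC (h * a) *v rr m (F m x)) <= K * K * K * h ^ 2 * norm x.
Proof.
intros Hm Hh; assert (Hk := kappa_pos a Ha).
assert (H := is_int_plus V minf pinf _ _ _ _
  (is_int_minus V minf pinf _ _ _ _ (neg_frac_int (m + h) x ltac:(lra)) (neg_frac_int m x Hm))
  (is_int_scal V minf pinf (RtoC h) _ _ (neg_frac_by_parts m x Hm))).
apply (is_int_kern_norm V _ (K * K * K * h ^ 2 * norm x) a) in H; [|exact Ha|].
- replace (RtoC (kappa a) *v F (m + h) x -v RtoC (kappa a) *v F m x
    +v RtoC h *v (RtoC (kappa a) *v (RtoC a *v rr m (F m x))))
    with (RtoC (kappa a) *v (F (m + h) x -v F m x +v RtoC (h * a) *v rr m (F m x))) in H by vring V.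
  rewrite norm_scal_eq, Cmod_R, Rabs_pos_eq in H by lra.
  apply (Rmult_le_reg_l (kappa a)); [exact Hk | lra].
- intros t; unfold w; rewrite <- Rplus_assoc.
  set (u := exp t + m); assert (Hu : 0 < u) by (apply exp_shift_pos, Hm).
  replace (RtoC (exp ((1 - a) * t)) *v rr (u + h) x -v RtoC (exp ((1 - a) * t)) *v rr u x
     +v RtoC h *v (RtoC (exp ((1 - a) * t)) *v rr u (rr u x)))
    with (RtoC (exp ((1 - a) * t)) *v (RtoC (h * h) *v rr (u + h) (rr u (rr u x)))).
  + unfold kern; rewrite (Rplus_comm 1 (exp t)); apply exp_scal_norm; [lra|].
    rewrite norm_scal_eq, Cmod_R, Rabs_pos_eq by (apply Rmult_le_pos; assumption).
    assert (HK := rf_K _ _ _ _ Hr).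
    assert (B := rr_norm (u + h) (rr u (rr u x)) ltac:(lra)).
    assert (B1 : norm (rr u (rr u x)) <= K * (K * norm x)).
    { eapply Rle_trans; [apply rr_norm1; lra|]; apply Rmult_le_compat_l; [exact HK | apply rr_norm1; lra]. }
    apply Rle_trans with (h * h * ((1 + (u + h)) * norm (rr (u + h) (rr u (rr u x))))).
    { rewrite <- Rmult_assoc, (Rmult_comm _ (h * h)), Rmult_assoc.
      apply Rmult_le_compat_l; [apply Rmult_le_pos; exact Hh|].
      apply Rmult_le_compat_r; [apply norm_ge_0 | unfold u; lra]. }
    apply Rle_trans with (h * h * (K * (K * (K * norm x)))); [|right; ring].
    apply Rmult_le_compat_l; [apply Rmult_le_pos; exact Hh|].
    eapply Rle_trans; [exact B|]; apply Rmult_le_compat_l; assumption.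
  + assert (I1 : rr (u + h) x -v rr u x = (- RtoC h)%C *v rr (u + h) (rr u x)).
    { rewrite rr_id by lra; replace (u - (u + h)) with (- h) by ring; rewrite RtoC_opp; reflexivity. }
    assert (I2 : rr (u + h) (rr u x) -v rr u (rr u x) = (- RtoC h)%C *v rr (u + h) (rr u (rr u x))).
    { rewrite rr_id by lra; replace (u - (u + h)) with (- h) by ring; rewrite RtoC_opp; reflexivity. }
    transitivity (RtoC (exp ((1 - a) * t)) *v ((rr (u + h) x -v rr u x) +v RtoC h *v rr u (rr u x)));
      [|vring V].
    rewrite I1.
    transitivity (RtoC (exp ((1 - a) * t)) *v ((- RtoC h)%C *v (rr (u + h) (rr u x) -v rr u (rr u x)))); [|vring V].
    rewrite I2; vring V.
Qed.

(** Comparison with the scalar integral of [e^((1 - a) t) / (e^t + m)], which is [m^(-a) kappa a].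
    On the range of [A^(-1)] the difference of the integrands is [- (u + A)^(-1) x / u], with
    [u >= m], which yields the rate [1 / m]. *)
Lemma neg_frac_asymptotics m x : 0 < m ->
  norm (RtoC (exp (a * ln m)) *v F m (rr 0 x) -v rr 0 x) <= K * norm x / m.
Proof.
intros Hm; assert (Hk := kappa_pos a Ha).
assert (Em : exp (a * ln m) * exp (- a * ln m) = 1).
{ rewrite <- exp_plus; replace (a * ln m + - a * ln m) with 0 by ring; apply exp_0. }
assert (H := is_int_minus V minf pinf _ _ _ _ (neg_frac_int m (rr 0 x) ltac:(lra))
  (is_int_kern_scaled V (rr 0 x) a m Ha Hm)).
apply (is_int_kern_scaled_norm V _ (K * norm x / m) a m _ Ha Hm) in H.
- replace (RtoC (kappa a) *v F m (rr 0 x) -v RtoC (exp (- a * ln m) * kappa a) *v rr 0 x)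
    with (RtoC (kappa a) *v (F m (rr 0 x) -v RtoC (exp (- a * ln m)) *v rr 0 x)) in H by vring V.
  rewrite norm_scal_eq, Cmod_R, Rabs_pos_eq in H by lra.
  replace (RtoC (exp (a * ln m)) *v F m (rr 0 x) -v rr 0 x)
    with (RtoC (exp (a * ln m)) *v (F m (rr 0 x) -v RtoC (exp (- a * ln m)) *v rr 0 x)).
  2:{ vlin V; [ring|].
      transitivity (- (RtoC (exp (a * ln m)) * RtoC (exp (- a * ln m))))%C; [ring|].
      rewrite <- RtoC_mult, Em; ring. }
  rewrite norm_scal_eq, Cmod_R, Rabs_pos_eq by (apply Rlt_le, exp_pos).
  assert (P := exp_pos (a * ln m)).
  apply (Rmult_le_compat_l (exp (a * ln m))) in H; [|lra].
  replace (exp (a * ln m) * (K * norm x / m * exp (- a * ln m) * kappa a))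
    with (exp (a * ln m) * exp (- a * ln m) * (kappa a * (K * norm x / m))) in H by ring.
  rewrite Em, Rmult_1_l in H.
  apply (Rmult_le_reg_l (kappa a)); [exact Hk | lra].
- intros t; unfold w.
  set (u := exp t + m); assert (Hu : 0 < u) by (apply exp_shift_pos; lra).
  assert (Hmu : m <= u) by (unfold u; generalize (exp_pos t); lra).
  replace (RtoC (exp ((1 - a) * t)) *v rr u (rr 0 x) -v RtoC (exp ((1 - a) * t) / u) *v rr 0 x)
    with (RtoC (exp ((1 - a) * t)) *v (RtoC (- / u) *v rr u x)).
  + apply exp_scal_norm; [lra|]; fold u.
    rewrite norm_scal_eq, Cmod_R, Rabs_Ropp, Rabs_pos_eq by (apply Rlt_le, Rinv_0_lt_compat, Hu).
    rewrite <- Rmult_assoc, Rinv_r, Rmult_1_l by lra.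
    assert (B := rr_norm u x (Rlt_le _ _ Hu)).
    apply (Rmult_le_reg_l m); [exact Hm|].
    replace (m * (K * norm x / m)) with (K * norm x) by (field; lra).
    eapply Rle_trans; [|exact B]; apply Rmult_le_compat_r; [apply norm_ge_0 | lra].
  + assert (I : rr 0 x -v rr u x = RtoC u *v rr u (rr 0 x)).
    { rewrite rr_id, (rr_comm 0 u) by lra; f_equal; f_equal; ring. }
    assert (I' : RtoC (/ u) *v (rr 0 x -v rr u x) = rr u (rr 0 x)).
    { rewrite I; vlin V; rewrite Cmult_assoc, <- RtoC_mult, Rinv_l by lra; ring. }
    rewrite <- I'; unfold Rdiv; vring V.
Qed.

End OnePower.
End Semigroup.

(** * The differential equation in [m] and the semigroup law *)

Section SemigroupLaw.
Variables (V : CBanach) (G : C -> Prop) (K : R) (r : C -> V -> V).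
Hypothesis Hr : resolvent_family V G K r.

Let rr (s : R) (x : V) : V := r (RtoC s) x.

(** [y] solves [y' = - q r(m) y], up to second order. *)
Definition flow (q : R) (y : R -> V) : Prop :=
  exists B, 0 <= B /\ (forall m, 0 <= m -> norm (y m) <= B) /\
    forall m h, 0 <= m -> 0 <= h <= 1 ->
      norm (y (m + h) -v y m +v RtoC (h * q) *v rr m (y m)) <= B * h ^ 2.

(** The normalisation at infinity that selects one solution: [y m] behaves like [m^(-q) z], with
    relative error of order [1 / m]. *)
Definition asymptotic (q : R) (y : R -> V) (z : V) : Prop :=
  exists B, 0 <= B /\ forall m, 1 <= m ->
    norm (RtoC (exp (q * ln m)) *v y m -v z) <= B / m.

(** Leibniz rule; the exponents add because the powers commute with the resolvent. *)
Lemma flow_mult a q y : 0 < a < 1 -> flow q y ->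
  flow (q + a) (fun m => neg_frac V r a m (y m)).
Proof.
intros Ha (B & HB & By & Hy).
assert (HK := rf_K _ _ _ _ Hr).
set (F := neg_frac V r a).
assert (KB : 0 <= K * B) by (apply Rmult_le_pos; assumption).
assert (KKB : 0 <= K * K * B) by (apply Rmult_le_pos; [apply Rmult_le_pos|]; assumption).
assert (KKKB : 0 <= K * K * K * B) by (apply Rmult_le_pos; [apply Rmult_le_pos; [apply Rmult_le_pos|]|]; assumption).
assert (KKKKB : 0 <= K * (K * K * K * B)) by (apply Rmult_le_pos; assumption).
assert (Hq := Rabs_pos q).
set (D := K * (K * K * K * B) + K * (K * K * B)).
assert (HD : 0 <= D) by (unfold D; assert (0 <= K * (K * K * B)) by (apply Rmult_le_pos; assumption); lra).
assert (HqD : 0 <= Rabs q * D) by (apply Rmult_le_pos; assumption).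
exists (K * B + (K * B + Rabs q * D + K * K * K * B)); split; [lra|]; split.
{ intros m Hm; eapply Rle_trans; [apply (neg_frac_norm V G K r Hr a Ha m _ Hm)|].
  assert (K * norm (y m) <= K * B) by (apply Rmult_le_compat_l; auto); lra. }
intros m h Hm Hh.
assert (Hmh : 0 <= m + h) by lra.
assert (H2 : 0 <= h ^ 2) by apply pow2_ge_0.
assert (Fp := fun u v => neg_frac_plus V G K r Hr a Ha (m + h) u v Hmh).
assert (Fs := fun c u => neg_frac_scal V G K r Hr a Ha (m + h) c u Hmh).
assert (Fm := fun u v => neg_frac_minus V G K r Hr a Ha (m + h) u v Hmh).
fold F in Fp, Fs, Fm.
set (u := rr m (y m)).
assert (Cm : rr m (F m (y m)) = F m u) by (apply (neg_frac_rr_comm V G K r Hr a Ha); assumption).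
replace (F (m + h) (y (m + h)) -v F m (y m) +v RtoC (h * (q + a)) *v rr m (F m (y m)))
  with (F (m + h) (y (m + h) -v y m +v RtoC (h * q) *v u)
        -v RtoC (h * q) *v (F (m + h) u -v F m u)
        +v (F (m + h) (y m) -v F m (y m) +v RtoC (h * a) *v rr m (F m (y m)))).
2:{ rewrite Fp, Fm, Fs, Cm; vring V. }
assert (A1 : norm (F (m + h) (y (m + h) -v y m +v RtoC (h * q) *v u)) <= K * (B * h ^ 2)).
{ eapply Rle_trans; [apply (neg_frac_norm V G K r Hr a Ha _ _ Hmh)|].
  apply Rmult_le_compat_l; [exact HK | apply Hy; lra]. }
assert (A3 : norm (F (m + h) (y m) -v F m (y m) +v RtoC (h * a) *v rr m (F m (y m)))
          <= K * K * K * h ^ 2 * B).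
{ eapply Rle_trans; [apply (neg_frac_flow V G K r Hr a Ha m h (y m) Hm (proj1 Hh))|].
  apply Rmult_le_compat_l; [|auto].
  apply Rmult_le_pos; [apply Rmult_le_pos; [apply Rmult_le_pos|]|]; assumption. }
assert (Nu : norm u <= K * B).
{ eapply Rle_trans; [apply (rr_norm1 V G K r Hr); exact Hm|]; apply Rmult_le_compat_l; auto. }
(* The cross term already carries a factor [h], so a first-order bound on this increment suffices;
   [h <= 1] absorbs the quadratic part. *)
assert (A2 : norm (F (m + h) u -v F m u) <= h * D).
{ replace (F (m + h) u -v F m u) with ((F (m + h) u -v F m u +v RtoC (h * a) *v rr m (F m u))
    -v RtoC (h * a) *v rr m (F m u)) by vring V.
  eapply Rle_trans; [apply norm_minus_le|].
  rewrite norm_scal_eq, Cmod_R, Rabs_pos_eq by (apply Rmult_le_pos; lra).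
  assert (E1 : norm (F (m + h) u -v F m u +v RtoC (h * a) *v rr m (F m u)) <= K * K * K * h ^ 2 * (K * B)).
  { eapply Rle_trans; [apply (neg_frac_flow V G K r Hr a Ha m h u Hm (proj1 Hh))|].
    apply Rmult_le_compat_l; [|exact Nu].
    apply Rmult_le_pos; [apply Rmult_le_pos; [apply Rmult_le_pos|]|]; assumption. }
  assert (E2 : norm (rr m (F m u)) <= K * (K * (K * B))).
  { eapply Rle_trans; [apply (rr_norm1 V G K r Hr); exact Hm|]; apply Rmult_le_compat_l; [exact HK|].
    eapply Rle_trans; [apply (neg_frac_norm V G K r Hr a Ha _ _ Hm)|].
    apply Rmult_le_compat_l; assumption. }
  assert (E3 : K * K * K * h ^ 2 * (K * B) <= h * (K * (K * K * K * B))).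
  { replace (K * K * K * h ^ 2 * (K * B)) with (h * (h * (K * (K * K * K * B)))) by ring.
    apply Rmult_le_compat_l; [lra|].
    rewrite <- (Rmult_1_l (K * (K * K * K * B))) at 2; apply Rmult_le_compat_r; lra. }
  assert (E4 : h * a * norm (rr m (F m u)) <= h * (K * (K * K * B))).
  { rewrite Rmult_assoc; apply Rmult_le_compat_l; [lra|].
    replace (K * (K * K * B)) with (1 * (K * (K * (K * B)))) by ring.
    apply Rmult_le_compat; [lra | apply norm_ge_0 | lra | exact E2]. }
  unfold D; lra. }
eapply Rle_trans; [apply norm_plus_le|].
eapply Rle_trans; [apply Rplus_le_compat_r, norm_minus_le|].
rewrite norm_scal_eq, Cmod_R, Rabs_mult, (Rabs_pos_eq h) by lra.
assert (A2' : h * Rabs q * norm (F (m + h) u -v F m u) <= h * Rabs q * (h * D)).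
{ apply Rmult_le_compat_l; [apply Rmult_le_pos; lra | exact A2]. }
assert (0 <= K * B * h ^ 2) by (apply Rmult_le_pos; assumption).
replace (h * Rabs q * (h * D)) with (Rabs q * D * h ^ 2) in A2' by ring.
lra.
Qed.

(** The error of [y] is carried over by the bounded operator [m^a (m + A)^(-a)]; the new error is
    that of this operator on [rr 0 x]. *)
Lemma asymptotic_mult a q y x : 0 < a < 1 -> asymptotic q y (rr 0 x) ->
  asymptotic (q + a) (fun m => neg_frac V r a m (y m)) (rr 0 x).
Proof.
intros Ha (B & HB & Hy).
assert (HK := rf_K _ _ _ _ Hr).
set (F := neg_frac V r a).
exists (K * B + K * norm x).
split; [apply Rplus_le_le_0_compat; apply Rmult_le_pos; try assumption; apply norm_ge_0|].
intros m Hm.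
set (z := rr 0 x).
assert (Hm0 : 0 <= m) by lra.
replace (RtoC (exp ((q + a) * ln m)) *v F m (y m) -v z)
  with (RtoC (exp (a * ln m)) *v F m (RtoC (exp (q * ln m)) *v y m -v z)
        +v (RtoC (exp (a * ln m)) *v F m z -v z)).
2:{ unfold F; rewrite (neg_frac_minus V G K r Hr a Ha), (neg_frac_scal V G K r Hr a Ha) by exact Hm0.
    rewrite Rmult_plus_distr_r, exp_plus; vring V. }
eapply Rle_trans; [apply norm_plus_le|].
assert (A1 := neg_frac_norm_scaled V G K r Hr a Ha m (RtoC (exp (q * ln m)) *v y m -v z) ltac:(lra)).
assert (A2 := neg_frac_asymptotics V G K r Hr a Ha m x ltac:(lra)).
assert (A3 := Hy m Hm); fold z in A3.
apply (Rmult_le_compat_l K) in A3; [|exact HK].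
replace ((K * B + K * norm x) / m) with (K * (B / m) + K * norm x / m) by (field; lra).
apply Rplus_le_compat; [|exact A2].
eapply Rle_trans; [exact A1 | exact A3].
Qed.

Lemma flow_const v : flow 0 (fun _ => v).
Proof.
exists (norm v); split; [apply norm_ge_0|]; split; [intros; apply Rle_refl|].
intros m h _ _; rewrite Rmult_0_r.
replace (v -v v +v RtoC 0 *v rr m v) with (vzero : V) by vring V.
rewrite norm_zeroC; apply Rmult_le_pos; [apply norm_ge_0 | apply pow2_ge_0].
Qed.

Lemma asymptotic_const v : asymptotic 0 (fun _ => v) v.
Proof.
exists 0; split; [lra|]; intros m Hm.
rewrite Rmult_0_l, exp_0.
replace (RtoC 1 *v v -v v) with (vzero : V) by vring V.
rewrite norm_zeroC; unfold Rdiv; lra.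
Qed.

Lemma flow_minus q y y' : flow q y -> flow q y' -> flow q (fun m => y m -v y' m).
Proof.
intros (B & HB & By & Hy) (B' & HB' & By' & Hy'); exists (B + B'); split; [lra|]; split.
- intros m Hm; eapply Rle_trans; [apply norm_minus_le|].
  apply Rplus_le_compat; auto.
- intros m h Hm Hh.
  replace ((y (m + h) -v y' (m + h)) -v (y m -v y' m) +v RtoC (h * q) *v rr m (y m -v y' m))
    with ((y (m + h) -v y m +v RtoC (h * q) *v rr m (y m))
          -v (y' (m + h) -v y' m +v RtoC (h * q) *v rr m (y' m))).
  + eapply Rle_trans; [apply norm_minus_le|]; rewrite Rmult_plus_distr_r.
    apply Rplus_le_compat; auto.
  + unfold rr; rewrite (rr_minus V G K r Hr) by exact Hm; vring V.
Qed.

Lemma flow_resolvent v : flow 1 (fun m => rr m v).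
Proof.
assert (HK := rf_K _ _ _ _ Hr).
exists (K * norm v + K * (K * (K * norm v))).
assert (0 <= K * norm v) by (apply Rmult_le_pos; [exact HK | apply norm_ge_0]).
assert (0 <= K * (K * norm v)) by (apply Rmult_le_pos; assumption).
assert (0 <= K * (K * (K * norm v))) by (apply Rmult_le_pos; assumption).
split; [lra|]; split.
- intros m Hm; eapply Rle_trans; [apply (rr_norm1 V G K r Hr), Hm | lra].
- intros m h Hm Hh; rewrite Rmult_1_r.
  assert (Hmh : 0 <= m + h) by lra.
  assert (I : forall w, rr (m + h) w -v rr m w = RtoC (- h) *v rr (m + h) (rr m w)).
  { intros w; unfold rr; rewrite (rr_id V G K r Hr) by assumption.
    replace (m - (m + h)) with (- h) by ring; reflexivity. }
  replace (rr (m + h) v -v rr m v +v RtoC h *v rr m (rr m v))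
    with (RtoC (h ^ 2) *v rr (m + h) (rr m (rr m v))).
  + rewrite norm_scal_eq, Cmod_R, Rabs_pos_eq by apply pow2_ge_0.
    rewrite (Rmult_comm (h ^ 2)); apply Rmult_le_compat_r; [apply pow2_ge_0|].
    assert (norm (rr (m + h) (rr m (rr m v))) <= K * (K * (K * norm v))); [|lra].
    eapply Rle_trans; [apply (rr_norm1 V G K r Hr), Hmh|]; apply Rmult_le_compat_l; [exact HK|].
    eapply Rle_trans; [apply (rr_norm1 V G K r Hr), Hm|]; apply Rmult_le_compat_l; [exact HK|].
    apply (rr_norm1 V G K r Hr), Hm.
  + rewrite I.
    transitivity (RtoC (- h) *v (rr (m + h) (rr m v) -v rr m (rr m v))); [|vring V].
    rewrite I; replace (h ^ 2) with ((- h) * (- h)) by ring; vring V.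
Qed.

Lemma asymptotic_resolvent x : asymptotic 1 (fun m => rr m (rr 0 x)) (rr 0 x).
Proof.
assert (HK := rf_K _ _ _ _ Hr).
exists (K * norm x); split; [apply Rmult_le_pos; [exact HK | apply norm_ge_0]|].
intros m Hm; rewrite Rmult_1_l, exp_ln by lra.
replace (RtoC m *v rr m (rr 0 x) -v rr 0 x) with (vopp (rr m x)).
- rewrite norm_oppC.
  assert (B := rr_norm V G K r Hr m x ltac:(lra)).
  apply (Rmult_le_reg_l m); [lra|].
  replace (m * (K * norm x / m)) with (K * norm x) by (field; lra).
  eapply Rle_trans; [|exact B]; apply Rmult_le_compat_r; [apply norm_ge_0 | lra].
- assert (I : rr 0 x -v rr m x = RtoC m *v rr m (rr 0 x)).
  { unfold rr; rewrite (rr_id V G K r Hr), (rr_comm V G K r Hr 0 m) by lra.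
    f_equal; f_equal; ring. }
  rewrite <- I; vring V.
Qed.

(* [(1 + m r(0)) d(m)] is constant along the flow and tends to 0. *)
Lemma flow_unique (d : R -> V) : flow 1 d -> asymptotic 1 d vzero -> d 0 = vzero.
Proof.
intros (B & HB & Bd & Hd) (A & HA & Ad).
assert (HK := rf_K _ _ _ _ Hr).
assert (KB : 0 <= K * B) by (apply Rmult_le_pos; assumption).
(* This is [A^(-1) (m + A) d(m)]: a bounded expression that makes sense without [d m] being in the
   domain of [A]. *)
set (W m := d m +v RtoC m *v rr 0 (d m)).
assert (WC : forall N, 0 <= N -> W 0 = W N).
{ intros N HN.
  apply constant_of_quadratic_increments with (K := B + N * (K * B) + K * (K * B + B)); [exact HN|].
  intros s t Hs Hst Ht H1; set (h := t - s).
  assert (Hh : 0 <= h <= 1) by (unfold h; lra).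
  assert (Et : t = s + h) by (unfold h; ring).
  set (rho := d t -v d s +v RtoC h *v rr s (d s)).
  assert (Nrho : norm rho <= B * h ^ 2).
  { unfold rho; rewrite Et; replace h with (h * 1) at 2 by ring; apply Hd; [exact Hs | exact Hh]. }
  assert (I : rr 0 (d s) -v rr s (d s) = RtoC s *v rr 0 (rr s (d s))).
  { unfold rr; rewrite (rr_id V G K r Hr) by lra; f_equal; f_equal; ring. }
  assert (Ed : d t = d s -v RtoC h *v rr s (d s) +v rho) by (unfold rho; vring V).
  assert (R0 : forall u v, rr 0 (u +v v) = rr 0 u +v rr 0 v).
  { intros; apply (rr_plus V G K r Hr); lra. }
  assert (R1 : forall u v, rr 0 (u -v v) = rr 0 u -v rr 0 v).
  { intros; apply (rr_minus V G K r Hr); lra. }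
  assert (R2 : forall c v, rr 0 (c *v v) = c *v rr 0 v).
  { intros; apply (rr_scal V G K r Hr); lra. }
  assert (Nd : norm (d t -v d s) <= h * (K * B + B)).
  { replace (d t -v d s) with (rho -v RtoC h *v rr s (d s)) by (rewrite Ed; vring V).
    eapply Rle_trans; [apply norm_minus_le|].
    rewrite norm_scal_eq, Cmod_R, Rabs_pos_eq by lra.
    assert (X : norm (rr s (d s)) <= K * B).
    { eapply Rle_trans; [apply (rr_norm1 V G K r Hr), Hs|]; apply Rmult_le_compat_l; auto. }
    apply (Rmult_le_compat_l h) in X; [|lra].
    assert (B * h ^ 2 <= h * B).
    { replace (B * h ^ 2) with (h * B * h) by ring.
      rewrite <- (Rmult_1_r (h * B)) at 2; apply Rmult_le_compat_l; [apply Rmult_le_pos; lra | lra]. }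
    lra. }
  replace (W t -v W s) with (rho +v RtoC s *v rr 0 rho +v RtoC h *v rr 0 (d t -v d s)).
  2:{ transitivity ((d t -v d s) +v RtoC s *v rr 0 (d t -v d s) +v RtoC h *v rr 0 (d t)).
      2:{ unfold W; rewrite R1; replace (RtoC t) with (RtoC s + RtoC h)%C
            by (rewrite Et, RtoC_plus; reflexivity); vring V. }
      assert (E0 : rr 0 (d t) = rr 0 (d t -v d s) +v (rr s (d s) +v RtoC s *v rr 0 (rr s (d s)))).
      { rewrite <- I, R1; vring V. }
      assert (E1 : rr 0 rho = rr 0 (d t -v d s) +v RtoC h *v rr 0 (rr s (d s))).
      { unfold rho; rewrite R0, R2; reflexivity. }
      rewrite E1, E0; unfold rho; vring V. }
  eapply Rle_trans; [apply norm_plus_le|].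
  eapply Rle_trans; [apply Rplus_le_compat_r, norm_plus_le|].
  rewrite !norm_scal_eq, !Cmod_R, !Rabs_pos_eq by lra.
  assert (X1 : norm (rr 0 rho) <= K * (B * h ^ 2)).
  { eapply Rle_trans; [apply (rr_norm1 V G K r Hr); lra|]; apply Rmult_le_compat_l; assumption. }
  assert (X2 : norm (rr 0 (d t -v d s)) <= K * (h * (K * B + B))).
  { eapply Rle_trans; [apply (rr_norm1 V G K r Hr); lra|]; apply Rmult_le_compat_l; assumption. }
  apply (Rmult_le_compat_l h) in X2; [|lra].
  assert (X3 : s * norm (rr 0 rho) <= N * (K * (B * h ^ 2))).
  { apply Rmult_le_compat; [exact Hs | apply norm_ge_0 | lra | exact X1]. }
  replace ((B + N * (K * B) + K * (K * B + B)) * h ^ 2)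
    with (B * h ^ 2 + N * (K * (B * h ^ 2)) + h * (K * (h * (K * B + B)))) by ring.
  lra. }
apply norm_eq0; intros eps He.
replace (d 0 -v vzero) with (W 0) by (unfold W; vring V).
assert (HA1 : 0 <= (1 + K) * A) by (apply Rmult_le_pos; lra).
(* The decay of [d] gives [norm (W N) <= (1 + K) A / N], made at most [eps] by this choice; the
   summand 1 puts [N] in the range of the asymptotics. *)
set (N := 1 + (1 + K) * A / eps).
assert (HN : 1 <= N).
{ unfold N; assert (0 <= (1 + K) * A / eps) by (apply Rdiv_le_0_compat; assumption); lra. }
rewrite (WC N) by lra.
assert (D1 := Ad N HN).
rewrite Rmult_1_l, exp_ln in D1 by lra.
replace (RtoC N *v d N -v vzero) with (RtoC N *v d N) in D1 by vring V.
rewrite norm_scal_eq, Cmod_R, Rabs_pos_eq in D1 by lra.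
unfold W; eapply Rle_trans; [apply norm_plus_le|].
rewrite norm_scal_eq, Cmod_R, Rabs_pos_eq by lra.
assert (D2 : norm (rr 0 (d N)) <= K * norm (d N)) by (apply (rr_norm1 V G K r Hr); lra).
assert (D3 : N * norm (rr 0 (d N)) <= K * (A / N)).
{ apply Rle_trans with (N * (K * norm (d N))); [apply Rmult_le_compat_l; lra|].
  replace (N * (K * norm (d N))) with (K * (N * norm (d N))) by ring.
  apply Rmult_le_compat_l; assumption. }
assert (D4 : norm (d N) <= A / N).
{ eapply Rle_trans; [|exact D1]; rewrite <- (Rmult_1_l (norm (d N))) at 1.
  apply Rmult_le_compat_r; [apply norm_ge_0 | exact HN]. }
apply Rle_trans with ((1 + K) * A / N).
{ unfold Rdiv in *; lra. }
apply (Rmult_le_reg_r N); [lra|].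
replace ((1 + K) * A / N * N) with ((1 + K) * A) by (field; lra).
unfold N; replace (eps * (1 + (1 + K) * A / eps)) with (eps + (1 + K) * A) by (field; lra); lra.
Qed.

Lemma flow_value y x : flow 1 y -> asymptotic 1 y (rr 0 x) -> y 0 = rr 0 (rr 0 x).
Proof.
intros Fy (B & HB & Ay).
assert (E : y 0 -v rr 0 (rr 0 x) = vzero).
{ apply (flow_unique (fun m => y m -v rr m (rr 0 x))).
  - apply flow_minus; [exact Fy | apply flow_resolvent].
  - destruct (asymptotic_resolvent x) as (B' & HB' & Ar).
    exists (B + B'); split; [lra|]; intros m Hm.
    replace (RtoC (exp (1 * ln m)) *v (y m -v rr m (rr 0 x)) -v vzero)
      with ((RtoC (exp (1 * ln m)) *v y m -v rr 0 x)
            -v (RtoC (exp (1 * ln m)) *v rr m (rr 0 x) -v rr 0 x)) by vring V.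
    eapply Rle_trans; [apply norm_minus_le|].
    replace ((B + B') / m) with (B / m + B' / m) by (field; lra).
    apply Rplus_le_compat; auto. }
transitivity ((y 0 -v rr 0 (rr 0 x)) +v rr 0 (rr 0 x)); [vring V | rewrite E; vring V].
Qed.

Notation F a := (neg_frac V r a 0).

Lemma rr0_inj x y : rr 0 x = rr 0 y -> x = y.
Proof.
intros E; assert (Z : x -v y = vzero).
{ apply (rf_inj _ _ _ _ Hr (RtoC 0)); [apply (rf_nonneg _ _ _ _ Hr); lra|].
  change (rr 0 (x -v y) = vzero); unfold rr; rewrite (rr_minus V G K r Hr) by lra.
  fold (rr 0 x); fold (rr 0 y); rewrite E; vring V. }
transitivity ((x -v y) +v y); [vring V | rewrite Z; vring V].
Qed.

(** The asymptotics require data in the range of [rr 0], so the identity is obtained for [rr 0 x]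
    and the injective [rr 0] is cancelled. *)
Lemma neg_frac_complement a x : 0 < a < 1 -> F a (F (1 - a) x) = rr 0 x.
Proof.
intros Ha; assert (Ha' : 0 < 1 - a < 1) by lra.
apply rr0_inj.
transitivity (F a (F (1 - a) (rr 0 x))).
{ unfold rr; rewrite (neg_frac_rr_comm V G K r Hr a Ha), (neg_frac_rr_comm V G K r Hr _ Ha') by lra.
  reflexivity. }
apply (flow_value (fun m => neg_frac V r a m (neg_frac V r (1 - a) m (rr 0 x)))).
- refine (eq_ind (0 + (1 - a) + a) (fun q => flow q _) _ 1 _); [|ring].
  apply (flow_mult a _ (fun m => neg_frac V r (1 - a) m (rr 0 x)) Ha).
  apply (flow_mult (1 - a) 0 (fun m => rr 0 x) Ha'), flow_const.
- refine (eq_ind (0 + (1 - a) + a) (fun q => asymptotic q _ _) _ 1 _); [|ring].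
  apply (asymptotic_mult a _ (fun m => neg_frac V r (1 - a) m (rr 0 x)) x Ha).
  apply (asymptotic_mult (1 - a) 0 (fun m => rr 0 x) x Ha'), asymptotic_const.
Qed.

(** A further power, of exponent [1 - a], leads to the injective [rr 0]. *)
Lemma neg_frac_inj a x y : 0 < a < 1 -> F a x = F a y -> x = y.
Proof.
intros Ha E; apply rr0_inj.
rewrite <- (neg_frac_complement (1 - a) x), <- (neg_frac_complement (1 - a) y) by lra.
replace (1 - (1 - a)) with a by ring; rewrite E; reflexivity.
Qed.

(** Only products of total exponent 1 are computed by the flow. The missing exponent [c] is
    therefore supplied on both sides, where each gives [rr 0 x], and [F c] is cancelled. *)
Theorem neg_frac_semigroup a b x : 0 < a -> 0 < b -> a + b < 1 ->
  F a (F b x) = F (a + b) x.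
Proof.
intros Ha Hb Hab; set (c := 1 - (a + b)).
assert (Ha' : 0 < a < 1) by lra; assert (Hb' : 0 < b < 1) by lra.
assert (Hc : 0 < c < 1) by (unfold c; lra).
apply (neg_frac_inj c); [exact Hc|].
transitivity (rr 0 x).
2:{ symmetry; replace (a + b) with (1 - c) by (unfold c; ring).
    apply neg_frac_complement, Hc. }
apply rr0_inj.
transitivity (F c (F a (F b (rr 0 x)))).
{ unfold rr; rewrite (neg_frac_rr_comm V G K r Hr c Hc), (neg_frac_rr_comm V G K r Hr a Ha'),
    (neg_frac_rr_comm V G K r Hr b Hb') by lra; reflexivity. }
apply (flow_value (fun m => neg_frac V r c m (neg_frac V r a m (neg_frac V r b m (rr 0 x))))).
- refine (eq_ind (0 + b + a + c) (fun q => flow q _) _ 1 _); [|unfold c; ring].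
  apply (flow_mult c _ (fun m => neg_frac V r a m (neg_frac V r b m (rr 0 x))) Hc).
  apply (flow_mult a _ (fun m => neg_frac V r b m (rr 0 x)) Ha').
  apply (flow_mult b 0 (fun m => rr 0 x) Hb'), flow_const.
- refine (eq_ind (0 + b + a + c) (fun q => asymptotic q _ _) _ 1 _); [|unfold c; ring].
  apply (asymptotic_mult c _ (fun m => neg_frac V r a m (neg_frac V r b m (rr 0 x))) x Hc).
  apply (asymptotic_mult a _ (fun m => neg_frac V r b m (rr 0 x)) x Ha').
  apply (asymptotic_mult b 0 (fun m => rr 0 x) x Hb'), asymptotic_const.
Qed.

Lemma neg_frac_neg_frac_comm a b x : 0 < a < 1 -> 0 < b < 1 -> F a (F b x) = F b (F a x).
Proof.
intros Ha Hb; apply (neg_frac_comm V G K r Hr b Hb 0 (F a)); [lra | |].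
- apply (neg_frac_linear V G K r Hr a Ha); lra.
- intros s y Hs; symmetry; apply (neg_frac_rr_comm V G K r Hr a Ha); lra.
Qed.

End SemigroupLaw.

(** * The contour integral *)

Lemma Carg_ray t r : 0 < r -> - PI < t < PI -> Carg (ray t r) = t.
Proof.
intros Hr Ht; unfold Carg.
assert (E : Re (ray t r) / Cmod (ray t r) = cos t).
{ rewrite Cmod_ray by lra; unfold ray, cis; simpl; field; lra. }
assert (I : Im (ray t r) = r * sin t) by (unfold ray, cis; simpl; ring).
rewrite E, I; destruct (Rlt_dec (r * sin t) 0) as [H|H].
- assert (t < 0).
  { destruct (Rlt_le_dec t 0) as [H'|H']; [exact H'|exfalso].
    assert (0 <= sin t) by (apply sin_ge_0; lra).
    assert (0 <= r * sin t) by (apply Rmult_le_pos; lra); lra. }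
  rewrite <- (cos_neg t), acos_cos by lra; ring.
- assert (0 <= t).
  { destruct (Rlt_le_dec t 0) as [H'|H']; [exfalso|exact H'].
    apply H; assert (0 < sin (- t)) by (apply sin_gt_0; lra).
    rewrite sin_neg in *; assert (0 < r * - sin t) by (apply Rmult_lt_0_compat; lra); lra. }
  apply acos_cos; lra.
Qed.

(** Arguments of [z] in []- 2 PI, 0[] become principal arguments of [- z]. *)
Lemma opp_ray t r : (- ray t r)%C = ray (t + PI) r.
Proof.
unfold ray, cis; rewrite neg_cos, neg_sin; apply injective_projections; simpl; ring.
Qed.

Lemma ray_period t r : ray (t - 2 * PI) r = ray t r.
Proof.
unfold ray, cis; f_equal; f_equal.
- rewrite <- (cos_period (t - 2 * PI) 1); f_equal; simpl; ring.
- rewrite <- (sin_period (t - 2 * PI) 1); f_equal; simpl; ring.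
Qed.

Lemma cis_plus s t : cis (s + t) = (cis s * cis t)%C.
Proof.
unfold cis; rewrite cos_plus, sin_plus; apply injective_projections; simpl; ring.
Qed.

Lemma is_int_exp_subst (V : CBanach) (g h : R -> V) r l :
  0 < r -> (forall t, contin V h t) -> (forall t, 0 < t -> g t = RtoC (/ t) *v h (ln t)) ->
  is_int V h (at_point (ln r)) pinf l -> is_int V g (at_point r) pinf l.
Proof.
intros Hr Hh Hg H P HP.
assert (Cg : forall t, 0 < t -> contin V g t).
{ intros t Ht.
  apply (continuous_ext_loc g (fun t => RtoC (/ t) *v h (ln t)) t).
  - exists (mkposreal t Ht); intros s Hs; change (Rabs (s - t) < t) in Hs.
    apply Rabs_def2 in Hs; symmetry; apply Hg; lra.
  - apply contin_real_scal.
    + apply (ex_derive_continuous (V := R_NormedModule)); auto_derive; lra.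
    + apply (continuous_comp ln h t); [|apply Hh].
      apply (ex_derive_continuous (V := R_NormedModule)); auto_derive; exact Ht. }
destruct (H P HP) as [Q1 Q2 H1 [m H2] HQ].
exists (fun x => x = r) (fun y => Rmax r (exp m) < y); [reflexivity | eexists; eauto |].
intros x y -> Hy; cbn [fst snd].
assert (Hy1 := Rle_lt_trans _ _ _ (Rmax_l _ _) Hy).
assert (Hy2 := Rle_lt_trans _ _ _ (Rmax_r _ _) Hy).
assert (Hm : m < ln y) by (rewrite <- (ln_exp m); apply ln_increasing; [apply exp_pos | exact Hy2]).
destruct (HQ (ln r) (ln y) H1 (H2 _ Hm)) as [v [Hv Pv]]; cbn [fst snd] in Hv.
exists v; split; [|exact Pv].
assert (E : v = rint V g r y).
{ rewrite <- (rint_unique V _ _ _ _ Hv).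
  replace (rint V g r y) with (rint V g (exp (ln r)) (exp (ln y))) by (rewrite !exp_ln by lra; reflexivity).
  refine (eq_trans _ (RInt_comp (V := restrC V) g exp exp (ln r) (ln y) _ _)).
  - apply (RInt_ext (V := restrC V)); intros t _.
    change (h t = RtoC (exp t) *v g (exp t)).
    rewrite Hg by apply exp_pos; rewrite ln_exp.
    vlin V; rewrite Cmult_assoc, <- RtoC_mult, Rinv_r by (apply Rgt_not_eq, exp_pos); ring.
  - intros t _; apply Cg, exp_pos.
  - intros t _; split; [apply is_derive_Reals, derivable_pt_lim_exp|].
    apply (ex_derive_continuous (V := R_NormedModule)); auto_derive; exact I. }
rewrite E; apply is_RInt_rint; intros t Ht; apply Cg.
rewrite Rmin_left in Ht by lra; lra.
Qed.

(** The centre [r / cos t] is where the perpendicular to the ray at [ray t r] meets the real axis.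
    Its distance to the point is [|sin t|] times the centre, the least possible ratio. *)
Lemma near_halfline_sector M t r : 0 <= M -> 0 < r -> 0 < cos t -> M * Rabs (sin t) < / 2 ->
  near_halfline M (ray t r).
Proof.
intros HM Hr Hc Hs; exists (r / cos t).
assert (P : 0 < r / cos t) by (apply Rdiv_lt_0_compat; assumption).
split; [exact P|].
replace (ray t r - RtoC (r / cos t))%C with (RtoC (r / cos t * sin t) * cis (t + PI / 2))%C.
- rewrite Cmod_mult, Cmod_cis, Cmod_R, Rabs_mult, (Rabs_pos_eq (r / cos t)) by lra.
  rewrite Rmult_1_r.
  apply Rle_lt_trans with (r / cos t * / 2); [|lra].
  replace (M * (r / cos t * Rabs (sin t))) with (r / cos t * (M * Rabs (sin t))) by ring.
  apply Rmult_le_compat_l; lra.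
- unfold ray, cis; rewrite cos_plus, sin_plus, cos_PI2, sin_PI2.
  assert (S : sin t * sin t = 1 - cos t * cos t).
  { generalize (sin2_cos2 t); unfold Rsqr; lra. }
  apply injective_projections; simpl; [|field; lra].
  transitivity (- (r / cos t * (sin t * sin t))); [ring|]; rewrite S; field; lra.
Qed.

(** The centre [1 / (2 M) - r] has distance at most [1 / (2 M)] to the whole disc, so [M] times the
    distance is at most [1/2]. *)
Lemma near_halfline_disc M r z : 0 < M -> Cmod z <= r -> r < 1 / (2 * M) -> near_halfline M z.
Proof.
intros HM Hz Hr; exists (1 / (2 * M) - r).
split; [lra|].
assert (A : Cmod (z - RtoC (1 / (2 * M) - r)) <= 1 / (2 * M)).
{ unfold Cminus; eapply Rle_trans; [apply Cmod_triangle|].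
  rewrite Cmod_opp, Cmod_R, Rabs_pos_eq by lra; lra. }
apply (Rmult_le_compat_l M) in A; [|lra].
replace (M * (1 / (2 * M))) with (/ 2) in A by (field; lra); lra.
Qed.

Section Contour.
Variables (V : CBanach) (T : lrel V V) (M psi : R).
Hypothesis HT : positive_with T M.
Hypothesis Hpsi : 0 < psi < asin (1 / (2 * M)).

Let HM : 1 <= M := proj1 HT.

Lemma psi_bound : psi < PI / 2 /\ M * sin psi < / 2.
Proof.
assert (B : -1 <= 1 / (2 * M) <= 1).
{ assert (0 < 1 / (2 * M)) by (apply Rdiv_lt_0_compat; lra).
  split; [lra|].
  apply (Rmult_le_reg_r (2 * M)); [lra|].
  replace (1 / (2 * M) * (2 * M)) with 1 by (field; lra); lra. }
assert (A := asin_bound (1 / (2 * M))).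
split; [lra|].
assert (Hs : sin psi < 1 / (2 * M)).
{ rewrite <- (sin_asin (1 / (2 * M)) B); apply sin_increasing_1; lra. }
apply (Rmult_lt_compat_l M) in Hs; [|lra].
replace (M * (1 / (2 * M))) with (/ 2) in Hs by (field; lra); exact Hs.
Qed.

Lemma near_sector t y : - psi <= y <= psi -> near_halfline M (cexp (t, y)).
Proof.
intros Hy; destruct psi_bound as [B1 B2].
apply near_halfline_sector; [lra | apply exp_pos | apply cos_gt_0; simpl; lra |].
simpl; eapply Rle_lt_trans; [|exact B2].
apply Rmult_le_compat_l; [lra|]; apply Rabs_le.
rewrite <- sin_neg; split; apply sin_incr_1; lra.
Qed.

(** The same sector one turn lower, around the other side of the cut. *)
Lemma near_sector' t y : - psi - 2 * PI <= y <= psi - 2 * PI -> near_halfline M (cexp (t, y)).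
Proof.
intros Hy; replace (cexp (t, y)) with (cexp (t, y + 2 * PI)); [apply near_sector; lra|].
unfold cexp; cbn [fst snd]; rewrite <- (ray_period (y + 2 * PI)); f_equal; ring.
Qed.

Variable r : R.
Hypothesis Hr : 0 < r < 1 / (2 * M).

Lemma near_disc t y : t <= ln r -> near_halfline M (cexp (t, y)).
Proof.
intros Ht; apply near_halfline_disc with r; [lra | | lra].
rewrite Cmod_cexp; cbn [fst]; rewrite <- (exp_ln r) by lra; apply exp_le, Ht.
Qed.

Variables (a : R) (x : V).
Hypothesis Ha : 0 < a < 1.

Let HF := res_family V T M HT.
Notation res := (res V T).

(** The scalar factor [(- z)^(-a) dz/dw] at [z = e^w], with [w + i PI] as logarithm of [- z]. *)
Let e (w : C) : C := (cis (- (a * PI)) * cexp (RtoC (1 - a) * w))%C.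
Let n (w : C) : V := e w *v res (cexp w) x.
Let S (N : R) (w : C) : Prop := fst w <= N /\ near_halfline M (cexp w).

Lemma contour_C11 N : exists n1, C11 V (S N) n n1.
Proof.
assert (CS : C11 C_CompleteNormedModule (S N) cexp cexp).
{ apply (C11_subset _ _ (fun w => fst w <= N)); [intros w Hw; apply Hw | apply C11_cexp1]. }
eexists; apply (C11_mult V (S N) e (fun w => 0 * cexp (RtoC (1 - a) * w)
    + cis (- (a * PI)) * (RtoC (1 - a) * cexp (RtoC (1 - a) * w)))%C
  (fun w => res (cexp w) x) (fun w => cexp w *v vopp (res (cexp w) (res (cexp w) x)))).
- apply (C11_mult C_CompleteNormedModule (S N) (fun _ => cis (- (a * PI))) (fun _ => RtoC 0)
    (fun w => cexp (RtoC (1 - a) * w)) (fun w => (RtoC (1 - a) * cexp (RtoC (1 - a) * w))%C)).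
  + exact (C11_const C_CompleteNormedModule (S N) (cis (- (a * PI)))).
  + apply (C11_subset _ _ (fun w => fst w <= N)); [intros w Hw; apply Hw|].
    apply C11_cexp; lra.
- apply (C11_comp V (S N) (near_halfline M) cexp cexp (fun z => res z x)
    (fun z => vopp (res z (res z x))) CS (C11_resolvent V _ _ _ HF x)).
  intros w Hw; apply Hw.
Qed.

(** The strict inequality of [near_halfline] leaves a slack [gap], which is divided by [M] times the
    Lipschitz constant of [cexp]; the summand 1 avoids a zero denominator. *)
Lemma contour_interior N t y : t < N -> near_halfline M (cexp (t, y)) -> interior_pt (S N) (t, y).
Proof.
intros Ht (s & Hs & Hn).
destruct (C11_cexp1 N) as [K [HK H]].
set (gap := (1 + s) / 2 - M * Cmod (cexp (t, y) - RtoC s)).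
assert (Hg : 0 < gap) by (unfold gap; lra).
assert (Hp : 0 < Rmin (N - t) (gap / (M * K + 1))).
{ assert (0 <= M * K) by (apply Rmult_le_pos; lra).
  apply Rmin_pos; [lra | apply Rdiv_lt_0_compat; lra]. }
exists (Rmin (N - t) (gap / (M * K + 1))); split; [exact Hp|].
intros w' Hw'; apply Rmin_Rgt in Hw'; destruct Hw' as [H1 H2].
assert (X : fst w' <= N).
{ assert (A := re_le_Cmod (w' - (t, y))%C); unfold Re in A; simpl in A.
  generalize (Rle_abs (fst w' + - t)); lra. }
split; [exact X|]; exists s; split; [exact Hs|].
destruct (H (t, y) w') as (_ & _ & D & _); [simpl; lra | exact X |].
change (Cmod (cexp w' - cexp (t, y)) <= K * Cmod (w' - (t, y))) in D.
assert (A : Cmod (cexp w' - RtoC s) <= Cmod (cexp w' - cexp (t, y)) + Cmod (cexp (t, y) - RtoC s)).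
{ replace (cexp w' - RtoC s)%C with ((cexp w' - cexp (t, y)) + (cexp (t, y) - RtoC s))%C by ring.
  apply Cmod_triangle. }
assert (Q : M * K * Cmod (w' - (t, y)) < gap).
{ assert (0 <= M * K) by (apply Rmult_le_pos; lra).
  apply Rle_lt_trans with ((M * K + 1) * Cmod (w' - (t, y))).
  - apply Rmult_le_compat_r; [apply Cmod_ge_0 | lra].
  - apply Rgt_lt, (Rmult_lt_compat_l (M * K + 1)) in H2; [|lra].
    replace ((M * K + 1) * (gap / (M * K + 1))) with gap in H2 by (field; lra); exact H2. }
apply (Rmult_le_compat_l M) in A; [|lra].
apply (Rmult_le_compat_l M) in D; [|lra].
unfold gap in Q; lra.
Qed.

Lemma contour_contin_h t y : near_halfline M (cexp (t, y)) -> contin V (fun t => n (t, y)) t.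
Proof.
intros H; destruct (contour_C11 (t + 1)) as [n1 Hn].
apply (C11_contin_horizontal V (S (t + 1)) n n1 Hn), interior_pt_hor, contour_interior; [lra | exact H].
Qed.

Lemma contour_contin_v t y : near_halfline M (cexp (t, y)) -> contin V (fun y => n (t, y)) y.
Proof.
intros H; destruct (contour_C11 (t + 1)) as [n1 Hn].
apply (C11_contin_vertical V (S (t + 1)) n n1 Hn), contour_interior; [lra | exact H].
Qed.

Lemma contour_bound t y : near_halfline M (cexp (t, y)) ->
  norm (n (t, y)) <= 3 * M * norm x * kern a t.
Proof.
intros H; unfold n, e; rewrite norm_scal_eq, Cmod_mult, Cmod_cis, Cmod_cexp.
replace (fst (RtoC (1 - a) * (t, y))%C) with ((1 - a) * t) by (simpl; ring).
assert (B := rf_bound _ _ _ _ HF (cexp (t, y)) x H).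
rewrite Cmod_cexp in B; cbn [fst] in B.
unfold kern; assert (P := exp_pos t); assert (Q := exp_pos ((1 - a) * t)).
apply (Rmult_le_reg_r (1 + exp t)); [lra|].
replace (3 * M * norm x * (exp ((1 - a) * t) / (1 + exp t)) * (1 + exp t))
  with (exp ((1 - a) * t) * (3 * M * norm x)) by (field; lra).
replace (1 * exp ((1 - a) * t) * norm (res (cexp (t, y)) x) * (1 + exp t))
  with (exp ((1 - a) * t) * ((1 + exp t) * norm (res (cexp (t, y)) x))) by ring.
apply Rmult_le_compat_l; lra.
Qed.

Lemma contour_ex (Fa Fb : (R -> Prop) -> Prop) {FFa : ProperFilter Fa} {FFb : ProperFilter Fb} y :
  sigmoid_lim Fa -> sigmoid_lim Fb -> (forall t, near_halfline M (cexp (t, y))) ->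
  exists l, is_int V (fun t => n (t, y)) Fa Fb l.
Proof.
intros Sa Sb H.
apply (ex_int_kern_dom V Fa Fb _ (3 * M * norm x) a Sa Sb Ha).
- intros t; apply contour_contin_h, H.
- intros t; apply contour_bound, H.
Qed.

Lemma contour_half_line (F : (R -> Prop) -> Prop) {FF : ProperFilter F} p q lp lq :
  p <= q -> filterlim (kern a) F (locally 0) ->
  (forall t, near_halfline M (cexp (t, p))) -> (forall t, near_halfline M (cexp (t, q))) ->
  F (fun b => forall t y, Rmin (ln r) b <= t <= Rmax (ln r) b -> p <= y <= q ->
     near_halfline M (cexp (t, y))) ->
  is_int V (fun t => n (t, p)) (at_point (ln r)) F lp ->
  is_int V (fun t => n (t, q)) (at_point (ln r)) F lq ->
  lq -v lp = vopp (Ci *v rint V (fun y => n (ln r, y)) p q).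
Proof.
intros Hpq Hk Hp Hq HF' Ip Iq.
apply (Cauchy_half_line V F n (ln r) p q (3 * M * norm x) a lp lq Hpq); try assumption.
- apply Rmult_le_pos; [lra | apply norm_ge_0].
- intros t; apply contour_contin_h, Hp.
- intros t; apply contour_contin_h, Hq.
- intros y Hy; apply contour_contin_v, near_disc, Rle_refl.
- revert HF'; apply filter_imp; intros b Hb.
  assert (Bb : Rmin (ln r) b <= b <= Rmax (ln r) b) by (split; [apply Rmin_r | apply Rmax_r]).
  split.
  + intros y Hy; split; [apply contour_contin_v | apply contour_bound]; auto.
  + destruct (contour_C11 (Rmax (ln r) b + 1)) as [n1 Hn].
    apply (Cauchy_rectangle V _ n n1 Hn); [exact Hpq|].
    intros t y Ht Hy; apply contour_interior; [lra | auto].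
Qed.

Lemma e_0 t : e (t, 0) = (RtoC (exp ((1 - a) * t)) * cis (- (a * PI)))%C.
Proof.
unfold e, cexp, ray; replace (snd (RtoC (1 - a) * (t, 0))%C) with 0 by (simpl; ring).
replace (fst (RtoC (1 - a) * (t, 0))%C) with ((1 - a) * t) by (simpl; ring).
unfold cis at 2; rewrite cos_0, sin_0; apply injective_projections; simpl; ring.
Qed.

Lemma e_arg t y : e (t, y) = (RtoC (exp ((1 - a) * t)) * cis ((1 - a) * y - a * PI))%C.
Proof.
unfold e, cexp, ray; replace (snd (RtoC (1 - a) * (t, y))%C) with ((1 - a) * y) by (simpl; ring).
replace (fst (RtoC (1 - a) * (t, y))%C) with ((1 - a) * t) by (simpl; ring).
replace ((1 - a) * y - a * PI) with (- (a * PI) + (1 - a) * y) by ring.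
rewrite cis_plus; ring.
Qed.

Lemma e_2PI t : e (t, - (2 * PI)) = (RtoC (exp ((1 - a) * t)) * cis (a * PI))%C.
Proof.
rewrite e_arg; f_equal.
replace ((1 - a) * - (2 * PI) - a * PI) with (a * PI - 2 * PI) by ring.
unfold cis; f_equal.
- rewrite <- (cos_period (a * PI - 2 * PI) 1); f_equal; simpl; ring.
- rewrite <- (sin_period (a * PI - 2 * PI) 1); f_equal; simpl; ring.
Qed.

(* On the sheet [- 2 pi < y < 0] of the logarithm, [n (t, y)] is the integrand
   of the contour integral times [dz / dw], at [z = e^w], [w = (t, y)]. *)
Lemma contour_integrand t y : 0 < t -> - (2 * PI) < y < 0 ->
  ray y t *v (Cpower (- ray y t) (- a) *v res (ray y t) x) = n (ln t, y).
Proof.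
intros Ht Hy; unfold n; rewrite e_arg.
assert (E : cexp (ln t, y) = ray y t) by (unfold cexp; cbn [fst snd]; rewrite exp_ln by exact Ht; reflexivity).
rewrite E, opp_ray; unfold Cpower.
rewrite Carg_ray, Cmod_ray by lra.
replace ((1 - a) * y - a * PI) with (y + - a * (y + PI)) by ring.
rewrite cis_plus.
replace ((1 - a) * ln t) with (ln t + - a * ln t) by ring.
rewrite exp_plus, exp_ln, RtoC_mult by exact Ht.
unfold Rpower, ray; vring V.
Qed.

(** To the right of [ln r] each ray is moved to its side of the cut at the cost of an arc of the
    circle. The full circle, retracted to minus infinity, provides the missing left halves of the
    two lines. Their phases [cis (- (a PI))] and [cis (a PI)] leave [2 Ci sin (a PI) kappa a]. *)
Theorem contour_value :
  is_contour_int psi r (fun z => Cpower (- z) (- a) *v res z x)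
    ((2 * RtoC PI * Ci)%C *v neg_frac V res a 0 x).
Proof.
assert (HPI := PI_RGT_0); destruct psi_bound as [Bp _].
assert (N1 : forall t, near_halfline M (cexp (t, - psi))) by (intros; apply near_sector; lra).
assert (N0 : forall t, near_halfline M (cexp (t, 0))) by (intros; apply near_sector; lra).
assert (N3 : forall t, near_halfline M (cexp (t, psi - 2 * PI))) by (intros; apply near_sector'; lra).
assert (N2 : forall t, near_halfline M (cexp (t, - (2 * PI)))) by (intros; apply near_sector'; lra).
assert (Sp := sigmoid_lim_point (ln r)).
destruct (contour_ex (at_point (ln r)) pinf (- psi) Sp sigmoid_lim_pinf N1) as [k1 K1].
destruct (contour_ex (at_point (ln r)) pinf 0 Sp sigmoid_lim_pinf N0) as [k0 K0].
destruct (contour_ex (at_point (ln r)) pinf (psi - 2 * PI) Sp sigmoid_lim_pinf N3) as [k3 K3].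
destruct (contour_ex (at_point (ln r)) pinf (- (2 * PI)) Sp sigmoid_lim_pinf N2) as [k2 K2].
destruct (contour_ex (at_point (ln r)) minf 0 Sp sigmoid_lim_minf N0) as [m0 M0].
destruct (contour_ex (at_point (ln r)) minf (- (2 * PI)) Sp sigmoid_lim_minf N2) as [m2 M2].
set (J p q := rint V (fun y => n (ln r, y)) p q).
assert (JC : forall p q s, J p q +v J q s = J p s).
{ intros p q s; apply rint_Chasles; intros y; apply contour_contin_v, near_disc, Rle_refl. }
assert (E1 : k0 -v k1 = vopp (Ci *v J (- psi) 0)).
{ apply (contour_half_line pinf (- psi) 0); try assumption; [lra | apply kern_lim_pinf; lra |].
  apply filter_forall; intros b t y _ Hy; apply near_sector; lra. }
assert (E3 : k3 -v k2 = vopp (Ci *v J (- (2 * PI)) (psi - 2 * PI))).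
{ apply (contour_half_line pinf (- (2 * PI)) (psi - 2 * PI)); try assumption; [lra | apply kern_lim_pinf; lra |].
  apply filter_forall; intros b t y _ Hy; apply near_sector'; lra. }
(* To the left of [ln r] all arguments are allowed, because the disc lies in [near_halfline M]: this
   closes the circle at 0. *)
assert (E2 : m0 -v m2 = vopp (Ci *v J (- (2 * PI)) 0)).
{ apply (contour_half_line minf (- (2 * PI)) 0); try assumption; [lra | apply kern_lim_minf; lra |].
  exists (ln r); intros b Hb t y Ht Hy; apply near_disc.
  rewrite Rmax_left in Ht by lra; lra. }
set (L := neg_frac V res a 0 x) in *.
assert (W := neg_frac_int V _ _ res HF a Ha 0 x (Rle_refl 0)); fold L in W.
assert (I0 : k0 -v m0 = cis (- (a * PI)) *v (RtoC (kappa a) *v L)).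
{ apply (is_int_unique V minf pinf (fun t => n (t, 0))); [apply (is_int_line V _ _ _ _ M0 K0)|].
  refine (is_int_ext V minf pinf _ _ _ _ (is_int_scal V minf pinf (cis (- (a * PI))) _ _ W)).
  intros t; unfold n; rewrite e_0, Rplus_0_r.
  replace (cexp (t, 0)) with (RtoC (exp t)); [vring V|].
  unfold cexp, ray, cis; simpl; rewrite cos_0, sin_0; apply injective_projections; simpl; ring. }
assert (I2 : k2 -v m2 = cis (a * PI) *v (RtoC (kappa a) *v L)).
{ apply (is_int_unique V minf pinf (fun t => n (t, - (2 * PI)))); [apply (is_int_line V _ _ _ _ M2 K2)|].
  refine (is_int_ext V minf pinf _ _ _ _ (is_int_scal V minf pinf (cis (a * PI)) _ _ W)).
  intros t; unfold n; rewrite e_2PI, Rplus_0_r.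
  replace (cexp (t, - (2 * PI))) with (RtoC (exp t)); [vring V|].
  unfold cexp; cbn [fst snd]; replace (- (2 * PI)) with (0 - 2 * PI) by ring; rewrite ray_period.
  unfold ray, cis; rewrite cos_0, sin_0; apply injective_projections; simpl; ring. }
(* Return from [ln t] to the modulus [t], which parametrises the rays of the contour. *)
assert (GR : forall y l, - (2 * PI) < y < 0 -> (forall t, near_halfline M (cexp (t, y))) ->
  is_int V (fun t => n (t, y)) (at_point (ln r)) pinf l ->
  is_int V (fun t => cis y *v (Cpower (- ray y t) (- a) *v res (ray y t) x)) (at_point r) pinf l).
{ intros y l Hy Hn; apply is_int_exp_subst; [lra | |].
  - intros t; apply contour_contin_h, Hn.
  - intros t Ht; rewrite <- contour_integrand by assumption.
    set (v := Cpower (- ray y t) (- a) *v res (ray y t) x); unfold ray.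
    transitivity ((RtoC (/ t) * RtoC t)%C *v (cis y *v v)); [|vring V].
    rewrite <- RtoC_mult, Rinv_l by lra; vring V. }
exists (vopp k1), (Ci *v J (- psi) (psi - 2 * PI)), k3.
split; [|split; [|split]].
- apply (is_RInt_gen_swap (V := restr V)); apply GR; [lra | exact N1 | exact K1].
- apply (is_RInt_gen_at_point (V := restr V)).
  refine (is_RInt_ext (V := restr V) (fun y => Ci *v n (ln r, y)) _ _ _ _ _ _).
  + intros y Hy; rewrite Rmin_right, Rmax_left in Hy by lra.
    rewrite <- contour_integrand by lra.
    change (Ci *v (ray y r *v (Cpower (- ray y r) (- a) *v res (ray y r) x))
      = (Ci * ray y r)%C *v (Cpower (- ray y r) (- a) *v res (ray y r) x)).
    vring V.
  + apply (is_RInt_lin V V (fun v => Ci *v v)); [apply is_linear_scal|].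
    apply is_RInt_rint; intros y _; apply contour_contin_v, near_disc, Rle_refl.
- assert (K3' := GR (psi - 2 * PI) k3 ltac:(lra) N3 K3).
  refine (is_int_ext V (at_point r) pinf _ _ _ _ K3').
  intros t; cbv beta; rewrite ray_period; f_equal.
  unfold cis; f_equal.
  + rewrite <- (cos_period (psi - 2 * PI) 1); f_equal; simpl; ring.
  + rewrite <- (sin_period (psi - 2 * PI) 1); f_equal; simpl; ring.
- change ((2 * RtoC PI * Ci)%C *v L = (vopp k1 +v Ci *v J (- psi) (psi - 2 * PI)) +v k3).
  (* The reflection formula turns the difference of the two phases into the normalisation [2 PI Ci]
     of the contour integral. *)
  assert (R : (RtoC 2 * RtoC PI * Ci = (cis (a * PI) - cis (- (a * PI))) * RtoC (kappa a))%C).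
  { unfold cis; rewrite cos_neg, sin_neg.
    assert (Q := kappa_reflection a Ha); rewrite (Rmult_comm PI a) in Q.
    set (s := sin (a * PI)) in *; set (c := cos (a * PI)).
    rewrite <- Q; apply injective_projections; simpl; ring. }
  transitivity ((k2 -v m2) -v (k0 -v m0)).
  + rewrite I0, I2, R; vring V.
  + transitivity ((k3 -v k1) -v (k3 -v k2) +v (m0 -v m2) -v (k0 -v k1)); [vring V|].
    rewrite E1, E2, E3.
    rewrite <- (JC (- (2 * PI)) (psi - 2 * PI) 0).
    rewrite <- (JC (psi - 2 * PI) (- psi) 0).
    (* The circle is run clockwise, with decreasing argument. *)
    assert (Z : J (- psi) (psi - 2 * PI) = vopp (J (psi - 2 * PI) (- psi))).
    { transitivity ((J (- psi) (psi - 2 * PI) +v J (psi - 2 * PI) (- psi)) -v J (psi - 2 * PI) (- psi));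
        [vring V|].
      rewrite JC; unfold J at 1, rint; rewrite (RInt_point (V := restrC V)); vring V. }
    rewrite Z; vring V.
Qed.

End Contour.

(** In [neg_power_rel] the function [u] is prescribed on the contour only, so the integral must be
    seen to depend on nothing else; [psi < PI] orders the ends of the arc. *)
Lemma contour_int_unique (V : CBanach) psi r (f g : C -> V) l m :
  psi < PI -> (forall z, on_contour psi r z -> f z = g z) ->
  is_contour_int psi r f l -> is_contour_int psi r g m -> l = m.
Proof.
intros Hpsi E (l1 & l2 & l3 & F1 & F2 & F3 & ->) (m1 & m2 & m3 & G1 & G2 & G3 & ->).
assert (E1 : l1 = m1).
{ refine (is_int_unique V pinf (at_point r) _ _ _ _ G1).
  refine (is_RInt_gen_ext (V := restr V) _ _ _ _ F1).
  exists (fun b => r < b) (fun c => c = r); [exists r; auto | reflexivity |].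
  intros b c Hb -> t Ht; simpl in Ht; rewrite Rmin_right in Ht by lra.
  f_equal; apply E; left; exists t; split; [lra | auto]. }
assert (E2 : l2 = m2).
{ refine (is_int_unique V (at_point (- psi)) (at_point (psi - 2 * PI)) _ _ _ _ G2).
  refine (is_RInt_gen_ext (V := restr V) _ _ _ _ F2).
  exists (fun b => b = - psi) (fun c => c = psi - 2 * PI); [reflexivity | reflexivity |].
  intros b c -> -> t Ht; cbn [fst snd] in Ht; rewrite Rmin_right, Rmax_left in Ht by lra.
  f_equal; apply E; right; exists t; split; [lra | reflexivity]. }
assert (E3 : l3 = m3).
{ refine (is_int_unique V (at_point r) pinf _ _ _ _ G3).
  refine (is_RInt_gen_ext (V := restr V) _ _ _ _ F3).
  exists (fun c => c = r) (fun b => r < b); [reflexivity | exists r; auto |].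
  intros c b -> Hb t Ht; simpl in Ht; rewrite Rmin_left in Ht by lra.
  f_equal; apply E; left; exists t; split; [lra | auto]. }
rewrite E1, E2, E3; reflexivity.
Qed.

Section NegPowerSpec.
Variables (V : CBanach) (T : lrel V V).

Lemma two_PI_I_neq0 : (2 * RtoC PI * Ci)%C <> 0.
Proof.
intros E; apply (f_equal snd) in E; simpl in E; generalize PI_RGT_0; lra.
Qed.

Lemma on_contour_near M psi r z : positive_with T M ->
  0 < psi < asin (1 / (2 * M)) -> 0 < r < 1 / (2 * M) ->
  on_contour psi r z -> near_halfline M z.
Proof.
intros HT Hpsi Hr [(t & Ht & [-> | ->]) | (t & _ & ->)].
- replace (ray (- psi) t) with (cexp (ln t, - psi)).
  + apply (near_sector V T M psi HT Hpsi); lra.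
  + unfold cexp; cbn [fst snd]; rewrite exp_ln by lra; reflexivity.
- replace (ray psi t) with (cexp (ln t, psi)).
  + apply (near_sector V T M psi HT Hpsi); lra.
  + unfold cexp; cbn [fst snd]; rewrite exp_ln by lra; reflexivity.
- apply near_halfline_disc with r; [destruct HT; lra | rewrite Cmod_ray; lra | lra].
Qed.

(** From left to right one admissible triple is enough; from right to left [contour_value] provides
    the same value for every triple. *)
Theorem neg_power_spec a x y : positive_op T -> 0 < a < 1 ->
  neg_power T a x y <-> y = neg_frac V (res V T) a 0 x.
Proof.
intros [M0 HM0] Ha; split.
- intros H; destruct HM0 as [M1 HM0']; assert (HM0 := conj M1 HM0').
  assert (Pm : 0 < 1 / (2 * M0)) by (apply Rdiv_lt_0_compat; lra).
  assert (Pm1 : 1 / (2 * M0) <= 1).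
  { apply (Rmult_le_reg_r (2 * M0)); [lra|].
    replace (1 / (2 * M0) * (2 * M0)) with 1 by (field; lra); lra. }
  assert (As : 0 < asin (1 / (2 * M0))).
  { rewrite <- asin_0.
    apply Rnot_le_lt; intros Hle.
    assert (B1 := asin_bound (1 / (2 * M0))); assert (B2 := asin_bound 0).
    assert (S := sin_incr_1 _ _ (proj1 B1) (proj2 B1) (proj1 B2) (proj2 B2) Hle).
    rewrite !sin_asin in S by lra; lra. }
  set (psi := asin (1 / (2 * M0)) / 2); set (r := 1 / (2 * M0) / 2).
  assert (Hpsi : 0 < psi < asin (1 / (2 * M0))) by (unfold psi; lra).
  assert (Hr : 0 < r < 1 / (2 * M0)) by (unfold r; lra).
  destruct (H M0 psi r HM0 Hpsi Hr) as (u & l & Hu & Hl & ->).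
  assert (C := contour_value V T M0 psi HM0 Hpsi r Hr a x Ha).
  assert (E : l = (2 * RtoC PI * Ci)%C *v neg_frac V (res V T) a 0 x).
  { refine (contour_int_unique V psi r _ _ _ _ _ _ Hl C).
    - destruct (psi_bound V T M0 psi HM0 Hpsi); generalize PI_RGT_0; lra.
    - intros z Hz; f_equal.
      apply (res_spec V T M0 HM0); [apply (on_contour_near M0 psi r); assumption | apply Hu, Hz]. }
  rewrite E.
  change ((/ (2 * RtoC PI * Ci))%C *v ((2 * RtoC PI * Ci)%C *v neg_frac V (res V T) a 0 x)
    = neg_frac V (res V T) a 0 x).
  transitivity ((/ (2 * RtoC PI * Ci) * (2 * RtoC PI * Ci))%C *v neg_frac V (res V T) a 0 x); [vring V|].
  rewrite Cinv_l by exact two_PI_I_neq0; vring V.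
- intros -> M psi r HM Hpsi Hr.
  exists (fun z => res V T z x), ((2 * RtoC PI * Ci)%C *v neg_frac V (res V T) a 0 x).
  split; [|split].
  + intros z Hz; apply (res_spec V T M HM); [apply (on_contour_near M psi r); assumption | reflexivity].
  + apply (contour_value V T M psi HM Hpsi r Hr a x Ha).
  + change (neg_frac V (res V T) a 0 x
      = (/ (2 * RtoC PI * Ci))%C *v ((2 * RtoC PI * Ci)%C *v neg_frac V (res V T) a 0 x)).
    transitivity ((/ (2 * RtoC PI * Ci) * (2 * RtoC PI * Ci))%C *v neg_frac V (res V T) a 0 x); [|vring V].
    rewrite Cinv_l by exact two_PI_I_neq0; vring V.
Qed.

End NegPowerSpec.

(** * The square root *)

Section SquareRoot.
Variables (V : CBanach) (G : C -> Prop) (K : R) (r : C -> V -> V).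
Hypothesis Hr : resolvent_family V G K r.

Notation rr s := (r (RtoC s)).
Notation F a := (neg_frac V r a 0).

Lemma half_bounds : 0 < 1 / 2 < 1. Proof. lra. Qed.

Lemma neg_sqrt_square x : F (1 / 2) (F (1 / 2) x) = rr 0 x.
Proof.
rewrite <- (neg_frac_complement V G K r Hr (1 / 2) x half_bounds).
replace (1 - 1 / 2) with (1 / 2) by field; reflexivity.
Qed.

(** [A^(1/2) (s^2 + A)^(-1)] *)
Definition sqrt_res (s : R) (y : V) : V := F (1 / 2) (y -v RtoC (s ^ 2) *v rr (s ^ 2) y).

(** The argument of [rr 0] is [A (s + A)^(-1) y]. *)
Lemma resolvent_0_eq s y : 0 <= s -> rr 0 (y -v RtoC s *v rr s y) = rr s y.
Proof.
intros Hs.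
rewrite (rr_minus V G K r Hr), (rr_scal V G K r Hr) by lra.
assert (I := rr_id V G K r Hr 0 s y ltac:(lra) Hs).
rewrite Rminus_0_r in I; rewrite <- I; vring V.
Qed.

Lemma neg_sqrt_sqrt_res s y : F (1 / 2) (sqrt_res s y) = rr (s ^ 2) y.
Proof.
unfold sqrt_res; rewrite neg_sqrt_square; apply resolvent_0_eq, pow2_ge_0.
Qed.

Lemma sqrt_res_plus s x y : sqrt_res s (x +v y) = sqrt_res s x +v sqrt_res s y.
Proof.
unfold sqrt_res; rewrite <- (neg_frac_plus V G K r Hr _ half_bounds) by lra; f_equal.
rewrite (rr_plus V G K r Hr) by apply pow2_ge_0; vring V.
Qed.

Lemma sqrt_res_scal s c x : sqrt_res s (c *v x) = c *v sqrt_res s x.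
Proof.
unfold sqrt_res; rewrite <- (neg_frac_scal V G K r Hr _ half_bounds) by lra; f_equal.
rewrite (rr_scal V G K r Hr) by apply pow2_ge_0; vring V.
Qed.

Lemma scaled_rr_norm s y : 0 <= s -> s * norm (rr s y) <= K * norm y.
Proof.
intros Hs; eapply Rle_trans; [|apply (rr_norm V G K r Hr s y Hs)].
apply Rmult_le_compat_r; [apply norm_ge_0 | lra].
Qed.

Lemma rr_complement_norm s y : 0 <= s ->
  norm (y -v RtoC s *v rr s y) <= (1 + K) * norm y.
Proof.
intros Hs; eapply Rle_trans; [apply norm_minus_le|].
rewrite norm_scal_eq, Cmod_R, Rabs_pos_eq by exact Hs.
generalize (scaled_rr_norm s y Hs); lra.
Qed.

(** Both sides are [A (s + A)^(-1) (t + A)^(-1) y]. The exchange puts the resolvent at [s] outside,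
    where a factor [s] is absorbed. *)
Lemma rr_complement_comm s t y : 0 <= s -> 0 <= t ->
  rr t (y -v RtoC s *v rr s y) = rr s (y -v RtoC t *v rr t y).
Proof.
intros Hs Ht.
rewrite !(rr_minus V G K r Hr), !(rr_scal V G K r Hr) by assumption.
assert (I := rr_id V G K r Hr t s y Ht Hs).
rewrite (rr_comm V G K r Hr s t) by assumption.
transitivity ((rr t y -v rr s y) +v rr s y -v RtoC s *v rr t (rr s y)); [vring V|].
rewrite I; vring V.
Qed.

(** For [s <= 1] boundedness is enough. For [s > 1], with [z = A (s^2 + A)^(-1) y], both [e^t] and
    [s^2] are absorbed by [(e^t + A)^(-1) z]; the kernel [1 / (e^t + s^2)] scales to
    [(s^2)^(-1/2) = 1 / s]. The 4 comes from these two bounds and from [1 + s <= 2 s]. *)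
Lemma sqrt_res_norm s y : 0 <= s ->
  (1 + s) * norm (sqrt_res s y) <= 4 * (K * (1 + K)) * norm y.
Proof.
intros Hs; assert (HK := rf_K _ _ _ _ Hr).
assert (Hy := norm_ge_0 y).
assert (HKy : 0 <= K * ((1 + K) * norm y)) by (repeat apply Rmult_le_pos; lra).
assert (H2 : 0 <= s ^ 2) by apply pow2_ge_0.
assert (N0 : norm (sqrt_res s y) <= K * ((1 + K) * norm y)).
{ eapply Rle_trans; [apply (neg_frac_norm V G K r Hr _ half_bounds); lra|].
  apply Rmult_le_compat_l; [exact HK | apply rr_complement_norm, H2]. }
destruct (Rle_lt_dec s 1) as [H1|H1].
{ apply Rle_trans with (2 * norm (sqrt_res s y)); [|lra].
  apply Rmult_le_compat_r; [apply norm_ge_0 | lra]. }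
set (z := y -v RtoC (s ^ 2) *v rr (s ^ 2) y).
assert (Hs2 : 0 < s ^ 2) by (apply pow_lt; lra).
assert (W := neg_frac_int V G K r Hr _ half_bounds 0 z (Rle_refl 0)).
assert (Hk := kappa_pos _ half_bounds).
apply (is_int_kern_scaled_norm V _ (2 * (K * ((1 + K) * norm y))) (1 / 2) (s ^ 2) _ half_bounds Hs2) in W.
- change (F (1 / 2) z) with (sqrt_res s y) in W.
  rewrite norm_scal_eq, Cmod_R, Rabs_pos_eq in W by lra.
  replace (exp (- (1 / 2) * ln (s ^ 2))) with (/ s) in W.
  2:{ rewrite ln_pow by lra; replace (- (1 / 2) * (INR 2 * ln s)) with (- ln s) by (simpl; field).
      rewrite exp_Ropp, exp_ln by lra; reflexivity. }
  assert (W' : norm (sqrt_res s y) <= 2 * (K * ((1 + K) * norm y)) * / s).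
  { apply (Rmult_le_reg_l (kappa (1 / 2))); [exact Hk | lra]. }
  apply (Rmult_le_compat_l s) in W'; [|lra].
  replace (s * (2 * (K * ((1 + K) * norm y)) * / s)) with (2 * (K * ((1 + K) * norm y))) in W' by (field; lra).
  assert (norm (sqrt_res s y) <= s * norm (sqrt_res s y)).
  { rewrite <- (Rmult_1_l (norm (sqrt_res s y))) at 1; apply Rmult_le_compat_r; [apply norm_ge_0 | lra]. }
  lra.
- intros t; rewrite Rplus_0_r; apply exp_scal_norm; [lra|].
  assert (Pt := exp_pos t).
  rewrite Rmult_plus_distr_r.
  assert (A1 : exp t * norm (rr (exp t) z) <= K * ((1 + K) * norm y)).
  { eapply Rle_trans; [apply scaled_rr_norm; lra|].
    apply Rmult_le_compat_l; [exact HK | apply rr_complement_norm, H2]. }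
  assert (A2 : s ^ 2 * norm (rr (exp t) z) <= K * ((1 + K) * norm y)).
  { unfold z; rewrite rr_complement_comm by lra.
    eapply Rle_trans; [apply scaled_rr_norm; lra|].
    apply Rmult_le_compat_l; [exact HK | apply rr_complement_norm; lra]. }
  lra.
Qed.

Lemma scal_res_square_norm s y : 0 <= s ->
  (1 + s) * norm (RtoC s *v rr (s ^ 2) y) <= 2 * K * norm y.
Proof.
intros Hs; rewrite norm_scal_eq, Cmod_R, Rabs_pos_eq by exact Hs.
assert (B := rr_norm V G K r Hr (s ^ 2) y (pow2_ge_0 s)).
replace ((1 + s) * (s * norm (rr (s ^ 2) y))) with (((1 + s) * s) * norm (rr (s ^ 2) y)) by ring.
apply Rle_trans with (2 * (1 + s ^ 2) * norm (rr (s ^ 2) y)); [|lra].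
apply Rmult_le_compat_r; [apply norm_ge_0|].
generalize (pow2_ge_0 (s - 1)); lra.
Qed.

Variable a : R.
Hypothesis Ha : 0 < a < 1.

Lemma half_power_bounds : 0 < a / 2 < 1. Proof. lra. Qed.

Lemma cos_half_pos : 0 < cos (PI * a / 2).
Proof.
assert (HPI := PI_RGT_0); assert (H : 0 < PI * a < PI).
{ split; [apply Rmult_lt_0_compat; lra|].
  rewrite <- (Rmult_1_r PI) at 2; apply Rmult_lt_compat_l; lra. }
apply cos_gt_0; lra.
Qed.

(** Quotient of the reflection formulas at [(1 + a) / 2] and [a], whose sines are [cos (PI a / 2)]
    and [2 sin (PI a / 2) cos (PI a / 2)]. *)
Lemma kappa_half_shift : kappa ((1 + a) / 2) = 2 * sin (PI * a / 2) * kappa a.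
Proof.
assert (E1 := kappa_reflection a Ha).
assert (E2 := kappa_reflection ((1 + a) / 2) ltac:(lra)).
assert (C0 := cos_half_pos).
replace (sin (PI * ((1 + a) / 2))) with (cos (PI * a / 2)) in E2
  by (rewrite <- sin_shift, <- sin_PI_x; f_equal; field).
replace (sin (PI * a)) with (2 * sin (PI * a / 2) * cos (PI * a / 2)) in E1
  by (rewrite <- sin_2a; f_equal; field).
apply (Rmult_eq_reg_r (cos (PI * a / 2))); [|lra].
rewrite E2; lra.
Qed.

(* The resolvent of [[0, - A^(1/2)], [A^(1/2), 0]] has the diagonal entries
   [s (s^2 + A)^(-1)] and the off-diagonal ones [+- A^(1/2) (s^2 + A)^(-1)];
   [s = e^t]. *)
Lemma is_int_diagonal y :
  is_int V (fun t => RtoC (exp ((1 - a) * t)) *v (RtoC (exp t) *v rr (exp t ^ 2) y)) minf pinf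
    (RtoC (kappa a) *v (RtoC (cos (PI * a / 2)) *v F (a / 2) y)).
Proof.
assert (W := neg_frac_int V G K r Hr _ half_power_bounds 0 y (Rle_refl 0)).
apply (is_int_affine V _ 2 0) in W; [|lra].
replace (RtoC (kappa a) *v (RtoC (cos (PI * a / 2)) *v F (a / 2) y))
  with (RtoC (/ 2) *v (RtoC (kappa (a / 2)) *v F (a / 2) y)).
2:{ rewrite (kappa_half a Ha).
    transitivity (RtoC (/ 2 * (2 * cos (PI * a / 2) * kappa a)) *v F (a / 2) y); [vring V|].
    replace (/ 2 * (2 * cos (PI * a / 2) * kappa a)) with (kappa a * cos (PI * a / 2)) by field.
    vring V. }
refine (is_int_ext V minf pinf _ _ _ _ W).
intros t; cbv beta.
replace ((1 - a / 2) * (2 * t + 0)) with ((1 - a) * t + t) by field.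
replace (2 * t + 0) with (t + t) by ring.
rewrite !exp_plus, Rplus_0_r; replace (exp t ^ 2) with (exp t * exp t) by ring.
vring V.
Qed.

(** Under [A^(-1/2)] the integrand becomes that of exponent [(1 + a) / 2] in the variable [2 t]. The
    semigroup law writes the result as [A^(-1/2)] of the claimed value, and [A^(-1/2)] is
    injective. *)
Lemma is_int_off_diagonal y l :
  is_int V (fun t => RtoC (exp ((1 - a) * t)) *v sqrt_res (exp t) y) minf pinf (RtoC (kappa a) *v l) ->
  l = RtoC (sin (PI * a / 2)) *v F (a / 2) y.
Proof.
intros Hl; assert (Hk := kappa_pos a Ha).
assert (B : 0 < (1 + a) / 2 < 1) by lra.
assert (LF : is_linear (F (1 / 2))) by (apply (neg_frac_linear V G K r Hr _ half_bounds); lra).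
apply (neg_frac_inj V G K r Hr (1 / 2)); [exact half_bounds|].
rewrite (neg_frac_scal V G K r Hr _ half_bounds) by lra.
rewrite (neg_frac_semigroup V G K r Hr (1 / 2) (a / 2) y) by lra.
replace (1 / 2 + a / 2) with ((1 + a) / 2) by field.
apply (is_int_lin V minf pinf V _ _ _ LF) in Hl.
assert (W := neg_frac_int V G K r Hr _ B 0 y (Rle_refl 0)).
apply (is_int_affine V _ 2 0) in W; [|lra].
assert (E : F (1 / 2) (RtoC (kappa a) *v l) = RtoC (/ 2) *v (RtoC (kappa ((1 + a) / 2)) *v F ((1 + a) / 2) y)).
{ refine (is_int_unique V minf pinf _ _ _ Hl _).
  refine (is_int_ext V minf pinf _ _ _ _ W).
  intros t; rewrite (neg_frac_scal V G K r Hr _ half_bounds), neg_sqrt_sqrt_res by lra.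
  replace ((1 - (1 + a) / 2) * (2 * t + 0)) with ((1 - a) * t) by field.
  replace (2 * t + 0) with (t + t) by ring.
  rewrite exp_plus, Rplus_0_r; replace (exp t ^ 2) with (exp t * exp t) by ring; reflexivity. }
rewrite (neg_frac_scal V G K r Hr _ half_bounds), kappa_half_shift in E by lra.
transitivity (RtoC (/ kappa a * kappa a) *v F (1 / 2) l).
{ rewrite Rinv_l by lra; vring V. }
transitivity (RtoC (/ kappa a) *v (RtoC (kappa a) *v F (1 / 2) l)); [vring V|].
rewrite E.
transitivity (RtoC (/ kappa a * (/ 2 * (2 * sin (PI * a / 2) * kappa a))) *v F ((1 + a) / 2) y); [vring V|].
f_equal; f_equal; field; lra.
Qed.

End SquareRoot.

(** * Completeness *)

(** Existence of limits as a proposition, without a limit function: in this form it passes to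
    products and to closed graphs. *)
Definition is_complete (V : UniformSpace) : Prop :=
  forall F : (V -> Prop) -> Prop, ProperFilter F -> cauchy F ->
    exists l : V, forall eps : posreal, F (ball l eps).

Section MakeComplete.
Variables (V : CNormedModule) (HV : is_complete V).

Definition filter_lim (F : (V -> Prop) -> Prop) : V :=
  epsilon (inhabits vzero) (fun l : V => forall eps : posreal, F (ball l eps)).

Lemma filter_lim_ball F : ProperFilter F -> cauchy F ->
  forall eps : posreal, F (ball (filter_lim F) eps).
Proof.
intros PF CF.
exact (epsilon_spec (inhabits vzero) (fun l : V => forall eps : posreal, F (ball l eps)) (HV F PF CF)).
Qed.

(** Filters finer than each other are equal by extensionality, so the choice made for them is the
    same. *)
Lemma filter_lim_close F1 F2 : filter_le F1 F2 -> filter_le F2 F1 ->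
  close (filter_lim F1) (filter_lim F2).
Proof.
intros H12 H21; replace F2 with F1; [intros eps; apply ball_center|].
apply functional_extensionality; intros P; apply propositional_extensionality; split; auto.
Qed.

(** The normed module structure is kept unchanged, so that operators on [V] are operators on the
    result as they stand. *)
Definition make_complete : CBanach :=
  CompleteNormedModule.Pack C_AbsRing V
    (CompleteNormedModule.Class C_AbsRing V (NormedModule.class C_AbsRing V)
      (CompleteSpace.Mixin V filter_lim filter_lim_ball filter_lim_close)) V.

End MakeComplete.

Lemma is_complete_prod (U V : UniformSpace) :
  is_complete U -> is_complete V -> is_complete (prod_UniformSpace U V).
Proof.
intros HU HV F PF CF.
destruct (HU (filtermap fst F)) as [l Hl].
{ apply filtermap_proper_filter, PF. }
{ intros eps; destruct (CF eps) as [x Hx]; exists (fst x).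
  change (F (fun y => ball (fst x) eps (fst y))); revert Hx; apply filter_imp; intros y Hy; apply Hy. }
destruct (HV (filtermap snd F)) as [m Hm].
{ apply filtermap_proper_filter, PF. }
{ intros eps; destruct (CF eps) as [x Hx]; exists (snd x).
  change (F (fun y => ball (snd x) eps (snd y))); revert Hx; apply filter_imp; intros y Hy; apply Hy. }
exists (l, m); intros eps; generalize (filter_and (F := F) (fun y => ball l eps (fst y)) (fun y => ball m eps (snd y))
  (Hl eps) (Hm eps)).
apply filter_imp; intros y Hy; exact Hy.
Qed.

Lemma is_complete_graph (U V : CNormedModule) (T : lrel U V) :
  is_complete U -> is_complete V -> closed_graph T -> is_complete (graph_space T).
Proof.
intros HU HV HT F PF CF.
destruct (is_complete_prod U V HU HV (filtermap (@proj1_sig _ _) F)) as [l Hl].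
{ apply filtermap_proper_filter, PF. }
{ intros eps; destruct (CF eps) as [x Hx]; exists (proj1_sig x).
  change (F (fun y => ball (proj1_sig x) eps (proj1_sig y))); revert Hx; apply filter_imp; intros y Hy; apply Hy. }
assert (Tl : in_graph T l).
{ apply (closed_filterlim (F := F) (@proj1_sig _ (in_graph T)) (fun p => T (fst p) (snd p)) l); [| |exact HT].
  - intros P [eps HP]; change (F (fun y => P (proj1_sig y))).
    generalize (Hl eps : F (fun y => ball l eps (proj1_sig y))).
    apply filter_imp; intros y Hy; apply HP, Hy.
  - intros p; exact (proj2_sig p). }
exists (exist _ l Tl); exact Hl.
Qed.

Lemma is_complete_CBanach (X : CBanach) : is_complete X.
Proof.
intros F PF CF; exists (lim F); exact (complete_cauchy F PF CF).
Qed.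

(** The graph is the zero set of the continuous function [norm (f v - u)]. *)
Lemma closed_graph_inverse (U : CNormedModule) (T : lrel U U) (f : U -> U) :
  is_linear f -> (forall u v, T u v <-> u = f v) -> closed_graph T.
Proof.
intros Hf HT; unfold closed_graph.
apply (closed_ext (fun p : U * U => norm (f (snd p) -v fst p) <= 0)).
{ intros [u v]; cbn [fst snd]; rewrite HT; split.
  - intros H; assert (E : norm (f v -v u) = 0) by (apply Rle_antisym; [exact H | apply norm_ge_0]).
    apply norm_eq_zero in E.
    transitivity (u +v (f v -v u)); [|vring U]; rewrite E; vring U.
  - intros ->; replace (f v -v f v) with (vzero : U) by vring U.
    right; exact norm_zero. }
apply (closed_comp (fun p : U * U => norm (f (snd p) -v fst p)) (fun x => x <= 0)); [|apply closed_le].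
intros [u v].
refine (filterlim_comp _ _ _ (fun p : U * U => f (snd p) -v fst p) norm _ _ _ _ (filterlim_norm _)).
apply (continuous_minus (V := U) (fun p : U * U => f (snd p)) fst (u, v)).
- apply (continuous_comp (fun p : U * U => snd p) f); [apply continuous_snd | exact (linear_cont f v Hf)].
- apply continuous_fst.
Qed.

(** * Norms on products *)

Section ProdNorm.
Variables U V : CNormedModule.

Lemma norm_fst_le (p : prod_NormedModule C_AbsRing U V) : norm (fst p) <= norm p.
Proof.
destruct p as [x y]; eapply Rle_trans; [|apply (norm_prod x y)]; apply Rmax_l.
Qed.

Lemma norm_snd_le (p : prod_NormedModule C_AbsRing U V) : norm (snd p) <= norm p.
Proof.
destruct p as [x y]; eapply Rle_trans; [|apply (norm_prod x y)]; apply Rmax_r.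
Qed.

Lemma norm_pair_le (p : prod_NormedModule C_AbsRing U V) : norm p <= norm (fst p) + norm (snd p).
Proof.
change (norm p) with (sqrt (norm (fst p) ^ 2 + norm (snd p) ^ 2)).
assert (H1 := norm_ge_0 (fst p)); assert (H2 := norm_ge_0 (snd p)).
rewrite <- (sqrt_pow2 (norm (fst p) + norm (snd p))) by lra.
apply sqrt_le_1_alt.
assert (0 <= norm (fst p) * norm (snd p)) by (apply Rmult_le_pos; assumption).
simpl; lra.
Qed.

End ProdNorm.

(** * The operator [Lambda4] *)

Lemma frac_power_pos (V : CBanach) (T : lrel V V) b x y : positive_op T -> 0 < b < 1 ->
  frac_power T b x y <-> x = neg_frac V (res V T) b 0 y.
Proof.
intros HT Hb; unfold frac_power.
destruct (Rlt_dec b 0) as [H|H]; [lra|]; destruct (Rlt_dec 0 b) as [H'|H']; [|lra].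
exact (neg_power_spec V T b y x HT Hb).
Qed.

Lemma frac_power_neg (V : CBanach) (T : lrel V V) b x y : positive_op T -> 0 < b < 1 ->
  frac_power T (- b) x y <-> y = neg_frac V (res V T) b 0 x.
Proof.
intros HT Hb; unfold frac_power.
destruct (Rlt_dec (- b) 0) as [H|H]; [|lra]; rewrite Ropp_involutive.
exact (neg_power_spec V T b x y HT Hb).
Qed.

Lemma frac_power_swap (U : CNormedModule) (T : lrel U U) b x y : 0 < b ->
  frac_power T b x y <-> frac_power T (- b) y x.
Proof.
intros Hb; unfold frac_power.
destruct (Rlt_dec b 0) as [H|H]; [lra|]; destruct (Rlt_dec 0 b) as [H'|H']; [|lra].
destruct (Rlt_dec (- b) 0) as [H''|H'']; [|lra]; rewrite Ropp_involutive; reflexivity.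
Qed.

Section Lambda4.
Variables (X : CBanach) (A : lrel X X) (M : R).
Hypothesis hM : positive_with A M.

Let hA : positive_op A := ex_intro _ M hM.
Let HF := res_family X A M hM.
Let K := 3 * M.

Notation rr s := (res X A (RtoC s)).
Notation G b := (neg_frac X (res X A) b 0).
Notation B := (frac_power A (1 / 2)).
Notation Y := (Xpow A (1 / 2)).
Notation U := (Xhalf3 A).
Notation Q := (sqrt_res X (res X A)).

Lemma sqrt_spec x y : B x y <-> x = G (1 / 2) y.
Proof. exact (frac_power_pos X A (1 / 2) x y hA half_bounds). Qed.

Definition graph_of (k : X) : Y :=
  exist (in_graph B) (G (1 / 2) k, k) (proj2 (sqrt_spec (G (1 / 2) k) k) eq_refl).

(** [A^(1/2) p] *)
Definition sqrt_coord (p : Y) : X := snd (proj1_sig p).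

Lemma incl_coord (p : Y) : graph_incl p = G (1 / 2) (sqrt_coord p).
Proof. apply sqrt_spec; exact (proj2_sig p). Qed.

Lemma coord_inj (p q : Y) : sqrt_coord p = sqrt_coord q -> p = q.
Proof.
intros E; apply graph_inj; apply injective_projections.
- change (graph_incl p = graph_incl q); rewrite !incl_coord, E; reflexivity.
- exact E.
Qed.

Lemma graph_of_coord p : graph_of (sqrt_coord p) = p.
Proof. apply coord_inj; reflexivity. Qed.

Lemma K_ge0 : 0 <= K.
Proof. exact (rf_K _ _ _ _ HF). Qed.

Lemma norm_coord (p : Y) : norm (sqrt_coord p) <= norm p.
Proof. exact (norm_snd_le X X (proj1_sig p)). Qed.

Lemma norm_graph (p : Y) : norm p <= (K + 1) * norm (sqrt_coord p).
Proof.
eapply Rle_trans; [exact (norm_pair_le X X (proj1_sig p))|].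
change (norm (graph_incl p) + norm (sqrt_coord p) <= (K + 1) * norm (sqrt_coord p)).
rewrite incl_coord.
generalize (neg_frac_norm X _ _ _ HF (1 / 2) half_bounds 0 (sqrt_coord p) (Rle_refl 0)).
fold K; lra.
Qed.

(** Coordinates in three copies of [X]: the first is [A^(1/2)] of the first component, which makes
    the norm equivalent to that of the product. *)
Definition crd1 (u : U) : X := sqrt_coord (fst (fst u)).
Definition crd2 (u : U) : X := snd (fst u).
Definition crd3 (u : U) : X := snd u.
Definition mk (x y z : X) : U := ((graph_of x, y), z).

Lemma mk_crd u : mk (crd1 u) (crd2 u) (crd3 u) = u.
Proof.
destruct u as [[p y] z]; unfold mk, crd1, crd2, crd3; cbn [fst snd].
rewrite graph_of_coord; reflexivity.
Qed.

Lemma crd_inj (u v : U) : crd1 u = crd1 v -> crd2 u = crd2 v -> crd3 u = crd3 v -> u = v.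
Proof.
intros E1 E2 E3; rewrite <- (mk_crd u), <- (mk_crd v), E1, E2, E3; reflexivity.
Qed.

Lemma norm_crd1 u : norm (crd1 u) <= norm u.
Proof.
eapply Rle_trans; [apply norm_coord|].
eapply Rle_trans; [exact (norm_fst_le Y X (fst u)) | exact (norm_fst_le _ X u)].
Qed.

Lemma norm_crd2 u : norm (crd2 u) <= norm u.
Proof.
eapply Rle_trans; [exact (norm_snd_le Y X (fst u)) | exact (norm_fst_le _ X u)].
Qed.

Lemma norm_crd3 u : norm (crd3 u) <= norm u.
Proof. exact (norm_snd_le _ X u). Qed.

Lemma norm_le_crd u : norm u <= (K + 1) * (norm (crd1 u) + norm (crd2 u) + norm (crd3 u)).
Proof.
assert (HK := K_ge0).
eapply Rle_trans; [exact (norm_pair_le _ X u)|].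
change (norm (fst u) + norm (crd3 u) <= (K + 1) * (norm (crd1 u) + norm (crd2 u) + norm (crd3 u))).
assert (E1 := norm_pair_le Y X (fst u)).
change (norm (fst u) <= norm (fst (fst u)) + norm (crd2 u)) in E1.
assert (E2 := norm_graph (fst (fst u))); fold (crd1 u) in E2.
assert (E3 : 0 <= K * norm (crd2 u)) by (apply Rmult_le_pos; [exact HK | apply norm_ge_0]).
assert (E4 : 0 <= K * norm (crd3 u)) by (apply Rmult_le_pos; [exact HK | apply norm_ge_0]).
lra.
Qed.

Lemma crd1_linear : is_linear (fun u : U => crd1 u : X).
Proof.
split; [reflexivity | reflexivity |].
exists 1; split; [lra|]; intros u; rewrite Rmult_1_l; apply norm_crd1.
Qed.

Lemma crd2_linear : is_linear (fun u : U => crd2 u : X).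
Proof.
split; [reflexivity | reflexivity |].
exists 1; split; [lra|]; intros u; rewrite Rmult_1_l; apply norm_crd2.
Qed.

Lemma crd3_linear : is_linear (fun u : U => crd3 u : X).
Proof.
split; [reflexivity | reflexivity |].
exists 1; split; [lra|]; intros u; rewrite Rmult_1_l; apply norm_crd3.
Qed.

Lemma scal_m1 (x : X) : RtoC (-1) *v x = vopp x.
Proof. vlin X; apply injective_projections; simpl; ring. Qed.

(** The first equation also encodes that [crd3 u] belongs to [X^(1/2)], being in the range of
    [A^(-1/2)]. *)
Lemma Lambda4_spec u v :
  Lambda4 A u v <->
  G (1 / 2) (crd1 v) = vopp (crd3 u) /\ A (crd2 u) (crd2 v) /\ A (G (1 / 2) (crd1 u)) (crd3 v).
Proof.
destruct u as [[p y] z], v as [[p' y'] z'].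
unfold crd1, crd2, crd3; cbn [fst snd]; rewrite <- !incl_coord.
split.
- intros [R1 [R2 R3]].
  destruct R1 as (a1 & a2 & a3 & H1 & H2 & [w [Hw H3]] & E1).
  destruct R2 as (b1 & b2 & b3 & I1 & I2 & I3 & E2).
  destruct R3 as (c1 & c2 & c3 & J1 & J2 & J3 & E3).
  cbn [fst snd] in *; hnf in H1, H2, Hw, I1, I3, J2, J3; subst a1 a2 b1 b3 c2 c3 w.
  split; [|split].
  + rewrite E1.
    change (vzero +v vzero +v graph_incl a3 = vopp z); rewrite H3.
    change (vzero +v vzero +v RtoC (-1) *v z = vopp z); rewrite scal_m1; vring X.
  + rewrite E2; change (A y (vzero +v b2 +v vzero)).
    replace (vzero +v b2 +v vzero) with b2 by vring X; exact I2.
  + rewrite E3; change (A (graph_incl p) (c1 +v vzero +v vzero)).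
    replace (c1 +v vzero +v vzero) with c1 by vring X; exact J1.
- intros (H1 & H2 & H3); split; [|split]; cbn [fst snd].
  + exists vzero, vzero, p'; split; [reflexivity | split; [reflexivity | split]].
    * exists z; split; [reflexivity|]; rewrite H1; symmetry; exact (scal_m1 z).
    * apply coord_inj.
      change (sqrt_coord p' = vzero +v vzero +v sqrt_coord p'); vring X.
  + exists vzero, y', vzero; split; [reflexivity | split; [exact H2 | split; [reflexivity|]]].
    change (y' = vzero +v y' +v vzero); vring X.
  + exists z', vzero, vzero; split; [exact H3 | split; [reflexivity | split; [reflexivity|]]].
    change (z' = z' +v vzero +v vzero); vring X.
Qed.

(** In the first and third coordinates this inverts the block with rows [(s, - A^(1/2))] and
    [(A^(1/2), s)], whose determinant is [s^2 + A]. *)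
Definition res4 (s : R) (u : U) : U :=
  mk (RtoC s *v rr (s ^ 2) (crd1 u) +v Q s (crd3 u))
     (rr s (crd2 u))
     (RtoC s *v rr (s ^ 2) (crd3 u) -v Q s (crd1 u)).

Notation H := (G (1 / 2)).

Lemma H_plus x y : H (x +v y) = H x +v H y.
Proof. apply (neg_frac_plus X _ _ _ HF _ half_bounds); lra. Qed.

Lemma H_scal c x : H (c *v x) = c *v H x.
Proof. apply (neg_frac_scal X _ _ _ HF _ half_bounds); lra. Qed.

Lemma H_minus x y : H (x -v y) = H x -v H y.
Proof. apply (neg_frac_minus X _ _ _ HF _ half_bounds); lra. Qed.

Lemma H_rr s x : 0 <= s -> rr s (H x) = H (rr s x).
Proof. intros Hs; apply (neg_frac_rr_comm X _ _ _ HF _ half_bounds); lra. Qed.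

Lemma H_inj x y : H x = H y -> x = y.
Proof. apply (neg_frac_inj X _ _ _ HF), half_bounds. Qed.

Lemma A_spec x y : A x y <-> x = rr 0 y.
Proof. exact (res_0_spec X A M hM x y). Qed.

Lemma A_resolvent_spec s x y : 0 <= s -> resolvent A (RtoC s) x y <-> y = rr s x.
Proof. intros Hs; apply (res_spec X A M hM), (near_halfline_nonneg X A M hM), Hs. Qed.

Lemma Q_eq s y : Q s y = H y -v RtoC (s ^ 2) *v rr (s ^ 2) (H y).
Proof.
unfold sqrt_res; rewrite H_minus, H_scal, H_rr by apply pow2_ge_0; reflexivity.
Qed.

(** Eliminating the third component of [v] leaves [(s^2 + A) w = u3 + s u1] for its first component
    [w], with [u1 = A^(-1/2) (crd1 u)] and [u3 = crd3 u]; the rest of [v] is recovered from [w]. *)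
Lemma resolvent4_spec s u v : 0 <= s -> resolvent (Lambda4 A) (RtoC s) u v <-> v = res4 s u.
Proof.
intros Hs; assert (Hs2 := pow2_ge_0 s).
set (w := rr (s ^ 2) (crd3 u +v RtoC s *v H (crd1 u))).
assert (W1 : H (crd1 (res4 s u)) = w).
{ change (H (RtoC s *v rr (s ^ 2) (crd1 u) +v Q s (crd3 u)) = w).
  rewrite H_plus, H_scal, (neg_sqrt_sqrt_res X _ _ _ HF), <- H_rr by exact Hs2.
  unfold w; rewrite (rr_plus X _ _ _ HF), (rr_scal X _ _ _ HF) by exact Hs2; vring X. }
assert (W3 : crd3 (res4 s u) = RtoC s *v w -v H (crd1 u)).
{ change (RtoC s *v rr (s ^ 2) (crd3 u) -v Q s (crd1 u) = RtoC s *v w -v H (crd1 u)).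
  unfold w; rewrite Q_eq, (rr_plus X _ _ _ HF), (rr_scal X _ _ _ HF) by exact Hs2.
  replace (s ^ 2) with (s * s) at 2 by ring; vring X. }
assert (Aw : forall z, A w z <-> z = crd3 u +v RtoC s *v H (crd1 u) -v RtoC (s ^ 2) *v w).
{ assert (R0 : resolvent A (RtoC (s ^ 2)) (crd3 u +v RtoC s *v H (crd1 u)) w)
    by (apply A_resolvent_spec; [exact Hs2 | reflexivity]).
  destruct R0 as [z0 [Hz0 E0]].
  change (crd3 u +v RtoC s *v H (crd1 u) = RtoC (s ^ 2) *v w +v z0) in E0.
  assert (Z0 : z0 = crd3 u +v RtoC s *v H (crd1 u) -v RtoC (s ^ 2) *v w) by (rewrite E0; vring X).
  intros z; rewrite <- Z0; split; [|intros ->; exact Hz0].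
  intros Hz; assert (Fn := proj1 (proj2 hM)); exact (Fn _ _ _ Hz Hz0). }
split.
- intros [z [Hz E]].
  apply Lambda4_spec in Hz; destruct Hz as (Z1 & Z2 & Z3).
  assert (E1 : crd1 u = RtoC s *v crd1 v +v crd1 z) by (rewrite E; reflexivity).
  assert (E2 : crd2 u = RtoC s *v crd2 v +v crd2 z) by (rewrite E; reflexivity).
  assert (E3 : crd3 u = RtoC s *v crd3 v +v crd3 z) by (rewrite E; reflexivity).
  assert (V3 : crd3 v = RtoC s *v H (crd1 v) -v H (crd1 u)).
  { transitivity (vopp (vopp (crd3 v))); [vring X|].
    rewrite <- Z1, E1, H_plus, H_scal; vring X. }
  assert (V1 : H (crd1 v) = w).
  { apply A_resolvent_spec; [exact Hs2|]; exists (crd3 z); split; [exact Z3|].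
    change (crd3 u +v RtoC s *v H (crd1 u) = RtoC (s ^ 2) *v H (crd1 v) +v crd3 z).
    rewrite E3, V3; replace (s ^ 2) with (s * s) by ring; vring X. }
  apply crd_inj.
  + apply H_inj; rewrite W1; exact V1.
  + change (crd2 v = rr s (crd2 u)); apply A_resolvent_spec; [exact Hs|].
    exists (crd2 z); split; [exact Z2 | exact E2].
  + rewrite W3, V3, V1; reflexivity.
- intros ->.
  exists (mk (crd1 u -v RtoC s *v crd1 (res4 s u)) (crd2 u -v RtoC s *v crd2 (res4 s u))
       (crd3 u -v RtoC s *v crd3 (res4 s u))); split.
  + apply Lambda4_spec; split; [|split].
    * change (H (crd1 u -v RtoC s *v crd1 (res4 s u)) = vopp (crd3 (res4 s u))).
      rewrite W3, H_minus, H_scal, W1; vring X.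
    * change (A (rr s (crd2 u)) (crd2 u -v RtoC s *v rr s (crd2 u))).
      assert (R0 : resolvent A (RtoC s) (crd2 u) (rr s (crd2 u)))
        by (apply A_resolvent_spec; [exact Hs | reflexivity]).
      destruct R0 as [z0 [Hz0 E0]]; change (crd2 u = RtoC s *v rr s (crd2 u) +v z0) in E0.
      replace (crd2 u -v RtoC s *v rr s (crd2 u)) with z0; [exact Hz0|].
      rewrite E0 at 1; vring X.
    * change (A (H (crd1 (res4 s u))) (crd3 u -v RtoC s *v crd3 (res4 s u))).
      rewrite W1; apply Aw; rewrite W3; replace (s ^ 2) with (s * s) by ring; vring X.
  + apply crd_inj.
    * change (crd1 u = RtoC s *v crd1 (res4 s u) +v (crd1 u -v RtoC s *v crd1 (res4 s u))); vring X.
    * change (crd2 u = RtoC s *v crd2 (res4 s u) +v (crd2 u -v RtoC s *v crd2 (res4 s u))); vring X.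
    * change (crd3 u = RtoC s *v crd3 (res4 s u) +v (crd3 u -v RtoC s *v crd3 (res4 s u))); vring X.
Qed.

(** The bounds of a diagonal and an off-diagonal entry, for three coordinates, times the constant
    [K + 1] of the equivalence of norms; the last 1 ensures a constant at least 1. *)
Definition bound4 : R := (K + 1) * (3 * (4 * (K * (1 + K)) + 2 * K)) + 1.

Lemma res4_norm s u : 0 <= s -> (1 + s) * norm (res4 s u) <= bound4 * norm u.
Proof.
intros Hs; assert (HK := K_ge0).
assert (H1 := norm_crd1 u); assert (H2 := norm_crd2 u); assert (H3 := norm_crd3 u).
set (N := norm u) in *.
assert (HN : 0 <= N) by exact (norm_ge_0 u).
set (D := 4 * (K * (1 + K)) + 2 * K).
assert (HKK : 0 <= K * (1 + K)) by (apply Rmult_le_pos; lra).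
assert (Db : forall c x, 0 <= c -> norm (x : X) <= N -> c * norm x <= c * N)
  by (intros; apply Rmult_le_compat_l; assumption).
assert (E : forall x y z : X, norm y <= N -> norm z <= N ->
   norm x <= norm (RtoC s *v rr (s ^ 2) y) + norm (Q s z) -> (1 + s) * norm x <= D * N).
{ intros x y z Hy Hz Hx.
  assert (S1 := scal_res_square_norm X _ _ _ HF s y Hs).
  assert (S2 := sqrt_res_norm X _ _ _ HF s z Hs).
  fold K in S1, S2.
  apply (Rmult_le_compat_l (1 + s)) in Hx; [|lra].
  assert (S3 := Db (2 * K) y ltac:(lra) Hy).
  assert (S4 := Db (4 * (K * (1 + K))) z ltac:(lra) Hz).
  unfold D; lra. }
assert (C1 : (1 + s) * norm (crd1 (res4 s u)) <= D * N).
{ apply (E _ (crd1 u) (crd3 u)); try assumption; apply norm_plus_le. }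
assert (C3 : (1 + s) * norm (crd3 (res4 s u)) <= D * N).
{ apply (E _ (crd3 u) (crd1 u)); try assumption; apply norm_minus_le. }
assert (C2 : (1 + s) * norm (crd2 (res4 s u)) <= D * N).
{ eapply Rle_trans; [exact (rr_norm X _ _ _ HF s (crd2 u) Hs)|].
  fold K; eapply Rle_trans; [apply Db; assumption|].
  apply Rmult_le_compat_r; [exact HN | unfold D; lra]. }
assert (L := norm_le_crd (res4 s u)).
apply (Rmult_le_compat_l (1 + s)) in L; [|lra].
apply Rle_trans with ((K + 1) * (3 * (D * N))).
- eapply Rle_trans; [exact L|].
  replace ((1 + s) * ((K + 1) * (norm (crd1 (res4 s u)) + norm (crd2 (res4 s u)) + norm (crd3 (res4 s u)))))
    with ((K + 1) * ((1 + s) * norm (crd1 (res4 s u)) + (1 + s) * norm (crd2 (res4 s u)) + (1 + s) * norm (crd3 (res4 s u)))) by ring.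
  apply Rmult_le_compat_l; lra.
- unfold bound4; fold D; replace ((K + 1) * (3 * (D * N))) with ((K + 1) * (3 * D) * N) by ring; lra.
Qed.

Lemma bound4_ge1 : 1 <= bound4.
Proof.
assert (HK := K_ge0); unfold bound4.
assert (0 <= K * (1 + K)) by (apply Rmult_le_pos; lra).
assert (0 <= (K + 1) * (3 * (4 * (K * (1 + K)) + 2 * K))) by (apply Rmult_le_pos; lra); lra.
Qed.

Lemma res4_linear s : 0 <= s -> is_linear (res4 s).
Proof.
intros Hs; assert (Hs2 := pow2_ge_0 s); split.
- intros u v; apply crd_inj.
  + change (RtoC s *v rr (s ^ 2) (crd1 u +v crd1 v) +v Q s (crd3 u +v crd3 v)
      = (RtoC s *v rr (s ^ 2) (crd1 u) +v Q s (crd3 u)) +v (RtoC s *v rr (s ^ 2) (crd1 v) +v Q s (crd3 v))).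
    rewrite (rr_plus X _ _ _ HF), (sqrt_res_plus X _ _ _ HF) by exact Hs2; vring X.
  + exact (rr_plus X _ _ _ HF s (crd2 u) (crd2 v) Hs).
  + change (RtoC s *v rr (s ^ 2) (crd3 u +v crd3 v) -v Q s (crd1 u +v crd1 v)
      = (RtoC s *v rr (s ^ 2) (crd3 u) -v Q s (crd1 u)) +v (RtoC s *v rr (s ^ 2) (crd3 v) -v Q s (crd1 v))).
    rewrite (rr_plus X _ _ _ HF), (sqrt_res_plus X _ _ _ HF) by exact Hs2; vring X.
- intros c u; apply crd_inj.
  + change (RtoC s *v rr (s ^ 2) (c *v crd1 u) +v Q s (c *v crd3 u)
      = c *v (RtoC s *v rr (s ^ 2) (crd1 u) +v Q s (crd3 u))).
    rewrite (rr_scal X _ _ _ HF), (sqrt_res_scal X _ _ _ HF) by exact Hs2; vring X.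
  + exact (rr_scal X _ _ _ HF s c (crd2 u) Hs).
  + change (RtoC s *v rr (s ^ 2) (c *v crd3 u) -v Q s (c *v crd1 u)
      = c *v (RtoC s *v rr (s ^ 2) (crd3 u) -v Q s (crd1 u))).
    rewrite (rr_scal X _ _ _ HF), (sqrt_res_scal X _ _ _ HF) by exact Hs2; vring X.
- exists bound4; split; [generalize bound4_ge1; lra|].
  intros u; eapply Rle_trans; [|apply (res4_norm s u Hs)].
  rewrite <- (Rmult_1_l (norm (res4 s u))) at 1; apply Rmult_le_compat_r; [apply norm_ge_0 | lra].
Qed.

Lemma Lambda4_inverse u v : Lambda4 A u v <-> u = res4 0 v.
Proof.
rewrite <- (resolvent4_spec 0 v u (Rle_refl 0)); split.
- intros Hu; exists v; split; [exact Hu|].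
  change (v = RtoC 0 *v u +v v); vring (Xhalf3 A).
- intros [w [Hw E]]; change (v = RtoC 0 *v u +v w) in E.
  replace v with w; [exact Hw|]; rewrite E; vring (Xhalf3 A).
Qed.

Lemma A_dense (x : X) eps : 0 < eps -> exists y, norm (rr 0 y -v x) < eps.
Proof.
intros He; assert (D := proj1 (proj2 (proj2 (proj2 hM)))).
destruct (D x eps He) as (w & [y Hy] & Hw); exists y.
apply A_spec in Hy; rewrite <- Hy; exact Hw.
Qed.

Lemma Lambda4_dense : densely_defined (Lambda4 A).
Proof.
intros u eps He; assert (HK := K_ge0).
set (d := eps / (3 * (K + 1))).
assert (Hd : 0 < d) by (apply Rdiv_lt_0_compat; lra).
destruct (A_dense (crd1 u) d Hd) as [y1 H1].
destruct (A_dense (crd2 u) d Hd) as [y2 H2].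
destruct (A_dense (crd3 u) d Hd) as [y3 H3].
exists (mk (rr 0 y1) (rr 0 y2) (rr 0 y3)); split.
(* The image: its first coordinate is [A^(1/2)] of minus the third component, that is
   [- A^(-1/2) y3]. *)
- exists (mk (vopp (H y3)) y2 (H y1)); apply Lambda4_spec; split; [|split].
  + change (H (vopp (H y3)) = vopp (rr 0 y3)).
    replace (vopp (H y3)) with ((- RtoC 1)%C *v H y3) by vring X.
    rewrite H_scal, (neg_sqrt_square X _ _ _ HF); vring X.
  + apply A_spec; reflexivity.
  + apply A_spec; change (H (rr 0 y1) = rr 0 (H y1)); rewrite H_rr by lra; reflexivity.
- refine (Rle_lt_trans _ _ _ (norm_le_crd (mk (rr 0 y1) (rr 0 y2) (rr 0 y3) -v u)) _).
  change ((K + 1) * (norm (rr 0 y1 -v crd1 u) + norm (rr 0 y2 -v crd2 u) + norm (rr 0 y3 -v crd3 u)) < eps).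
  replace eps with ((K + 1) * (d + d + d)) by (unfold d; field; lra).
  apply Rmult_lt_compat_l; lra.
Qed.

Theorem Lambda4_positive : positive_op (Lambda4 A).
Proof.
exists bound4; split; [apply bound4_ge1|]; split; [|split; [|split; [|split]]].
- intros u v v' Hv Hv'; apply Lambda4_spec in Hv; apply Lambda4_spec in Hv'.
  destruct Hv as (V1 & V2 & V3), Hv' as (V1' & V2' & V3').
  assert (Fn := proj1 (proj2 hM)).
  apply crd_inj; [apply H_inj; rewrite V1, V1'; reflexivity | |]; eapply Fn; eassumption.
- apply (closed_graph_inverse U (Lambda4 A) (res4 0) (res4_linear 0 (Rle_refl 0)) Lambda4_inverse).
- exact Lambda4_dense.
- intros s Hs; exists (res4 s); split; [apply res4_linear, Hs|].
  intros u v; rewrite resolvent4_spec by exact Hs; split; intros E; symmetry; exact E.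
- intros s Hs u v Hv; apply resolvent4_spec in Hv; [|lra]; subst v.
  apply res4_norm; lra.
Qed.

End Lambda4.

(** * Fractional powers of [Lambda4] *)

Section Powers.
Variables (X : CBanach) (A : lrel X X) (M : R).
Hypothesis hM : positive_with A M.
Variable a : R.
Hypothesis Ha : 0 < a < 1.

Let hA : positive_op A := ex_intro _ M hM.
Let HF := res_family X A M hM.

Notation G b := (neg_frac X (res X A) b 0).
Notation B := (frac_power A (1 / 2)).
Notation U := (Xhalf3 A).
Notation k1 := (crd1 X A).
Notation k2 := (crd2 X A).
Notation k3 := (crd3 X A).
Notation H := (G (1 / 2)).
Notation co := (sqrt_coord X A).
Notation gr := (graph_of X A M hM).

Let c := RtoC (cos (PI * a / 2)).
Let s := RtoC (sin (PI * a / 2)).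

Lemma Xhalf3_complete : is_complete U.
Proof.
apply (is_complete_prod (prod_UniformSpace (Xpow A (1 / 2)) X) X); [|apply is_complete_CBanach].
apply (is_complete_prod (Xpow A (1 / 2)) X); [|apply is_complete_CBanach].
apply is_complete_graph; [apply is_complete_CBanach .. |].
apply (closed_graph_inverse X B H).
- apply (neg_frac_linear X _ _ _ HF _ half_bounds); lra.
- exact (sqrt_spec X A M hM).
Qed.

Definition V4 : CBanach := make_complete U Xhalf3_complete.

Lemma V4_positive : positive_op (U := V4) (Lambda4 A).
Proof. exact (Lambda4_positive X A M hM). Qed.

Lemma res_V4 t (u : V4) : 0 <= t -> res V4 (Lambda4 A) (RtoC t) u = res4 X A M hM t u.
Proof.
intros Ht; destruct V4_positive as [M4 h4].
symmetry; apply (res_spec V4 (Lambda4 A) M4 h4); [apply (near_halfline_nonneg V4 (Lambda4 A) M4 h4), Ht|].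
apply (resolvent4_spec X A M hM t u); [exact Ht | reflexivity].
Qed.

Lemma G_plus b x y : 0 < b < 1 -> G b (x +v y) = G b x +v G b y.
Proof. intros Hb; apply (neg_frac_plus X _ _ _ HF _ Hb); lra. Qed.

Lemma G_minus b x y : 0 < b < 1 -> G b (x -v y) = G b x -v G b y.
Proof. intros Hb; apply (neg_frac_minus X _ _ _ HF _ Hb); lra. Qed.

Lemma G_scal b z x : 0 < b < 1 -> G b (z *v x) = z *v G b x.
Proof. intros Hb; apply (neg_frac_scal X _ _ _ HF _ Hb); lra. Qed.

Lemma Ha2 : 0 < a / 2 < 1. Proof. lra. Qed.

(** One computation for the first and the third coordinate, which differ by the sign [sg] of the
    off-diagonal entry. *)
Lemma neg_power_entries (y p q : X) (Y : V4) (L : V4 -> X) sg :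
  is_linear L -> (sg = RtoC 1 \/ sg = RtoC (-1)) ->
  (forall t : R, 0 <= t -> L (res4 X A M hM t Y)
     = RtoC t *v res X A (RtoC (t ^ 2)) p +v sg *v sqrt_res X (res X A) t q) ->
  L (neg_frac V4 (res V4 (Lambda4 A)) a 0 Y) = G (a / 2) (c *v p +v (sg * s)%C *v q).
Proof.
intros HL Hsg HE.
assert (Hss : (sg * sg = 1)%C).
{ destruct Hsg as [-> | ->]; apply injective_projections; simpl; ring. }
destruct V4_positive as [M4 h4].
set (Z := neg_frac V4 (res V4 (Lambda4 A)) a 0 Y).
assert (W := neg_frac_int V4 _ _ _ (res_family V4 (Lambda4 A) M4 h4) a Ha 0 Y (Rle_refl 0)).
fold Z in W.
apply (is_int_lin V4 minf pinf X L _ _ HL) in W.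
assert (EL : L (RtoC (kappa a) *v Z) = RtoC (kappa a) *v L Z) by exact (linear_scal L HL _ _).
rewrite EL in W.
assert (D := is_int_diagonal X _ _ _ HF a Ha p).
assert (E := is_int_scal X minf pinf sg _ _ (is_int_minus X minf pinf _ _ _ _ W D)).
(* The off-diagonal integral converges as the difference of the whole integral and the diagonal one;
   multiplying by [sg] undoes the sign, as [sg * sg = 1]. *)
assert (O : sg *v (L Z -v c *v G (a / 2) p) = s *v G (a / 2) q).
{ apply (is_int_off_diagonal X _ _ _ HF a Ha q).
  replace (RtoC (kappa a) *v (sg *v (L Z -v c *v G (a / 2) p)))
    with (sg *v (RtoC (kappa a) *v L Z -v RtoC (kappa a) *v (c *v G (a / 2) p))) by vring X.
  refine (is_int_ext X minf pinf _ _ _ _ E); intros t; cbv beta.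
  assert (Et := exp_pos t).
  transitivity (sg *v (RtoC (exp ((1 - a) * t)) *v L (res4 X A M hM (exp t) Y)
     -v RtoC (exp ((1 - a) * t)) *v (RtoC (exp t) *v res X A (RtoC (exp t ^ 2)) p))).
  - f_equal; f_equal; rewrite Rplus_0_r, res_V4 by lra; exact (linear_scal L HL _ _).
  - rewrite HE by lra.
    transitivity ((sg * sg)%C *v (RtoC (exp ((1 - a) * t)) *v sqrt_res X (res X A) (exp t) q));
      [vring X | rewrite Hss; vring X]. }
rewrite G_plus, !G_scal by exact Ha2.
transitivity ((sg * sg)%C *v (L Z -v c *v G (a / 2) p) +v c *v G (a / 2) p); [rewrite Hss; vring X|].
transitivity (sg *v (sg *v (L Z -v c *v G (a / 2) p)) +v c *v G (a / 2) p); [vring X|].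
rewrite O; vring X.
Qed.

Theorem Lambda4_neg_power u v :
  frac_power (Lambda4 A) (- a) u v <->
  k1 v = G (a / 2) (c *v k1 u +v s *v k3 u) /\ k2 v = G a (k2 u) /\
  k3 v = G (a / 2) (c *v k3 u -v s *v k1 u).
Proof.
set (Y := neg_frac V4 (res V4 (Lambda4 A)) a 0 u).
assert (Y1 : k1 Y = G (a / 2) (c *v k1 u +v s *v k3 u)).
{ transitivity (G (a / 2) (c *v k1 u +v (RtoC 1 * s)%C *v k3 u)); [|f_equal; vring X].
  apply (neg_power_entries (k3 u) (k1 u) (k3 u) u k1); [exact (crd1_linear X A) | auto |].
  intros t Ht.
  change (RtoC t *v res X A (RtoC (t ^ 2)) (k1 u) +v sqrt_res X (res X A) t (k3 u)
    = RtoC t *v res X A (RtoC (t ^ 2)) (k1 u) +v RtoC 1 *v sqrt_res X (res X A) t (k3 u)).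
  vring X. }
assert (Y3 : k3 Y = G (a / 2) (c *v k3 u -v s *v k1 u)).
{ transitivity (G (a / 2) (c *v k3 u +v (RtoC (-1) * s)%C *v k1 u)).
  2:{ f_equal; vlin X; apply injective_projections; simpl; ring. }
  apply (neg_power_entries (k3 u) (k3 u) (k1 u) u k3); [exact (crd3_linear X A) | auto |].
  intros t Ht.
  change (RtoC t *v res X A (RtoC (t ^ 2)) (k3 u) -v sqrt_res X (res X A) t (k1 u)
    = RtoC t *v res X A (RtoC (t ^ 2)) (k3 u) +v RtoC (-1) *v sqrt_res X (res X A) t (k1 u)).
  vlin X; apply injective_projections; simpl; ring. }
assert (Y2 : k2 Y = G a (k2 u)).
{ symmetry; apply (neg_frac_unique X _ _ _ HF a Ha); [lra|].
  destruct V4_positive as [M4 h4].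
  assert (W := neg_frac_int V4 _ _ _ (res_family V4 (Lambda4 A) M4 h4) a Ha 0 u (Rle_refl 0)).
  apply (is_int_lin V4 minf pinf X k2 _ _ (crd2_linear X A)) in W.
  refine (is_int_ext X minf pinf _ _ _ _ W); intros t; cbv beta.
  rewrite Rplus_0_r, res_V4 by (apply Rlt_le, exp_pos); reflexivity. }
transitivity (v = Y).
- exact (frac_power_neg V4 (Lambda4 A) a u v V4_positive Ha).
- rewrite <- Y1, <- Y2, <- Y3; split; [intros ->; auto | intros (E1 & E2 & E3)].
  apply (crd_inj X A M hM); assumption.
Qed.

Lemma Lambda4_neg_power_bounded : bounded_op (frac_power (Lambda4 A) (- a)).
Proof.
destruct V4_positive as [M4 h4].
exists (neg_frac V4 (res V4 (Lambda4 A)) a 0); split.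
- exact (neg_frac_linear V4 _ _ _ (res_family V4 (Lambda4 A) M4 h4) a Ha 0 (Rle_refl 0)).
- intros u v.
  refine (iff_trans (frac_power_neg V4 (Lambda4 A) a u v V4_positive Ha) _).
  split; intros E; symmetry; exact E.
Qed.

Lemma c_s_unit : (c * c + s * s = 1)%C.
Proof.
unfold c, s; rewrite <- !RtoC_mult, <- RtoC_plus; f_equal.
generalize (sin2_cos2 (PI * a / 2)); unfold Rsqr; lra.
Qed.

Theorem Lambda4_pos_power u v :
  frac_power (Lambda4 A) a u v <->
  k1 u = G (a / 2) (c *v k1 v +v s *v k3 v) /\ k2 u = G a (k2 v) /\
  k3 u = G (a / 2) (c *v k3 v -v s *v k1 v).
Proof. rewrite frac_power_swap by lra; apply Lambda4_neg_power. Qed.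

Lemma P_pos b x y : 0 < b < 1 -> frac_power A b x y <-> x = G b y.
Proof. apply (frac_power_pos X A b x y hA). Qed.

Lemma P_neg b x y : 0 < b < 1 -> frac_power A (- b) x y <-> y = G b x.
Proof. apply (frac_power_neg X A b x y hA). Qed.

Lemma G_inj b x y : 0 < b < 1 -> G b x = G b y -> x = y.
Proof. apply (neg_frac_inj X _ _ _ HF). Qed.

Lemma G_H x : G ((1 + a) / 2) x = H (G (a / 2) x).
Proof.
rewrite (neg_frac_semigroup X _ _ _ HF (1 / 2) (a / 2)) by lra.
f_equal; field.
Qed.

Lemma G_H' x : G ((1 - a) / 2) (G (a / 2) x) = H x.
Proof.
rewrite (neg_frac_semigroup X _ _ _ HF ((1 - a) / 2) (a / 2)) by lra.
f_equal; field.
Qed.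

Lemma H_G x : G (a / 2) (H x) = H (G (a / 2) x).
Proof. apply (neg_frac_neg_frac_comm X _ _ _ HF); lra. Qed.

(* The matrix entries act between [Xpow A (1/2)] and [X] through
   [graph_incl = A^(-1/2) o sqrt_coord]. *)
Theorem neg_power_matrix u v :
  frac_power (Lambda4 A) (- a) u v <->
  lmat3
    (to_graph B (from_graph B (lscal c (frac_power A (- (a / 2))))))
    lzero
    (to_graph B (lscal s (frac_power A (- ((a + 1) / 2)))))
    lzero
    (frac_power A (- a))
    lzero
    (from_graph B (lscal (- s)%C (frac_power A ((1 - a) / 2))))
    lzero
    (lscal c (frac_power A (- (a / 2)))) u v.
Proof.
rewrite Lambda4_neg_power.
assert (Ga := Ha2).
destruct u as [[p y] z], v as [[p' y'] z'].
unfold crd1, crd2, crd3; cbn [fst snd].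
assert (Ip := incl_coord X A M hM p).
split.
- intros (E1 & E2 & E3); split; [|split]; cbn [fst snd].
  + exists (gr (c *v G (a / 2) (co p))), vzero, (gr (s *v G (a / 2) z)).
    split; [|split; [reflexivity | split]].
    * exists (G (a / 2) (graph_incl p)); split; [apply P_neg; [exact Ga | reflexivity]|].
      change (H (c *v G (a / 2) (co p)) = c *v G (a / 2) (graph_incl p)).
      rewrite Ip, H_G, G_scal by exact half_bounds; reflexivity.
    * exists (G ((a + 1) / 2) z); split; [apply P_neg; [lra | reflexivity]|].
      change (H (s *v G (a / 2) z) = s *v G ((a + 1) / 2) z).
      rewrite (Rplus_comm a 1), G_H, G_scal by exact half_bounds; reflexivity.
    * apply (coord_inj X A M hM).
      change (co p' = c *v G (a / 2) (co p) +v vzero +v s *v G (a / 2) z).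
      rewrite E1, G_plus, !G_scal by exact Ga; vring X.
  + exists vzero, y', vzero; split; [reflexivity | split; [|split; [reflexivity|]]].
    * apply P_neg; [exact Ha | exact E2].
    * change (y' = vzero +v y' +v vzero); vring X.
  + exists ((- s)%C *v G (a / 2) (co p)), vzero, (c *v G (a / 2) z).
    split; [|split; [reflexivity | split]].
    * exists (G (a / 2) (co p)); split; [|reflexivity].
      apply P_pos; [lra|]; rewrite G_H'; exact Ip.
    * exists (G (a / 2) z); split; [apply P_neg; [exact Ga | reflexivity] | reflexivity].
    * change (z' = (- s)%C *v G (a / 2) (co p) +v vzero +v c *v G (a / 2) z).
      rewrite E3, G_minus, !G_scal by exact Ga; vring X.
- intros [R1 [R2 R3]].
  destruct R1 as (a1 & a2 & a3 & [q1 [Q1 F1]] & Z1 & [q3 [Q3 F3]] & E1).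
  destruct R2 as (b1 & b2 & b3 & Z2 & I2 & Z3 & E2).
  destruct R3 as (d1 & d2 & d3 & [m1 [N1 J1]] & Z4 & [m3 [N3 J3]] & E3).
  cbn [fst snd] in *; hnf in Z1, Z2, Z3, Z4; subst a2 b1 b3 d1 d2 d3 p' y' z'.
  apply P_neg in Q1; [|exact Ga]; apply P_neg in Q3; [|lra].
  apply P_neg in I2; [|exact Ha]; apply P_neg in N3; [|exact Ga].
  apply P_pos in N1; [|lra]; subst q1 q3 b2 m3.
  assert (C1 : co a1 = c *v G (a / 2) (co p)).
  { apply (G_inj (1 / 2)); [exact half_bounds|].
    rewrite <- (incl_coord X A M hM a1), F1, Ip, H_G, G_scal by exact half_bounds; reflexivity. }
  assert (C3 : co a3 = s *v G (a / 2) z).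
  { apply (G_inj (1 / 2)); [exact half_bounds|].
    rewrite <- (incl_coord X A M hM a3), F3, (Rplus_comm a 1), G_H, G_scal by exact half_bounds; reflexivity. }
  assert (D1 : m1 = G (a / 2) (co p)).
  { apply (G_inj ((1 - a) / 2)); [lra|].
    rewrite G_H', <- N1; exact Ip. }
  split; [|split].
  + change (co a1 +v vzero +v co a3 = G (a / 2) (c *v co p +v s *v z)).
    rewrite C1, C3, G_plus, !G_scal by exact Ga; vring X.
  + change (vzero +v G a y +v vzero = G a y); vring X.
  + change ((- s)%C *v m1 +v vzero +v c *v G (a / 2) z = G (a / 2) (c *v z -v s *v co p)).
    rewrite D1, G_minus, !G_scal by exact Ga; vring X.
Qed.

(** The inverse of a rotation is its transpose; [c_s_unit] is the only property of the angle
    involved. *)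
Lemma rotation (x y m n : X) :
  x = c *v m -v s *v n -> y = s *v m +v c *v n ->
  m = c *v x +v s *v y /\ n = c *v y -v s *v x.
Proof.
intros -> ->; split.
- transitivity ((c * c + s * s)%C *v m); [rewrite c_s_unit; vring X | vring X].
- transitivity ((c * c + s * s)%C *v n); [rewrite c_s_unit; vring X | vring X].
Qed.

(** [Lambda4_pos_power] describes the inverse through combinations of coordinates of [v]. Undoing
    the rotation by [m] and [n] makes every entry defined separately, as the natural domain of the
    matrix requires. *)
Theorem pos_power_matrix u v :
  frac_power (Lambda4 A) a u v <->
  lmat3
    (to_graph B (from_graph B (lscal c (frac_power A (a / 2)))))
    lzero
    (to_graph B (lscal (- s)%C (frac_power A ((a - 1) / 2))))
    lzero
    (frac_power A a)
    lzero
    (from_graph B (lscal s (frac_power A ((1 + a) / 2))))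
    lzero
    (lscal c (frac_power A (a / 2))) u v.
Proof.
rewrite Lambda4_pos_power.
assert (Ga := Ha2).
replace ((a - 1) / 2) with (- ((1 - a) / 2)) by field.
destruct u as [[p y] z], v as [[p' y'] z'].
unfold crd1, crd2, crd3; cbn [fst snd].
assert (Ip := incl_coord X A M hM p).
split.
- intros (E1 & E2 & E3).
  (* [m] is [A^((1 + a) / 2)] of the first component of [u] and [n] is [A^(a / 2)] of the third. *)
  set (m := c *v co p' +v s *v z') in *; set (n := c *v z' -v s *v co p') in *.
  assert (Dp : co p' = c *v m -v s *v n).
  { transitivity ((c * c + s * s)%C *v co p'); [rewrite c_s_unit; vring X | unfold m, n; vring X]. }
  assert (Dz : z' = s *v m +v c *v n).
  { transitivity ((c * c + s * s)%C *v z'); [rewrite c_s_unit; vring X | unfold m, n; vring X]. }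
  split; [|split]; cbn [fst snd].
  + exists (gr (c *v m)), vzero, (gr ((- s)%C *v n)).
    split; [|split; [reflexivity | split]].
    * exists (H m); split.
      -- apply P_pos; [exact Ga|]; rewrite H_G, <- E1; exact Ip.
      -- change (H (c *v m) = c *v H m); apply G_scal, half_bounds.
    * exists (G ((1 - a) / 2) z); split; [apply P_neg; [lra | reflexivity]|].
      change (H ((- s)%C *v n) = (- s)%C *v G ((1 - a) / 2) z).
      rewrite E3, G_H'; apply G_scal, half_bounds.
    * apply (coord_inj X A M hM).
      change (co p' = c *v m +v vzero +v (- s)%C *v n); rewrite Dp; vring X.
  + exists vzero, y', vzero; split; [reflexivity | split; [|split; [reflexivity|]]].
    * apply P_pos; [exact Ha | exact E2].
    * change (y' = vzero +v y' +v vzero); vring X.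
  + exists (s *v m), vzero, (c *v n); split; [|split; [reflexivity | split]].
    * exists m; split; [|reflexivity].
      apply P_pos; [lra|]; rewrite G_H, <- E1; exact Ip.
    * exists n; split; [apply P_pos; [exact Ga | exact E3] | reflexivity].
    * change (z' = s *v m +v vzero +v c *v n); rewrite Dz; vring X.
- intros [R1 [R2 R3]].
  destruct R1 as (a1 & a2 & a3 & [q1 [Q1 F1]] & Z1 & [q3 [Q3 F3]] & E1).
  destruct R2 as (b1 & b2 & b3 & Z2 & I2 & Z3 & E2).
  destruct R3 as (d1 & d2 & d3 & [m [N1 J1]] & Z4 & [n [N3 J3]] & E3).
  cbn [fst snd] in *; hnf in Z1, Z2, Z3, Z4; subst a2 b1 b3 d1 d2 d3 p' y' z'.
  apply P_pos in Q1; [|exact Ga]; apply P_neg in Q3; [|lra].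
  apply P_pos in I2; [|exact Ha]; apply P_pos in N3; [|exact Ga].
  apply P_pos in N1; [|lra].
  assert (Cp : co p = G (a / 2) m).
  { apply (G_inj (1 / 2)); [exact half_bounds|].
    rewrite <- G_H, <- N1; symmetry; exact Ip. }
  (* Entries (1,1) and (3,1) act on the same vector: [q1] is [A^(-1/2) m], which puts it in
     [X^(1/2)] and gives its coordinate. *)
  assert (C1 : co a1 = c *v m).
  { apply (G_inj (1 / 2)); [exact half_bounds|].
    rewrite <- (incl_coord X A M hM a1), F1, G_scal by exact half_bounds.
    change (c *v q1 = c *v H m); f_equal; apply (G_inj (a / 2)); [exact Ga|].
    change (graph_incl p = G (a / 2) q1) in Q1.
    rewrite H_G, <- Cp, <- Q1; exact Ip. }
  assert (C3 : co a3 = (- s)%C *v n).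
  { apply (G_inj (1 / 2)); [exact half_bounds|].
    rewrite <- (incl_coord X A M hM a3), F3, G_scal, Q3, N3, G_H' by exact half_bounds; reflexivity. }
  destruct (rotation (co a1 +v vzero +v co a3) (s *v m +v vzero +v c *v n) m n) as [Rm Rn].
  { rewrite C1, C3; vring X. }
  { vring X. }
  split; [|split].
  + change (co p = G (a / 2) (c *v (co a1 +v vzero +v co a3) +v s *v (s *v m +v vzero +v c *v n))).
    rewrite <- Rm; exact Cp.
  + change (y = G a (vzero +v b2 +v vzero)).
    replace (vzero +v b2 +v vzero) with b2 by vring X; exact I2.
  + change (z = G (a / 2) (c *v (s *v m +v vzero +v c *v n) -v s *v (co a1 +v vzero +v co a3))).
    rewrite <- Rn; exact N3.
Qed.

Theorem pos_power_domain x1 x2 x3 :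
  (exists u : Xpow A (1 / 2), graph_incl u = x1 /\ dom (frac_power (Lambda4 A) a) (u, x2, x3)) <->
  dom (frac_power A ((1 + a) / 2)) x1 /\ dom (frac_power A a) x2 /\ dom (frac_power A (a / 2)) x3.
Proof.
assert (Ga := Ha2); split.
- intros [u [<- [v Hv]]].
  apply Lambda4_pos_power in Hv; destruct Hv as (E1 & E2 & E3).
  split; [|split]; eexists; (apply P_pos; [lra|]).
  + rewrite (incl_coord X A M hM u), G_H; exact (f_equal (fun w => H w) E1).
  + exact E2.
  + exact E3.
- intros ([m Hm] & [y Hy] & [n Hn]).
  apply P_pos in Hm; [|lra]; apply P_pos in Hy; [|exact Ha]; apply P_pos in Hn; [|exact Ga].
  exists (gr (G (a / 2) m)); split.
  + change (H (G (a / 2) m) = x1); rewrite <- G_H; symmetry; exact Hm.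
  (* The value at the chosen point has as first and third coordinates the rotated pair [(m, n)]. *)
  + destruct (rotation (c *v m -v s *v n) (s *v m +v c *v n) m n eq_refl eq_refl) as [Rm Rn].
    exists (mk X A M hM (c *v m -v s *v n) y (s *v m +v c *v n)).
    apply Lambda4_pos_power; split; [|split].
    * change (G (a / 2) m = G (a / 2) (c *v (c *v m -v s *v n) +v s *v (s *v m +v c *v n))).
      rewrite <- Rm; reflexivity.
    * exact Hy.
    * change (x3 = G (a / 2) (c *v (s *v m +v c *v n) -v s *v (c *v m -v s *v n))).
      rewrite <- Rn; exact Hn.
Qed.

End Powers.

Theorem theorem3p11 (X : CompleteNormedModule C_AbsRing) (A : lrel X X)
    (hA : positive_op A) (alpha : R) (halpha : 0 < alpha < 1) :
  let P := frac_power A in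
  let B := P (1 / 2) in
  let c := RtoC (cos (PI * alpha / 2)) in
  let s := RtoC (sin (PI * alpha / 2)) in
  (lrel_eq (frac_power (Lambda4 A) (- alpha))
     (lmat3
        (to_graph B (from_graph B (lscal c (P (- (alpha / 2))))))
        lzero
        (to_graph B (lscal s (P (- ((alpha + 1) / 2)))))
        lzero
        (P (- alpha))
        lzero
        (from_graph B (lscal (- s)%C (P ((1 - alpha) / 2))))
        lzero
        (lscal c (P (- (alpha / 2)))))
   /\ bounded_op (frac_power (Lambda4 A) (- alpha)))
  /\
  (lrel_eq (frac_power (Lambda4 A) alpha)
     (lmat3
        (to_graph B (from_graph B (lscal c (P (alpha / 2)))))
        lzero
        (to_graph B (lscal (- s)%C (P ((alpha - 1) / 2))))
        lzero
        (P alpha)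
        lzero
        (from_graph B (lscal s (P ((1 + alpha) / 2))))
        lzero
        (lscal c (P (alpha / 2))))
   /\ forall x1 x2 x3 : X,
        (exists u : Xpow A (1 / 2),
           graph_incl u = x1 /\ dom (frac_power (Lambda4 A) alpha) (u, x2, x3))
        <->
        dom (P ((1 + alpha) / 2)) x1 /\ dom (P alpha) x2
          /\ dom (P (alpha / 2)) x3).
Proof.
destruct hA as [M hM]; intros P B c s; split; split.
- exact (neg_power_matrix X A M hM alpha halpha).
- exact (Lambda4_neg_power_bounded X A M hM alpha halpha).
- exact (pos_power_matrix X A M hM alpha halpha).
- exact (pos_power_domain X A M hM alpha halpha).
Qed.
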